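(* All zeros and poles of the meromorphic function $f$ are simple and lie in $]-\infty,0]$. The zeros of $f$ are exactly $\xi_0=0$ together with, for each $p=1,2,\dots$, exactly $2^{p-1}$ zeros $\xi_{p,1}<\xi_{p,2}<\cdots<\xi_{p,2^{p-1}}$ lying in the open interval $]-p-1,-p[$. The poles of $f$ are exactly the points $-l$ and $\xi_{p,k}-l$ for $l=1,2,\dots$, $p\ge1$, $1\le k\le 2^{p-1}$. The numbers $$\rho_0=\frac{1}{f'(0)},\qquad \rho_{p,k}=\frac{1}{f'(\xi_{p,k})}$$ are strictly positive, and for $z\in\mathbb C$ (away from poles) $$F(z)=\frac{\rho_0}{z+1}+\sum_{p=1}^\infty\sum_{k=1}^{2^{p-1}}\frac{\rho_{p,k}}{z+1-\xi_{p,k}},$$ $$f(z)=z\sum_{l=1}^\infty\left[\frac{\rho_0}{l(z+l)}+\sum_{p=1}^\infty\sum_{k=1}^{2^{p-1}}\frac{\rho_{p,k}}{(l-\xi_{p,k})(z+l-\xi_{p,k})}\right].$$ Moreover $\mu$ is absolutely continuous with respect to Lebesgue measure on $]0,1[$ with an increasing and convex density $$\mathcal D(t)=\rho_0+\sum_{p=1}^\infty\sum_{k=1}^{2^{p-1}}\rho_{p,k}\,t^{-\xi_{p,k}},\qquad 0<t<1.$$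
   Context: Let $(m_n)_{n\ge0}$ be the unique sequence of positive reals with $m_0=1$ and $(1+m_1+\cdots+m_n)\,m_n=1$ for $n\ge1$. It is a Hausdorff moment sequence: let $\mu$ be the unique probability measure on $[0,1]$ with $\int_0^1 t^n\,d\mu(t)=m_n$ for all $n\ge0$; it satisfies $\mu(\{0\})=\mu(\{1\})=0$. For $\Re z>0$ define $f(z)=\int_0^1\frac{1-t^z}{1-t}\,d\mu(t)$ and $F(z)=\int_0^1 t^z\,d\mu(t)$ (with $t^z:=0$ at $t=0$, $\frac{1-t^z}{1-t}:=z$ at $t=1$). These functions extend to meromorphic functions on $\mathbb C$, still denoted $f$ and $F$, satisfying $f(z+1)F(z)=1$ and $f(z)=f(z+1)-1/f(z+1)$ for $z\in\mathbb C$. *)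

(* Defs.v *)
From HB Require Import structures.
From mathcomp Require Import all_boot all_order all_algebra.
From mathcomp Require Import complex.
From mathcomp Require Import all_classical all_reals all_analysis.
Import Order.TTheory GRing.Theory Num.Theory.
Import numFieldNormedType.Exports.

Set Implicit Arguments.
Unset Strict Implicit.
Unset Printing Implicit Defensive.

Local Open Scope classical_set_scope.
Local Open Scope ring_scope.
Local Open Scope complex_scope.

Definition sum_from1 (K : numFieldType) (V : normedModType K)
  (a : nat -> V) (s : V) : Prop :=
  (fun N => \sum_(1 <= n < N) a n) @ \oo --> s.

Section Defs.
Variable R : realType.
Local Notation C := (R[i])^o.

(* complex power t^z for real t > 0 (t^z := exp (z ln t));
   convention t^z := 0 for t <= 0 (only t = 0 matters on [0,1]). *)
Definition cpow (t : R) (z : C) : C :=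
  if 0 < t then
    (expR (@complex.Re R z * ln t) * cos (@complex.Im R z * ln t)) +i*
    (expR (@complex.Re R z * ln t) * sin (@complex.Im R z * ln t))
  else 0.

Definition fker (z : C) (t : R) : C :=
  if t == 1 then z else (1 - cpow t z) / ((1 - t)%:C).

Definition cintegral (mu : {measure set R -> \bar R}) (g : R -> C) : C :=
  (Rintegral mu `[0, 1] (fun t => @complex.Re R (g t))) +i*
  (Rintegral mu `[0, 1] (fun t => @complex.Im R (g t))).

(* f(z) = int_0^1 (1 - t^z)/(1 - t) dmu(t),  F(z) = int_0^1 t^z dmu(t)
   (used for @complex.Re R z > 0) *)
Definition f_int (mu : {measure set R -> \bar R}) (z : C) : C :=
  cintegral mu (fker z).
Definition F_int (mu : {measure set R -> \bar R}) (z : C) : C :=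
  cintegral mu (cpow^~ z).

Definition locally_finite_set (P : set C) : Prop :=
  forall z : C, exists2 r : R, 0 < r &
    forall w : C, P w -> `|w - z| < r%:C -> w = z.

Definition is_pole (g : C -> C) (p : C) : Prop :=
  forall M : R, \forall w \near p^', M%:C <= `|g w|.

Definition meromorphic (g : C -> C) (P : set C) : Prop :=
  [/\ locally_finite_set P,
      (forall z, ~ P z -> derivable g z 1) &
      (forall p, P p -> is_pole g p)].

Definition simple_pole (g : C -> C) (p : C) : Prop :=
  exists2 c : C, c != 0 & (fun w => (w - p) * g w) @ p^' --> c.

Definition csum_from1 (a : nat -> R[i]) (s : R[i]) : Prop :=
  sum_from1 (a : nat -> C) (s : C).
Definition rsum_from1 (a : nat -> R) (s : R) : Prop :=
  sum_from1 (a : nat -> R^o) (s : R^o).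

End Defs.

(* Main.v *)
(*
  The map [psi w = w - 1/w] satisfies [f z = psi (f (z + 1))], and the branch
  [phi > 0] of its inverse gives [m_n = 1/S_(n+1)] with [S_n = phi^n 0].  On the
  positive half-line [f] has to be the inverse of the Abel function
  [A w = lim S_n (phi^n w - S_n)], for which [A (phi w) = A w + 1].

  The reciprocal of [psi^n] is a sum of simple poles at the zeros of [psi^n],
  which are the values at [0] of all compositions of the two inverse branches of
  [psi].  Passing to the limit along the orbit of [X] turns it into
  [1/X = P (A X)] with [P z = sum_b rho_b / (z - xi_b)], where [xi] and [rho] are
  images of these zeros and residues under [A] and its derivative.  Hence
  [P (n + 1) = m_n], and termwise integration shows that the density
  [sum_b rho_b t^(-xi_b)] has the moments [m_n]; a measure on [[0, 1]] is
  determined by its moments, so it is the density of [mu].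

  Consequently [F z = P (z + 1)] and [f (A X) = X] on the positive half-line, and
  the identity theorem extends [f P = 1], [f (z + 1) - f z = P (z + 1)] and
  [F z = P (z + 1)] to the plane.  Zeros, poles and both expansions are then read
  off from [P], whose residues are positive.  The identity theorem is obtained
  from Goursat's lemma and the mean value property, without power series.
*)
Require Import Defs.
From HB Require Import structures.
From mathcomp Require Import all_boot all_order all_algebra.
From mathcomp Require Import complex ring lra.
From mathcomp Require Import all_classical all_reals all_analysis measurable_realfun.
Import Order.TTheory GRing.Theory Num.Theory.
Import numFieldNormedType.Exports.

Set Implicit Arguments.
Unset Strict Implicit.
Unset Printing Implicit Defensive.

Local Open Scope classical_set_scope.
Local Open Scope ring_scope.
Local Open Scope complex_scope.

(** * Iterates of the positive inverse branch and the Abel function *)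

(** One step of [phi] divides the distance of two points by [1 + 1 / (phi x * phi y)], so distances
    along orbits decay like [1 / S_n]. Multiplied by [S_n] they increase with [n] and stay bounded,
    which is why [A], and likewise its derivative, exists as a monotone limit. In the expansion of
    [1 / X] over the zeros of [psi^n], each term stays above its limit. Termwise passage to the
    limit therefore gives one inequality at no cost, while mass might escape to zeros of large
    index. Excluding this is the real difficulty on the dynamical side; it is done by comparing the
    expansions at [X] and at a later point of its orbit. On the complex side, dividing a function by
    [w - x] at a zero [x] leaves a quotient of which only continuity is recorded at [x]. The mean
    value property is accordingly proved for functions that are merely continuous on finitely many
    circles; this breaks the usual circle between removable singularities, Cauchy's formula and
    power series. *)

(* The two inverse branches of [w - 1/w]. *)
HB.lock Definition phi (R : realType) (w : R) : R :=
  (w + Num.sqrt (w ^+ 2 + 4)) / 2.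
HB.lock Definition phim (R : realType) (w : R) : R :=
  (w - Num.sqrt (w ^+ 2 + 4)) / 2.
Arguments phi {R} w.
Arguments phim {R} w.

Section RealDynamics.
Variable R : realType.
Implicit Types (c v w x y X Y : R).


Lemma sqrt_w24 w : `|w| < Num.sqrt (w ^+ 2 + 4).
Proof.
rewrite -sqrtr_sqr ltr_sqrt; first by rewrite ltrDl.
by rewrite ltr_wpDl// sqr_ge0.
Qed.

Lemma phi_gt0 w : 0 < phi w.
Proof.
have := sqrt_w24 w; have := ler_norm (- w); rewrite normrN phi.unlock; lra.
Qed.

Lemma phim_lt0 w : phim w < 0.
Proof. have := sqrt_w24 w; have := ler_norm w; rewrite phim.unlock; lra. Qed.

Lemma phiDm w : phi w + phim w = w. Proof. rewrite phi.unlock phim.unlock; lra. Qed.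

Lemma phiMm w : phi w * phim w = -1.
Proof.
have h : Num.sqrt (w ^+ 2 + 4) ^+ 2 = w ^+ 2 + 4.
  by rewrite sqr_sqrtr// addr_ge0// sqr_ge0.
rewrite phi.unlock phim.unlock; nra.
Qed.

Lemma phiV w : phi w - (phi w)^-1 = w.
Proof.
have h0 := phi_gt0 w; have h1 := phiMm w; have h2 := phiDm w.
rewrite -[RHS]h2; congr (_ + _).
apply: (@mulfI _ (phi w)); first by rewrite gt_eqF.
by rewrite mulrN divff ?gt_eqF// h1.
Qed.

(** This is [phiV] at two points, factored. All estimates on distances between orbits rest on it. *)
Lemma phi_step x y : x - y = (phi x - phi y) * (1 + (phi x * phi y)^-1).
Proof.
have hx := phi_gt0 x; have hy := phi_gt0 y.
rewrite -{1}[x]phiV -{1}[y]phiV; field.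
by rewrite (gt_eqF hx) (gt_eqF hy).
Qed.

Lemma phi_lt x y : (phi x < phi y) = (x < y).
Proof.
rewrite -subr_gt0 -[RHS]subr_gt0 (phi_step y x) pmulr_lgt0//.
by rewrite addr_gt0// invr_gt0 mulr_gt0// phi_gt0.
Qed.

Lemma phi_le x y : (phi x <= phi y) = (x <= y).
Proof. by rewrite !leNgt phi_lt. Qed.

Lemma phim_lt x y : (phim x < phim y) = (x < y).
Proof.
have h (z : R) : phim z = - (phi z)^-1.
  apply: (@mulfI _ (phi z)); first by rewrite gt_eqF ?phi_gt0.
  by rewrite mulrN divff ?phiMm// gt_eqF ?phi_gt0.
by rewrite !h ltrN2 ltf_pV2 ?posrE ?phi_gt0// phi_lt.
Qed.

Lemma phi0 : phi (0 : R) = 1.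
Proof.
rewrite phi.unlock expr0n/= !add0r.
have -> : (4 : R) = 2 ^+ 2 by lra.
by rewrite sqrtr_sqr gtr0_norm ?divff.
Qed.

Lemma phi_unique u w : 0 < u -> u - u^-1 = w -> u = phi w.
Proof.
move=> u0 uw; have p0 := phi_gt0 w; have := phiV w; rewrite -[RHS]uw => e.
have : (phi w - u) * (1 + (phi w * u)^-1) = 0.
  have -> : (phi w - u) * (1 + (phi w * u)^-1) =
     (phi w - (phi w)^-1) - (u - u^-1).
    by field; rewrite (gt_eqF p0) (gt_eqF u0).
  by rewrite e subrr.
move=> /eqP; rewrite mulf_eq0 => /orP[|].
  by rewrite subr_eq0 => /eqP.
by rewrite gt_eqF// addr_gt0// invr_gt0 mulr_gt0.
Qed.

Lemma phi_sq w : phi w ^+ 2 = w ^+ 2 + 2 - (phi w ^+ 2)^-1.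
Proof.
have p0 := phi_gt0 w.
by rewrite -{2}[w]phiV; field; rewrite gt_eqF.
Qed.

Lemma phi_ge1 w : 0 <= w -> 1 <= phi w.
Proof. by move=> w0; rewrite -phi0 phi_le. Qed.

Lemma phi_ge w : w <= phi w.
Proof. by rewrite -{1}[w]phiV gerBl invr_ge0 ltW// phi_gt0. Qed.

Definition it (n : nat) (w : R) : R := iter n phi w.

Lemma itS n w : it n.+1 w = phi (it n w). Proof. by []. Qed.
Lemma itSr n w : it n.+1 w = it n (phi w). Proof. by rewrite /it iterSr. Qed.
Lemma itD n k w : it (n + k) w = it n (it k w).
Proof. by rewrite /it iterD. Qed.

Lemma it_lt n x y : (it n x < it n y) = (x < y).
Proof. by elim: n => // n IH; rewrite !itS phi_lt. Qed.

Lemma it_le n x y : (it n x <= it n y) = (x <= y).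
Proof. by rewrite !leNgt it_lt. Qed.

Lemma it_ge0 n w : 0 <= w -> 0 <= it n w.
Proof. by case: n => // n _; rewrite itS ltW// phi_gt0. Qed.

Lemma it_gt0 n w : 0 < w -> 0 < it n w.
Proof. by case: n => // n _; rewrite itS phi_gt0. Qed.

(** By [phi_sq] the square grows by [2 - 1 / phi^2] at each step, and [phi >= 1] on nonnegative
    arguments. *)
Lemma it_sqr_ge n w : 0 <= w -> n%:R <= it n w ^+ 2.
Proof.
move=> w0; elim: n => [|n IH]; first exact: sqr_ge0.
have h := it_ge0 n w0; rewrite itS phi_sq -natr1.
have h1 := phi_ge1 h.
have : (phi (it n w) ^+ 2)^-1 <= 1.
  by rewrite invf_le1 ?exprn_ege1// exprn_gt0// phi_gt0.
lra.
Qed.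

Lemma it_unbounded w (M : R) : 0 <= w -> exists k, M <= it k w.
Proof.
move=> w0; have := archi_boundP (sqr_ge0 M); set k := Num.Def.archi_bound _ => hk.
exists k; rewrite leNgt; apply/negP => lt.
have h := it_sqr_ge k w0; have g := it_ge0 k w0.
have : it k w ^+ 2 < M ^+ 2 by nra.
lra.
Qed.

Lemma it_inv_cvg0 w : 0 <= w -> (fun n => (it n w)^-1) @ \oo --> 0.
Proof.
move=> w0; apply/cvgrPdist_le => e e0.
have [k hk] := it_unbounded (e^-1) w0.
exists k => // n /= kn; rewrite sub0r normrN.
have h : e^-1 <= it n w.
  apply: le_trans hk _; rewrite -(subnKC kn) addnC itD.
  by elim: (n - k)%N => // j IH; rewrite itS (le_trans IH)// phi_ge.
have ei : 0 < e^-1 by rewrite invr_gt0.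
rewrite gtr0_norm ?invr_gt0; last exact: lt_le_trans h.
by rewrite -[leRHS]invrK lef_pV2// posrE (lt_le_trans ei h).
Qed.

(** The orbit of 0; [S_ n.+1] is the sum [1 + m_1 + ... + m_n] of the moments, see [moments_S]. *)
Definition S_ n : R := it n 0.

Lemma S_0 : S_ 0 = 0. Proof. by []. Qed.
Lemma S_1 : S_ 1 = 1. Proof. exact: phi0. Qed.
Lemma S_ge0 n : 0 <= S_ n. Proof. exact: it_ge0. Qed.
Lemma S_gt0 n : 0 < S_ n.+1. Proof. by rewrite /S_ itS phi_gt0. Qed.
Lemma S_rec n : S_ n.+1 - S_ n = (S_ n.+1)^-1.
Proof. by rewrite /S_ itS -{2}[it n 0]phiV; lra. Qed.

Lemma S_sqr_le n : S_ n ^+ 2 <= 2 * n%:R.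
Proof.
elim: n => [|n IH]; first by rewrite S_0; lra.
rewrite /S_ itS phi_sq -natr1 -/(S_ n).
have : 0 <= (phi (S_ n) ^+ 2)^-1 by rewrite invr_ge0 sqr_ge0.
lra.
Qed.


Lemma it_sub_le n k X : 0 < X -> it (n + k) X - it n X <= k%:R / it n X.
Proof.
move=> X0; elim: k => [|k IH]; first by rewrite addn0 mul0r subrr.
have h0 := it_gt0 n X0; have h1 := it_gt0 (n + k).+1 X0.
have : it (n + k).+1 X - it (n + k) X = (it (n + k).+1 X)^-1.
  by rewrite itS -{2}[it (n + k) X]phiV; lra.
have : (it (n + k).+1 X)^-1 <= (it n X)^-1.
  rewrite lef_pV2// -addnS addnC itD; elim: k.+1 => // j IHj.
  by rewrite itS (le_trans IHj)// phi_ge.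
by rewrite addnS -natr1 mulrDl mul1r; lra.
Qed.

Lemma it_sub_ge n k X : 0 < X -> k%:R / it (n + k) X <= it (n + k) X - it n X.
Proof.
move=> X0; elim: k => [|k IH]; first by rewrite addn0 mul0r subrr.
have h0 := it_gt0 (n + k) X0; have h1 := it_gt0 (n + k).+1 X0.
have e : it (n + k).+1 X - it (n + k) X = (it (n + k).+1 X)^-1.
  by rewrite itS -{2}[it (n + k) X]phiV; lra.
have : k%:R / it (n + k).+1 X <= k%:R / it (n + k) X.
  by rewrite ler_wpM2l// lef_pV2// itS phi_ge.
by rewrite addnS -natr1 mulrDl mul1r; lra.
Qed.

Lemma it_S n k : it n (S_ k) = S_ (n + k).
Proof. by rewrite /S_ itD. Qed.

(** The factor [S_ n] balances the decay of distances under [phi]. *)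
Definition gap n Y v : R := S_ n * (it n Y - it n v).

Lemma S_ge1 n : 1 <= S_ n.+1.
Proof. by rewrite /S_ itS phi_ge1// it_ge0. Qed.

Lemma S_le_it n v : 0 <= v -> S_ n <= it n v.
Proof. by move=> v0; rewrite /S_ it_le. Qed.

(** With [s = S_ n.+1] one has [S_ n = s - 1/s], and both later points are at least [s]. The claim
    reduces to [(s - 1/s) * (1 + 1/s^2) = s - 1/s^3 <= s]. *)
Lemma gap_step n v Y : 0 <= v -> v <= Y -> gap n Y v <= gap n.+1 Y v.
Proof.
move=> v0 vY; rewrite /gap.
set u := it n.+1 Y; set w := it n.+1 v; set s := S_ n.+1.
have hs : 1 <= s := S_ge1 n.
have sw : s <= w by exact: S_le_it.
have su : w <= u by rewrite it_le.
have -> : S_ n = s - s^-1 by have := S_rec n; rewrite -/s; lra.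
rewrite (phi_step (it n Y)) -!itS -/u -/w.
clearbody u w s.
set i := s^-1; set j := (u * w)^-1.
have s0 : 0 < s by lra.
have si : s * i = 1 by rewrite divff// gt_eqF.
have w0 : 0 < w by exact: lt_le_trans sw.
have u0 : 0 < u by exact: lt_le_trans su.
have uw0 : 0 < u * w by rewrite mulr_gt0.
have ji : j <= i * i.
  rewrite /j /i -invfM lef_pV2 ?posrE ?mulr_gt0//.
  by apply: ler_pM; lra.
have j0 : 0 < j by rewrite invr_gt0.
have i0 : 0 < i by rewrite invr_gt0.
clearbody i j.
have h1 : 0 <= s - i by nra.
have h2 : (s - i) * (1 + j) <= s.
  apply: (@le_trans _ _ ((s - i) * (1 + i * i))).
    by apply: ler_wpM2l; lra.
  have -> : (s - i) * (1 + i * i) = s - i * i * i + (s * i - 1) * i by ring.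
  by rewrite si subrr mul0r addr0 gerBl !mulr_ge0// ltW.
rewrite mulrA [leLHS]mulrAC; apply: ler_wpM2r => //; lra.
Qed.

Lemma gap_mono n m v Y : 0 <= v -> v <= Y -> (n <= m)%N -> gap n Y v <= gap m Y v.
Proof.
move=> v0 vY /subnKC <-; elim: (m - n)%N => [|k IH]; first by rewrite addn0.
by rewrite (le_trans IH)// addnS gap_step.
Qed.

(** Once [Y <= S_ k], the [n]-th iterate of [Y] is at most [S_ (n + k)], and each of the [k]
    increments beyond [S_ n] is at most [1 / S_ n]. *)
Lemma gap_ub Y : 0 <= Y -> exists2 k : nat, Y <= S_ k & forall n, gap n Y 0 <= k%:R.
Proof.
move=> Y0; have [k hk] := it_unbounded Y (lexx 0).
exists k => // n; rewrite /gap -/(S_ n).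
have h : it n Y <= S_ (n + k) by rewrite -it_S it_le.
case: n h => [|n] h; first by rewrite S_0 mul0r.
apply: (@le_trans _ _ (S_ n.+1 * (S_ (n.+1 + k) - S_ n.+1))).
  by rewrite ler_wpM2l// ?S_ge0//; lra.
have hs := S_gt0 n; rewrite mulrC -ler_pdivlMr//.
have -> : S_ (n.+1 + k) = it (n + k) 1 by rewrite -S_1 it_S addn1 addSn.
have -> : S_ n.+1 = it n 1 by rewrite -S_1 it_S addn1.
exact: it_sub_le.
Qed.

(* The Abel function of [phi]: [A (phi w) = A w + 1]. In the paper's notation
   [A] is the inverse of the restriction of [f] to the positive half-line. *)
Definition A w : R := limn (fun n => gap n w 0).

Lemma A_cvg w : 0 <= w -> (fun n => gap n w 0) @ \oo --> A w.
Proof.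
move=> w0; have [k _ hk] := gap_ub w0.
apply: nondecreasing_is_cvgn.
  by move=> n m nm; apply: gap_mono.
by exists k%:R => _ [n _ <-].
Qed.

Lemma gapB n w v : gap n w 0 - gap n v 0 = gap n w v.
Proof. by rewrite /gap; lra. Qed.

Lemma AB_cvg w v : 0 <= w -> 0 <= v -> (fun n => gap n w v) @ \oo --> A w - A v.
Proof.
move=> w0 v0; rewrite [X in X @ _ --> _](_ : _ = (fun n => gap n w 0 - gap n v 0)).
  by apply: cvgB; apply: A_cvg.
by apply/funext => n; rewrite gapB.
Qed.

Lemma gap_le_A n v w : 0 <= v -> v <= w -> gap n w v <= A w - A v.
Proof.
move=> v0 vw; have w0 : 0 <= w by lra.
rewrite -(cvg_lim _ (AB_cvg w0 v0))//.
apply: nondecreasing_cvgn_le; first by move=> i j ij; apply: gap_mono.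
by apply: cvgP; exact: AB_cvg.
Qed.

Lemma A_0 : A 0 = 0.
Proof.
have h := A_cvg (lexx 0); rewrite -(cvg_lim _ h)//.
rewrite (_ : (fun n => gap n 0 0) = cst 0) ?lim_cst//.
by apply/funext => n; rewrite /gap subrr mulr0.
Qed.

Lemma A_lt v w : 0 <= v -> v < w -> A v < A w.
Proof.
move=> v0 vw; rewrite -subr_gt0; apply: lt_le_trans (gap_le_A 1 v0 (ltW vw)).
by rewrite /gap S_1 mul1r subr_gt0 it_lt.
Qed.

Lemma S_ratio_cvg : (fun n => S_ n / S_ n.+1 : R) @ \oo --> (1 : R).
Proof.
have -> : (fun n => S_ n / S_ n.+1) = (fun n => 1 - (it n 1)^-1 * (it n 1)^-1).
  apply/funext => n; have -> : it n 1 = S_ n.+1 by rewrite -S_1 it_S addn1.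
  have h := S_gt0 n; rewrite (_ : S_ n = S_ n.+1 - (S_ n.+1)^-1).
    by field; rewrite gt_eqF.
  by have := S_rec n; lra.
have h : (fun n => (it n 1)^-1) @ \oo --> 0 by apply: it_inv_cvg0.
have := cvgB (cvg_cst (1 : R)) (cvgM h h); rewrite mulr0 subr0; exact.
Qed.

(** The gap of [phi w] at [n] is the gap of [w] at [n + 1] up to the factor [S_ n / S_ n.+1], plus
    the increment [S_ n * (S_ n.+1 - S_ n)], which equals the same ratio. The ratio tends to 1. *)
Lemma A_phi w : 0 <= w -> A (phi w) = A w + 1.
Proof.
move=> w0; have pw : 0 <= phi w by rewrite ltW// phi_gt0.
have h1 := A_cvg pw.
have h2 : (fun n => gap n (phi w) 0) @ \oo --> A w + 1.
  have -> : (fun n => gap n (phi w) 0) =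
    (fun n => S_ n / S_ n.+1 * gap n.+1 w 0 + S_ n / S_ n.+1).
    apply/funext => n; rewrite /gap -itSr -!/(S_ _) .
    have h := S_rec n; have s0 := S_gt0 n.
    rewrite {2}(_ : S_ n = S_ n.+1 - (S_ n.+1)^-1); last lra.
    by field; rewrite gt_eqF.
  rewrite -[X in _ --> X + _]mul1r; apply: cvgD; last exact: S_ratio_cvg.
  apply: cvgM; first exact: S_ratio_cvg.
  have := A_cvg w0; rewrite -(cvg_shiftS (fun n => gap n w 0)); exact.
exact: cvg_unique h1 h2.
Qed.

Lemma A_S n : A (S_ n) = n%:R.
Proof.
elim: n => [|n IH]; first by rewrite S_0 A_0.
by rewrite /S_ itS A_phi ?it_ge0// IH natr1.
Qed.

Lemma A_it n w : 0 <= w -> A (it n w) = A w + n%:R.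
Proof.
move=> w0; elim: n => [|n IH]; first by rewrite addr0.
by rewrite itS A_phi ?it_ge0// IH -natr1; lra.
Qed.

End RealDynamics.

(** * The derivative of the Abel function *)

Section Weights.
Variable R : realType.
Implicit Types (c v w x y X Y : R).

Definition dphi c : R := phi c ^+ 2 / (1 + phi c ^+ 2).

Lemma dphi_gt0 c : 0 < dphi c.
Proof.
have h := phi_gt0 c; have h2 : 0 < phi c ^+ 2 by rewrite exprn_gt0.
by rewrite divr_gt0//; lra.
Qed.

Lemma dphiV c : dphi c * (1 + (phi c * phi c)^-1) = 1.
Proof.
have h := phi_gt0 c; rewrite /dphi.
by field; rewrite !gt_eqF//; nra.
Qed.

(* [dit n] is the derivative of [it n]. *)
Fixpoint dit n w : R := if n is n'.+1 then dphi (it n' w) * dit n' w else 1.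

Lemma dit_gt0 n w : 0 < dit n w.
Proof. by elim: n => //= n IH; rewrite mulr_gt0// dphi_gt0. Qed.

(* Both difference quotients are monotone in the number of iterations. *)
Lemma dit_slope_step n v w : v <= w ->
  dit n.+1 v * (it n w - it n v) <= dit n v * (it n.+1 w - it n.+1 v).
Proof.
move=> vw; rewrite [dit n.+1 v]/= (phi_step (it n w)) -!itS.
have hd := dphiV (it n v); have d0 := dphi_gt0 (it n v); rewrite -!itS in hd.
have hv : 0 < it n.+1 v by rewrite itS phi_gt0.
have uv : it n.+1 v <= it n.+1 w by rewrite it_le.
have hw : 0 < it n.+1 w by exact: lt_le_trans uv.
have dn := dit_gt0 n v.
have hj : (it n.+1 w * it n.+1 v)^-1 <= (it n.+1 v * it n.+1 v)^-1.
  rewrite lef_pV2 ?posrE ?mulr_gt0//.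
  by rewrite ler_wpM2r// ltW.
move: hd d0 uv dn hj; set D := dphi _; set d := dit n v; set u := it n.+1 w; set s := it n.+1 v.
set j := (u * s)^-1; set i := (s * s)^-1.
move: D d u s j i => D d u s j i hd d0 uv dn hj.
have -> : D * d * ((u - s) * (1 + j)) = d * (u - s) * (D * (1 + j)) by ring.
rewrite -[leRHS]mulr1 -hd ler_wpM2l// ?ler_wpM2l//; [|lra|lra].
by rewrite mulr_ge0//; lra.
Qed.

Lemma dit_slope_step_r n v w : v <= w ->
  dit n w * (it n.+1 w - it n.+1 v) <= dit n.+1 w * (it n w - it n v).
Proof.
move=> vw; rewrite [dit n.+1 w]/= (phi_step (it n w)) -!itS.
have hd := dphiV (it n w); have d0 := dphi_gt0 (it n w); rewrite -!itS in hd.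
have hv : 0 < it n.+1 v by rewrite itS phi_gt0.
have uv : it n.+1 v <= it n.+1 w by rewrite it_le.
have hw : 0 < it n.+1 w by exact: lt_le_trans uv.
have dn := dit_gt0 n w.
have hj : (it n.+1 w * it n.+1 w)^-1 <= (it n.+1 w * it n.+1 v)^-1.
  rewrite lef_pV2 ?posrE ?mulr_gt0//.
  by rewrite ler_wpM2l// ltW.
move: hd d0 uv dn hj; set D := dphi _; set d := dit n w; set u := it n.+1 w; set s := it n.+1 v.
set j := (u * s)^-1; set i := (u * u)^-1.
move: D d u s j i => D d u s j i hd d0 uv dn hj.
have -> : D * d * ((u - s) * (1 + j)) = d * (u - s) * (D * (1 + j)) by ring.
rewrite -[leLHS]mulr1 -hd ler_wpM2l// ?ler_wpM2l//; [|lra|lra].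
by rewrite mulr_ge0//; lra.
Qed.

(** The value at [Y] of the simple pole transported from [w] by [n] steps of [phi]: the pole has
    moved to [it n w] and carries the residue [dit n w]. *)
Definition slope n w Y : R := dit n w / (it n Y - it n w).

Lemma slope_step n w Y : w < Y -> slope n.+1 w Y <= slope n w Y.
Proof.
move=> wY; have h1 : it n w < it n Y by rewrite it_lt.
have h2 : it n.+1 w < it n.+1 Y by rewrite it_lt.
rewrite /slope ler_pdivrMr ?subr_gt0// mulrAC ler_pdivlMr ?subr_gt0//.
exact/dit_slope_step/ltW.
Qed.

Lemma slope_mono n m w Y : w < Y -> (n <= m)%N -> slope m w Y <= slope n w Y.
Proof.
move=> wY /subnKC <-; elim: (m - n)%N => [|k IH]; first by rewrite addn0.
by rewrite addnS (le_trans _ IH)// slope_step.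
Qed.

Definition gitd n w : R := S_ R n * dit n w.

Lemma gitd_slope n w Y : w < Y -> gitd n w = gap n Y w * slope n w Y.
Proof.
move=> wY; have h1 : it n w < it n Y by rewrite it_lt.
by rewrite /gitd /gap /slope; field; rewrite subr_eq0 gt_eqF.
Qed.

Lemma gitd_step n w : 0 <= w -> gitd n w <= gitd n.+1 w.
Proof.
move=> w0; rewrite /gitd [dit n.+1 w]/= mulrA ler_pM2r ?dit_gt0//.
have := dphiV (it n w); rewrite -itS.
have d0 := dphi_gt0 (it n w); move: (dphi _) d0 => d d0.
have sw : S_ R n.+1 <= it n.+1 w by exact: S_le_it.
have s0 := S_gt0 R n; have rec := S_rec R n; have hs := S_ge1 R n.
move: rec hs sw s0; set s := S_ R n.+1; set t := S_ R n; set u := it n.+1 w.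
rewrite -[(u * u)^-1]/((u * u)^-1).
move: s t u => s t u rec hs sw s0 e.
have ji : (u * u)^-1 <= s^-1 * s^-1.
  rewrite -invfM lef_pV2 ?posrE ?mulr_gt0//; last exact: lt_le_trans sw.
    by apply: ler_pM; lra.
  exact: lt_le_trans sw.
have j0 : 0 <= (u * u)^-1 by rewrite invr_ge0 mulr_ge0//; lra.
have si : s * s^-1 = 1 by rewrite divff// gt_eqF.
have i0 : 0 < s^-1 by rewrite invr_gt0.
move: (u * u)^-1 s^-1 ji j0 si i0 rec e => j i ji j0 si i0 rec e.
have -> : t = s - i by lra.
have h : (s - i) * (1 + j) <= s.
  apply: (@le_trans _ _ ((s - i) * (1 + i * i))).
    by apply: ler_wpM2l; [nra|lra].
  have -> : (s - i) * (1 + i * i) = s - i * i * i + (s * i - 1) * i by ring.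
  by rewrite si subrr mul0r addr0 gerBl !mulr_ge0// ltW.
have -> : s - i = (s - i) * (1 + j) * d by rewrite -mulrA [_ * d]mulrC e mulr1.
by rewrite ler_pM2r.
Qed.

(* The derivative of [A]. *)
Definition dA w : R := limn (fun n => gitd n w).

(** Boundedness comes from [gitd = gap * slope] with the auxiliary point [w + 1]: the slope starts
    at 1 and decreases, and the gap is bounded by the increment of [A]. *)
Lemma dA_cvg w : 0 <= w -> (fun n => gitd n w) @ \oo --> dA w.
Proof.
move=> w0; apply: nondecreasing_is_cvgn.
  move=> n m /subnKC <-; elim: (m - n)%N => [|k IH]; first by rewrite addn0.
  by rewrite (le_trans IH)// addnS gitd_step.
have hw : w < w + 1 by lra.
exists (A (w + 1) - A w) => _ [n _ <-]; rewrite (gitd_slope n hw).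
have h0 : slope n w (w + 1) <= 1.
  have := slope_mono hw (leq0n n); rewrite {2}/slope /=.
  by rewrite (_ : w + 1 - w = 1) ?divr1//; lra.
have h1 : 0 <= slope n w (w + 1).
  by rewrite divr_ge0 ?ltW ?dit_gt0 ?subr_gt0 ?it_lt//; lra.
have h2 : gap n (w + 1) w <= A (w + 1) - A w by apply: gap_le_A => //; lra.
have h3 : 0 <= gap n (w + 1) w.
  by rewrite mulr_ge0 ?S_ge0// subr_ge0 it_le ltW.
by apply: le_trans h2; rewrite -[leRHS]mulr1 ler_wpM2l.
Qed.

Lemma dA_gt0 w : 0 <= w -> 0 < dA w.
Proof.
move=> w0; apply: (@lt_le_trans _ _ (gitd 1 w)).
  by rewrite mulr_gt0 ?S_gt0// dit_gt0.
rewrite /dA.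
apply: nondecreasing_cvgn_le; last by apply: cvgP; exact: dA_cvg.
move=> n m /subnKC <-; elim: (m - n)%N => [|k IH]; first by rewrite addn0.
by rewrite (le_trans IH)// addnS gitd_step.
Qed.

(** Numerator and denominator both tend to 0 like [1 / S_ n]; the normalizing factors cancel in the
    quotient. *)
Lemma slope_cvg w Y : 0 <= w -> w < Y ->
  (fun n => slope n w Y) @ \oo --> dA w / (A Y - A w).
Proof.
move=> w0 wY; have Y0 : 0 <= Y by lra.
have AYw : A Y - A w != 0 by rewrite subr_eq0 gt_eqF// A_lt.
(* Since [S_ 0 = 0], the gap can be a denominator only from index 1 on. *)
rewrite -(cvg_shiftS (fun n => slope n w Y)).
have -> : (fun n => slope n.+1 w Y) = (fun n => gitd n.+1 w / gap n.+1 Y w).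
  apply/funext => n /=; rewrite (gitd_slope n.+1 wY) mulrAC divff ?mul1r//.
  by rewrite gt_eqF// mulr_gt0 ?S_gt0// subr_gt0 it_lt.
apply: cvgM.
  by have := dA_cvg w0; rewrite -(cvg_shiftS (fun n => gitd n w)).
apply: cvgV => //.
by have := AB_cvg Y0 w0; rewrite -(cvg_shiftS (fun n => gap n Y w)).
Qed.

Lemma slope_ge n w Y : 0 <= w -> w < Y -> dA w / (A Y - A w) <= slope n w Y.
Proof.
move=> w0 wY; rewrite -(cvg_lim _ (slope_cvg w0 wY))//.
apply: nonincreasing_cvgn_ge; last by apply: cvgP; exact: slope_cvg.
by move=> i j ij; apply: slope_mono.
Qed.

(** Convexity of [A]: a secant is no steeper than the tangent at its right end. This yields the left
    continuity of [A] in [A_left]. *)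
Lemma AB_le v w : 0 <= v -> v < w -> A w - A v <= dA w * (w - v).
Proof.
move=> v0 vw; have w0 : 0 <= w by lra.
apply: ler_cvg_to (AB_cvg w0 v0) (cvgM (dA_cvg w0) (cvg_cst (w - v))) _.
near=> n.
rewrite /gap /= /gitd -mulrA ler_wpM2l ?S_ge0//.
elim: (n : nat) => [|k IH]; first by rewrite mul1r.
have d0 := dit_gt0 k w.
rewrite -(ler_pM2l d0) (le_trans (dit_slope_step_r k (ltW vw)))// [leRHS]mulrCA.
by rewrite ler_wpM2l// ltW// dit_gt0.
Unshelve. all: by end_near. Qed.

End Weights.

(** * Partial fractions along an orbit *)

Lemma cvg_sum_seq (K : numFieldType) (T : Type) (F : set_system T)
    (I : eqType) (s : seq I) (f : I -> T -> K) (l : I -> K) : Filter F ->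
  (forall i, i \in s -> f i x @[x --> F] --> l i) ->
  (fun x => \sum_(i <- s) f i x) @ F --> \sum_(i <- s) l i.
Proof.
move=> FF; elim: s => [|i s IH] h.
  rewrite big_nil (_ : (fun x => _) = cst 0); first exact: cvg_cst.
  by apply/funext => x; rewrite big_nil.
rewrite big_cons (_ : (fun x => _) = (fun x => f i x + \sum_(i <- s) f i x)).
  apply: cvgD; first by apply: h; rewrite mem_head.
  by apply: IH => j js; apply: h; rewrite inE js orbT.
by apply/funext => x; rewrite big_cons.
Qed.

Section PartialFractions.
Variable R : realType.
Implicit Types (c v w x y X Y : R) (b : R * R).

Definition dphim c : R := phim c ^+ 2 / (1 + phim c ^+ 2).

Lemma phimE c : phim c = - (phi c)^-1.
Proof.
have h := phi_gt0 c; apply: (@mulfI _ (phi c)); first by rewrite gt_eqF.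
by rewrite mulrN divff ?phiMm// gt_eqF.
Qed.

Lemma dphim_gt0 c : 0 < dphim c.
Proof.
have h := phim_lt0 c; have h2 : 0 < phim c ^+ 2 by rewrite exprn_even_gt0//= lt_eqF.
by rewrite divr_gt0//; lra.
Qed.

Lemma dphiD c : dphi c + dphim c = 1.
Proof.
have h := phi_gt0 c; rewrite /dphi /dphim phimE.
by field; rewrite !gt_eqF//; nra.
Qed.

(* Pulling the simple pole at [c] back along [w - 1/w]. *)
Lemma pole_pullback c Y : Y != c ->
  (Y - c)^-1 = dphi c / (phi Y - phi c) + dphim c / (phi Y - phim c).
Proof.
move=> Yc; have y0 := phi_gt0 Y; have a0 := phi_gt0 c.
have ya : phi Y - phi c != 0.
  rewrite subr_eq0; apply: contraNN Yc => /eqP e.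
  by rewrite -[Y]phiV e phiV.
rewrite -{1}[Y]phiV -{1}[c]phiV /dphi /dphim phimE.
move: (phi Y) (phi c) y0 a0 ya => y a y0 a0 ya.
have ya1 : y * a + 1 != 0 by rewrite gt_eqF// addr_gt0// mulr_gt0.
field; rewrite ya (gt_eqF y0) (gt_eqF a0)/=.
rewrite ya1/= gt_eqF//=; last by rewrite ltr_wpDl// sqr_ge0.
rewrite (_ : _ + _ = (y - a) * (y * a + 1)); last by ring.
by rewrite mulf_neq0.
Qed.

Definition lift b : R * R := (phi b.1, b.2 * dphi b.1).
Definition liftm b : R * R := (phim b.1, b.2 * dphim b.1).

(* [Z n] lists, in increasing order, the zeros of the [n]-th iterate of
   [w - 1/w], each with the residue of the reciprocal of that iterate; [V n]
   is the sublist of the negative zeros (and of [0] when [n = 0]). *)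
Fixpoint Z (n : nat) : seq (R * R) :=
  if n is n'.+1 then map liftm (Z n') ++ map lift (Z n') else [:: (0, 1)].

Definition V (n : nat) : seq (R * R) :=
  if n is n'.+1 then map liftm (Z n') else [:: (0, 1)].

Lemma Z_weight_gt0 n b : b \in Z n -> 0 < b.2.
Proof.
elim: n b => [|n IH] b /=; first by rewrite inE => /eqP ->.
rewrite mem_cat => /orP[|] /mapP[c /IH c0 ->]/=.
  by rewrite mulr_gt0// dphim_gt0.
by rewrite mulr_gt0// dphi_gt0.
Qed.

Lemma V_weight_gt0 n b : b \in V n -> 0 < b.2.
Proof.
case: n => [|n] /=; first by rewrite inE => /eqP ->.
by move=> /mapP[c /Z_weight_gt0 c0 ->]/=; rewrite mulr_gt0// dphim_gt0.
Qed.

Lemma V_le0 n b : b \in V n -> b.1 <= 0.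
Proof.
case: n => [|n] /=; first by rewrite inE => /eqP ->.
by move=> /mapP[c _ ->]/=; rewrite ltW// phim_lt0.
Qed.

Lemma V_lt0 n b : b \in V n.+1 -> b.1 < 0.
Proof. by move=> /mapP[c _ ->]/=; rewrite phim_lt0. Qed.

Lemma size_Z n : size (Z n) = (2 ^ n)%N.
Proof.
elim: n => //= n IH; rewrite size_cat !size_map IH expnS.
by rewrite mul2n addnn.
Qed.

Lemma size_V n : size (V n.+1) = (2 ^ n)%N.
Proof. by rewrite /= size_map size_Z. Qed.

Definition rlt b b' := b.1 < b'.1.

Lemma sorted_Z n : sorted rlt (Z n).
Proof.
have tr : transitive rlt by move=> y x z; exact: lt_trans.
elim: n => //= n IH.
rewrite sorted_pairwise// pairwise_cat !pairwise_map.
rewrite (sorted_pairwise tr) in IH; apply/and3P; split.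
- by apply/allrelP => x y /mapP[c _ ->] /mapP[d _ ->]; rewrite /rlt/=
    (lt_trans (phim_lt0 _))// phi_gt0.
- by apply: sub_pairwise IH => x y; rewrite /rlt/= phim_lt.
- by apply: sub_pairwise IH => x y; rewrite /rlt/= phi_lt.
Qed.

Lemma sorted_V n : sorted rlt (V n).
Proof.
case: n => //= n; rewrite sorted_map; apply: sub_sorted (sorted_Z n) => x y.
by rewrite /rlt/= phim_lt.
Qed.

Lemma sum_Z_weight n : \sum_(b <- Z n) b.2 = 1.
Proof.
elim: n => [|n IH]; first by rewrite big_seq1.
rewrite big_cat !big_map/= -big_split/= -[RHS]IH; apply: eq_bigr => b _.
by rewrite -mulrDr addrC dphiD mulr1.
Qed.

Lemma it_notin_Z n X b : 0 < X -> b \in Z n -> it n X != b.1.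
Proof.
move=> X0; elim: n b => [|n IH] b /=.
  by rewrite inE => /eqP ->; rewrite gt_eqF.
rewrite mem_cat => /orP[|] /mapP[c /IH c0 ->] /=.
  by rewrite gt_eqF// (lt_trans (phim_lt0 _))// phi_gt0.
apply: contraNN c0 => /eqP e.
by rewrite -[it n X]phiV e phiV.
Qed.

Lemma pole_expansion_Z n X : 0 < X ->
  X^-1 = \sum_(b <- Z n) b.2 / (it n X - b.1).
Proof.
move=> X0; elim: n => [|n IH]; first by rewrite big_seq1 subr0 mul1r.
rewrite IH big_cat !big_map/= -big_split/=.
apply: eq_big_seq => b bZ.
rewrite (pole_pullback (it_notin_Z X0 bZ)) mulrDr addrC.
by rewrite !mulrA.
Qed.

(** A zero of the [n]-th iterate is classified by the last use of the negative branch: it occurs at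
    stage [p], and the remaining [n - p] branches are all [phi]. One of these is written apart,
    because [phi b.1] is positive and thus in the domain where [A] and [dA] are controlled. Class 0
    comes from the starting point 0. *)
Lemma sum_Z_split n (g : R -> R -> R) :
  \sum_(b <- Z n) g b.1 b.2 = \sum_(b <- V n) g b.1 b.2 +
   \sum_(p < n) \sum_(b <- V p) g (it (n - p.+1) (phi b.1))
      (b.2 * dphi b.1 * dit (n - p.+1) (phi b.1)).
Proof.
elim: n g => [|n IH] g; first by rewrite big_ord0 addr0.
rewrite big_cat !big_map/=; congr (_ + _).
rewrite (IH (fun x y => g (phi x) (y * dphi x))) addrC big_ord_recr/=.
congr (_ + _); last first.
  by apply: eq_bigr => b _; rewrite subnn /= mulr1.
apply: eq_bigr => p _; apply: eq_bigr => b _.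
by rewrite subSn//= -mulrA [dit _ _ * _]mulrC.
Qed.

(* [B p] lists the zeros of [f] in the interval [[-p-1,-p]], each with the
   reciprocal of the derivative of [f]. *)
Definition xi (p : nat) b : R := A (phi b.1) - p.+1%:R.
Definition rho b : R := b.2 * dphi b.1 * dA (phi b.1).
Definition B (p : nat) : seq (R * R) := [seq (xi p b, rho b) | b <- V p].
Definition Bsum (p : nat) x : R := \sum_(b <- B p) b.2 / (x - b.1).

(** The contribution to [1 / X] of the zeros in class [p] at level [n]; it converges from above to
    [Bsum p (A X)]. *)
Definition term (n p : nat) X : R :=
  \sum_(b <- V p) b.2 * dphi b.1 * slope (n - p.+1) (phi b.1) (it p.+1 X).

Lemma V_phi_lt p b X : b \in V p -> 0 < X -> phi b.1 < it p.+1 X.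
Proof.
move=> /V_le0 b0 X0; apply: (@le_lt_trans _ _ (phi 0)); first by rewrite phi_le.
apply: (@lt_le_trans _ _ (phi X)); first by rewrite phi_lt.
by rewrite itSr; elim: p => // p IH; rewrite itS (le_trans IH)// phi_ge.
Qed.

Lemma pole_expansion n X : 0 < X ->
  X^-1 = \sum_(b <- V n) b.2 / (it n X - b.1) + \sum_(p < n) term n p X.
Proof.
move=> X0; rewrite (pole_expansion_Z n X0).
rewrite (sum_Z_split n (fun x y => y / (it n X - x))); congr (_ + _).
apply: eq_bigr => p _; apply: eq_bigr => b _.
by rewrite /slope -itD subnK// mulrA.
Qed.

(** The zeros are at most 0 and their weights add up to at most 1, so this remainder of the pole
    expansion vanishes in the limit. *)
Lemma sum_V_le n X : 0 < X ->
  0 <= \sum_(b <- V n) b.2 / (it n X - b.1) <= (it n X)^-1.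
Proof.
move=> X0; have h := it_gt0 n X0.
apply/andP; split.
  rewrite big_seq; apply: sumr_ge0 => b bV.
  rewrite divr_ge0 ?ltW// ?V_weight_gt0//; first exact: V_weight_gt0 bV.
  by have := V_le0 bV; lra.
have w0 b : b \in V n -> 0 <= b.2 by move=> /V_weight_gt0/ltW.
apply: (@le_trans _ _ (\sum_(b <- V n) b.2 / it n X)).
  rewrite big_seq [leRHS]big_seq; apply: ler_sum => b bV.
  rewrite ler_wpM2l ?w0// lef_pV2 ?posrE//; have := V_le0 bV; lra.
rewrite -mulr_suml -[leRHS]mul1r ler_wpM2r ?invr_ge0 ?(ltW h)// -(sum_Z_weight n).
case: n h w0 => [|n] _ _; first by rewrite !big_seq1.
rewrite [leRHS]big_cat/= lerDl big_map big_seq.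
by apply: sumr_ge0 => b /Z_weight_gt0/ltW b0; rewrite mulr_ge0// ltW// dphi_gt0.
Qed.

Lemma term_ge0 n p X : 0 < X -> 0 <= term n p X.
Proof.
move=> X0; rewrite /term big_seq; apply: sumr_ge0 => b bV.
apply: mulr_ge0; first by rewrite mulr_ge0 ?ltW ?dphi_gt0 ?(V_weight_gt0 bV).
by rewrite divr_ge0 ?ltW ?dit_gt0 ?subr_gt0 ?it_lt ?(V_phi_lt bV).
Qed.

Lemma BsumE p X : 0 < X -> Bsum p (A X) =
  \sum_(b <- V p) b.2 * dphi b.1 *
     (dA (phi b.1) / (A (it p.+1 X) - A (phi b.1))).
Proof.
move=> X0; rewrite /Bsum big_map; apply: eq_bigr => b _ /=.
by rewrite -itS A_it ?ltW// /rho /xi mulrA opprB addrA.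
Qed.

Lemma phi_ge0 w : 0 <= phi w. Proof. by rewrite ltW// phi_gt0. Qed.

Lemma Bsum_le_term n p X : 0 < X -> Bsum p (A X) <= term n p X.
Proof.
move=> X0; rewrite BsumE// /term big_seq [leRHS]big_seq.
apply: ler_sum => b bV; rewrite ler_wpM2l ?slope_ge ?phi_ge0 ?(V_phi_lt bV)//.
by rewrite mulr_ge0 ?ltW ?dphi_gt0 ?(V_weight_gt0 bV).
Qed.

Lemma term_cvg p X : 0 < X -> (fun n => term n p X) @ \oo --> Bsum p (A X).
Proof.
move=> X0; rewrite BsumE// -(cvg_shiftn p.+1).
rewrite (_ : (fun n => _) = (fun n => \sum_(b <- V p)
   b.2 * dphi b.1 * slope n (phi b.1) (it p.+1 X))); last first.
  by apply/funext => n /=; rewrite /term addnK.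
apply: cvg_sum_seq => b bV; apply: cvgMl_tmp.
by apply: slope_cvg; rewrite ?phi_ge0 ?(V_phi_lt bV).
Qed.

(** The easy half of the limit: terms stay above their limits and the remainder is nonnegative. *)
Lemma Bsum_sum_le N X : 0 < X -> \sum_(p < N) Bsum p (A X) <= X^-1.
Proof.
move=> X0; rewrite (pole_expansion N X0).
have /andP[h _] := sum_V_le N X0.
apply: ler_wpDl => //; apply: ler_sum => p _; exact: Bsum_le_term.
Qed.

(* [X] and [it k X] give the same sum up to a factor close to [1], so the terms
   with large [p] are controlled by [(it k X)^-1], which is small. *)
Lemma term_shift n p K k X : 0 < X -> (0 < K)%N -> (K <= p)%N -> (p < n)%N ->
  term n p X <= (1 + k%:R / K%:R) * term n p (it k X).
Proof.
move=> X0 K0 Kp pn; rewrite /term mulr_sumr big_seq [leRHS]big_seq.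
apply: ler_sum => b bV; rewrite [leRHS]mulrCA ler_wpM2l//.
  by rewrite mulr_ge0 ?ltW ?dphi_gt0 ?(V_weight_gt0 bV).
rewrite /slope [leRHS]mulrCA ler_wpM2l ?(ltW (dit_gt0 _ _))//.
set m := (n - p.+1)%N; have mn : (m + p.+1)%N = n by rewrite subnK.
rewrite -![it m (it _ _)]itD mn -itD.
(* As [phi b.1 <= phi 0 <= phi X], the pole trails the orbit of [X] by at least [p] steps, hence by
   a distance of at least [K / it n X]; [k] further steps move the orbit by at most [k / it n X]. *)
have w1 : it m (phi b.1) <= it (m + 1) X.
  rewrite itD it_le (le_trans (y := phi 0))// ?phi_le ?(V_le0 bV)//.
  exact: ltW.
have h1 := it_sub_ge (m + 1) p X0.
have h2 := it_sub_le n k X0.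
rewrite -addnA add1n mn in h1.
have n0 := it_gt0 n X0.
have Kp' : K%:R <= p%:R :> R by rewrite ler_nat.
have K0' : 0 < K%:R :> R by rewrite ltr0n.
have p1 : K%:R / it n X <= p%:R / it n X.
  by rewrite ler_wpM2r// invr_ge0 ltW.
have q0 : 0 < K%:R / it n X by rewrite divr_gt0.
set d := it n X - it m (phi b.1).
have d0 : K%:R / it n X <= d by rewrite /d; lra.
have dK : k%:R / it n X <= k%:R / K%:R * d.
  rewrite -mulrA ler_wpM2l//  ler_pdivlMl//.
have d1 : 0 < d by lra.
set d' := it (n + k) X - it m (phi b.1).
have dd' : d' <= (1 + k%:R / K%:R) * d.
  by rewrite mulrDl mul1r /d'; move: d0 dK; rewrite /d; lra.
have d'0 : 0 < d'.
  have : it n X <= it (n + k) X.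
    rewrite addnC itD; elim: k {h2 dK dd' d'} => // j IH.
    by rewrite itS (le_trans IH)// phi_ge.
  by move: d1; rewrite /d /d'; lra.
by rewrite ler_pdivlMr// mulrC ler_pdivrMr.
Qed.

(** Classes [p < K] pass to the limit one by one. The others are compared with those of [it k X],
    where the full expansion adds up to [1 / it k X]. *)
Lemma Bsum_sum_ge K k X : 0 < X -> (0 < K)%N ->
  X^-1 <= \sum_(p < K) Bsum p (A X) + (1 + k%:R / K%:R) / it k X.
Proof.
move=> X0 K0; have Xk := it_gt0 k X0.
have c0 : 0 <= 1 + k%:R / K%:R :> R by rewrite addr_ge0// divr_ge0.
have H n : (K <= n)%N -> X^-1 <= (it n X)^-1 +
    (\sum_(p < K) term n p X + (1 + k%:R / K%:R) / it k X).
  move=> Kn; rewrite {1}(pole_expansion n X0).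
  have /andP[_ h] := sum_V_le n X0; apply: lerD => //.
  rewrite -!(big_mkord xpredT (fun p => term n p X)) (@big_cat_nat _ _ _ K)//=.
  rewrite lerD2l.
  apply: (@le_trans _ _ (\sum_(K <= p < n) (1 + k%:R / K%:R) * term n p (it k X))).
    rewrite big_nat [leRHS]big_nat; apply: ler_sum => p /andP[Kp pn].
    exact: term_shift.
  rewrite -mulr_sumr ler_wpM2l// (pole_expansion n Xk).
  have /andP[g _] := sum_V_le n Xk; rewrite ler_wpDl//.
  rewrite -(big_mkord xpredT (fun p => term n p (it k X))).
  rewrite [leRHS](@big_cat_nat _ _ _ K)//= lerDr.
  by apply: sumr_ge0 => p _; exact: term_ge0.
rewrite -[leRHS]add0r.
apply: (@ler_cvg_to _ \oo _ _ (fun=> X^-1) _ _ _ (cvg_cst _)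
  (cvgD (it_inv_cvg0 (ltW X0)) (cvgD (cvg_sum_seq _ _) (cvg_cst _)))).
  by move=> p _; exact: term_cvg.
by exists K => // n /= Kn; exact: H.
Qed.

Lemma Bsum_cvg X : 0 < X -> (fun N => \sum_(p < N) Bsum p (A X)) @ \oo --> X^-1.
Proof.
move=> X0.
(* Taking [k = K] turns the factor [1 + k / K] into 2. *)
apply: (@squeeze_cvgr _ _ _ _ (fun K => X^-1 - 2 * (it K X)^-1) (fun=> X^-1)).
- exists 1%N => // K /= K0; rewrite Bsum_sum_le// andbT.
  have := Bsum_sum_ge K X0 K0; rewrite divff ?pnatr_eq0 -?lt0n//.
  by rewrite (_ : 1 + 1 = 2); lra.
- have := cvgB (cvg_cst X^-1) (cvgM (cvg_cst (2 : R)) (it_inv_cvg0 (ltW X0))).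
  by rewrite mulr0 subr0; exact.
- exact: cvg_cst.
Qed.

End PartialFractions.

(** * The mean value property *)

Section Modulus.
Variable R : realType.
Local Notation C := R[i].
Implicit Types (z w : C).

(** The norm of [R[i]] has values in [R[i]]; this is the same modulus with values in [R], where the
    order is total and [lra] applies. *)
Definition cm z : R := complex.Re `|z|.

Lemma cmE z : `|z| = (cm z)%:C.
Proof. by rewrite /cm RRe_real// normr_real. Qed.

Lemma cm_def z : cm z = Num.sqrt (complex.Re z ^+ 2 + complex.Im z ^+ 2).
Proof. by rewrite /cm normc_def. Qed.

Lemma cm_ge0 z : 0 <= cm z.
Proof. by rewrite cm_def sqrtr_ge0. Qed.

Lemma cm_real (x : R) : cm x%:C = `|x|.
Proof. by rewrite cm_def /= expr0n/= addr0 sqrtr_sqr. Qed.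

Lemma cm0 : cm 0 = 0. Proof. by rewrite (cm_real 0) normr0. Qed.
Lemma cm1 : cm 1 = 1. Proof. by rewrite (cm_real 1) normr1. Qed.

Lemma cm_eq0 z : (cm z == 0) = (z == 0).
Proof. by rewrite -[RHS]normr_eq0 cmE -(inj_eq (@complexI R)). Qed.

Lemma cm_gt0 z : (0 < cm z) = (z != 0).
Proof. by rewrite lt0r cm_eq0 cm_ge0 andbT. Qed.

Lemma cmD z w : cm (z + w) <= cm z + cm w.
Proof. by rewrite -lecR rmorphD/= -!cmE ler_normD. Qed.

Lemma cmN z : cm (- z) = cm z. Proof. by rewrite /cm normrN. Qed.

Lemma cmB z w : cm (z - w) <= cm z + cm w.
Proof. by rewrite -(cmN w); exact: cmD. Qed.

Lemma cm_distC z w : cm (z - w) = cm (w - z).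
Proof. by rewrite -cmN opprB. Qed.

Lemma cmM z w : cm (z * w) = cm z * cm w.
Proof. by apply: (@complexI R); rewrite rmorphM/= -!cmE normrM. Qed.

Lemma cmV z : cm z^-1 = (cm z)^-1.
Proof. by apply: (@complexI R); rewrite fmorphV/= -!cmE normfV. Qed.

Lemma cm_i : cm 'i = 1.
Proof. by rewrite cm_def /= expr0n/= add0r expr1n sqrtr1. Qed.

Lemma cm_Re z : `|complex.Re z| <= cm z.
Proof.
rewrite cm_def -sqrtr_sqr ler_wsqrtr// lerDl; exact: sqr_ge0.
Qed.

Lemma cm_Im z : `|complex.Im z| <= cm z.
Proof.
rewrite cm_def -sqrtr_sqr ler_wsqrtr// lerDr; exact: sqr_ge0.
Qed.

Lemma cm_le z : cm z <= `|complex.Re z| + `|complex.Im z|.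
Proof.
rewrite [X in cm X]complexE (le_trans (cmD _ _))// cmM cm_i mul1r.
by rewrite !cm_real.
Qed.

Lemma cm_sum (I : Type) (s : seq I) (F : I -> C) :
  cm (\sum_(i <- s) F i) <= \sum_(i <- s) cm (F i).
Proof.
elim: s => [|i s IH]; first by rewrite !big_nil cm0.
by rewrite !big_cons (le_trans (cmD _ _))// lerD2l.
Qed.

Lemma ReD z w : complex.Re (z + w) = complex.Re z + complex.Re w.
Proof. by case: z => ? ?; case: w => ? ?. Qed.
Lemma ReN z : complex.Re (- z) = - complex.Re z.
Proof. by case: z. Qed.
Lemma ImD z w : complex.Im (z + w) = complex.Im z + complex.Im w.
Proof. by case: z => ? ?; case: w => ? ?. Qed.
Lemma ImN z : complex.Im (- z) = - complex.Im z.
Proof. by case: z. Qed.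
End Modulus.

(** * Integrals along horizontal and vertical segments *)

Section Primitive.
Variable R : realType.
Local Notation C := R[i].

(** The base point [lo] always lies strictly below the arguments in use, so that the derivative
    there is two-sided. *)
Definition prim (lo : R) (u : R -> R) (x : R) : R :=
  \int[lebesgue_measure]_(t in `[lo, x]) u t.

Lemma prim_derive (lo x : R) (u : R -> R) : continuous u -> lo < x -> is_derive x 1 (prim lo u) (u x).
Proof.
move=> cu lox.
have x1 : x < x + 1 by rewrite ltrDl.
have cx : {for x, continuous u} by exact: cu.
have [|d e] := @continuous_FTC1_closed R u lo x (x + 1) x1 _ lox cx.
  apply: continuous_compact_integrable; first exact: segment_compact.
  exact: continuous_subspaceT.
by rewrite derive1E in e; rewrite /prim; split.
Qed.

Lemma derive_bound (F dF : R -> R) (s t e : R) : s <= t ->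
  (forall x, s <= x <= t -> is_derive x 1 F (dF x)) ->
  (forall x, s <= x <= t -> `|dF x| <= e) -> `|F t - F s| <= e * (t - s).
Proof.
move=> st hF he.
have [||c] := @MVT_segment _ F dF s t st.
- by move=> x /[!in_itv]/= /andP[sx xt]; apply: hF; rewrite !ltW.
- apply: derivable_within_continuous => x /[!in_itv]/= hx.
  by have := hF x hx => ?; exact: ex_derive.
rewrite in_itv/= => hc ->.
by rewrite normrM (ger0_norm (x := t - s)) ?subr_ge0// ler_wpM2r ?subr_ge0// he.
Qed.

Lemma prim_bound (lo s t e : R) (u1 u2 : R -> R) : continuous u1 -> continuous u2 ->
  lo < s -> s <= t -> (forall x, s <= x <= t -> `|u1 x - u2 x| <= e) ->
  `|(prim lo u1 t - prim lo u1 s) - (prim lo u2 t - prim lo u2 s)| <= e * (t - s).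
Proof.
move=> c1 c2 los st he.
pose F := (prim lo u1 - prim lo u2).
rewrite (_ : _ - _ = F t - F s); last by rewrite /F !fctE; ring.
apply: (@derive_bound F (fun x => u1 x - u2 x)) => // x /andP[sx xt].
by apply: is_deriveB; apply: prim_derive => //; exact: lt_le_trans sx.
Qed.

Lemma prim_affine (lo a b s t : R) : lo < s -> s <= t ->
  prim lo (fun x => a + x * b) t - prim lo (fun x => a + x * b) s =
  a * (t - s) + b * ((t ^+ 2 - s ^+ 2) / 2).
Proof.
move=> los st; apply/eqP; rewrite -subr_eq0 -normr_le0.
have ca : continuous (fun x : R => a + x * b).
  move=> x; apply: cvgD; first exact: cvg_cst.
  by apply: cvgM; [exact: cvg_id|exact: cvg_cst].
pose F := (prim lo (fun x => a + x * b) - (fun x => a * x + b / 2 * x ^+ 2)).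
rewrite (_ : _ - _ = F t - F s); last by rewrite /F !fctE; field.
rewrite -[leRHS](mul0r (t - s)).
apply: (@derive_bound F (fun x => (a + x * b) - (a + x * b))) => //; last first.
  by move=> x _; rewrite subrr normr0.
move=> x /andP[sx xt]; apply: is_deriveB.
  by apply: prim_derive => //; exact: lt_le_trans sx.
apply: is_derive_eq.
rewrite /GRing.scale/= !mulr1; by field.
Qed.

Definition cprim lo (k : R -> C) (x : R) : C :=
  prim lo (fun t => complex.Re (k t)) x +i* prim lo (fun t => complex.Im (k t)) x.

Definition ccont (k : R -> C) :=
  continuous (fun t => complex.Re (k t)) /\ continuous (fun t => complex.Im (k t)).

(** Real and imaginary parts are bounded separately, whence the factor 2, which survives in
    [mean_value]. *)
Lemma cprim_bound (lo s t e : R) (k1 k2 : R -> C) : ccont k1 -> ccont k2 ->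
  lo < s -> s <= t -> (forall x, s <= x <= t -> cm (k1 x - k2 x) <= e) ->
  cm ((cprim lo k1 t - cprim lo k1 s) - (cprim lo k2 t - cprim lo k2 s))
    <= 2 * e * (t - s).
Proof.
move=> [c1 d1] [c2 d2] los st he.
apply: le_trans (cm_le _) _; rewrite -mulrA mulrDl !mul1r; apply: lerD.
  rewrite !(ReD, ReN); apply: prim_bound => // x hx.
  by apply: le_trans (he x hx); rewrite -ReN -ReD cm_Re.
rewrite !(ImD, ImN); apply: prim_bound => // x hx.
by apply: le_trans (he x hx); rewrite -ImN -ImD cm_Im.
Qed.

Lemma ccont_affine (a b : C) : ccont (fun x => a + x%:C * b).
Proof.
case: a b => [a1 a2] [b1 b2]; split => x /=.
  rewrite (_ : (fun t : R => _) = (fun t => a1 + t * b1)).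
    apply: cvgD; first exact: cvg_cst.
    by apply: cvgM; [exact: cvg_id|exact: cvg_cst].
  by apply/funext => t; rewrite mul0r subr0.
rewrite (_ : (fun t : R => _) = (fun t => a2 + t * b2)).
  apply: cvgD; first exact: cvg_cst.
  by apply: cvgM; [exact: cvg_id|exact: cvg_cst].
by apply/funext => t; rewrite mul0r addr0.
Qed.

Lemma cprim_affine (lo s t : R) (a b : C) : lo < s -> s <= t ->
  cprim lo (fun x => a + x%:C * b) t - cprim lo (fun x => a + x%:C * b) s =
  a * (t - s)%:C + b * ((t ^+ 2 - s ^+ 2) / 2)%:C.
Proof.
case: a b => [a1 a2] [b1 b2] los st.
have e1 : (fun x : R => complex.Re (a1 +i* a2 + x%:C * (b1 +i* b2))) =
    (fun x => a1 + x * b1).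
  by apply/funext => x /=; rewrite mul0r subr0.
have e2 : (fun x : R => complex.Im (a1 +i* a2 + x%:C * (b1 +i* b2))) =
    (fun x => a2 + x * b2).
  by apply/funext => x /=; rewrite mul0r addr0.
apply/eqP; rewrite eq_complex; apply/andP; split; apply/eqP.
  rewrite !(ReD, ReN) /cprim [LHS]/= e1 prim_affine//=; ring.
rewrite !(ImD, ImN) /cprim [LHS]/= e2 prim_affine//=; ring.
Qed.

End Primitive.

(** * Goursat's lemma on rectangles *)

Lemma nested_point (R : realType) (a l : nat -> R) :
  (forall n, a n <= a n.+1) -> (forall n, a n.+1 + l n.+1 <= a n + l n) ->
  (forall n, 0 <= l n) -> exists x, forall n, a n <= x <= a n + l n.
Proof.
move=> ha hb hl.
have am n m : (n <= m)%N -> a n <= a m.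
  by move=> /subnKC <-; elim: (m - n)%N => [|j IH]; rewrite ?addn0// addnS (le_trans IH).
have bm n m : (n <= m)%N -> a m + l m <= a n + l n.
  by move=> /subnKC <-; elim: (m - n)%N => [|j IH]; rewrite ?addn0// addnS (le_trans _ IH).
have ub n m : a m <= a n + l n.
  have [mn|nm] := leqP m n; first by rewrite (le_trans (am _ _ mn))// lerDl.
  by rewrite (le_trans _ (bm _ _ (ltnW nm)))// lerDl.
exists (sup (range a)) => n; apply/andP; split.
  by apply: ub_le_sup; [exists (a 0%N + l 0%N) => _ [m _ <-]|exists n].
by apply: ge_sup; [exists (a 0%N); exists 0%N|move=> _ [m _ <-]].
Qed.

Section Goursat.
Variable R : realType.
Local Notation C := R[i].
Variables (lo lo' : R) (k : R -> R -> C).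
Hypothesis kx : forall y, ccont (fun x => k x y).
Hypothesis ky : forall x, ccont (k x).

Let H (y x : R) : C := cprim lo (fun x => k x y) x.
Let V (x y : R) : C := cprim lo' (k x) y.

(* The integral of [k] along the boundary of a rectangle. *)
Definition rect_int (x1 x2 y1 y2 : R) : C :=
  (H y1 x2 - H y1 x1) - (H y2 x2 - H y2 x1)
  + 'i * ((V x2 y2 - V x2 y1) - (V x1 y2 - V x1 y1)).

(** Complex differentiability in two real coordinates: the linear part is multiplication of the
    displacement by the single complex number [d]. *)
Definition cdiff_at (x y : R) (d : C) : Prop :=
  forall e : R, 0 < e -> exists2 r : R, 0 < r &
    forall x' y' : R, `|x' - x| <= r -> `|y' - y| <= r ->
      cm (k x' y' - k x y - d * ((x' - x) +i* (y' - y)))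
        <= e * (`|x' - x| + `|y' - y|).

Lemma rect_split x1 xm x2 y1 ym y2 :
  rect_int x1 x2 y1 y2 = rect_int x1 xm y1 ym + rect_int xm x2 y1 ym
     + rect_int x1 xm ym y2 + rect_int xm x2 ym y2.
Proof. by rewrite /rect_int; ring. Qed.

(** The affine part of [k] has boundary integral 0 ([E0]). The rest is at most [e * (w + h)] on a
    boundary of length [2 * (w + h)], and [cprim_bound] adds a factor 2. *)
Lemma rect_small (x y : R) (d : C) (e r x1 y1 w h : R) : lo < x1 -> lo' < y1 ->
  0 <= w -> 0 <= h -> 0 <= e -> w <= r -> h <= r ->
  x1 <= x <= x1 + w -> y1 <= y <= y1 + h ->
  (forall x' y' : R, `|x' - x| <= r -> `|y' - y| <= r ->
      cm (k x' y' - k x y - d * ((x' - x) +i* (y' - y)))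
        <= e * (`|x' - x| + `|y' - y|)) ->
  cm (rect_int x1 (x1 + w) y1 (y1 + h)) <= 4 * e * (w + h) ^+ 2.
Proof.
move=> lox loy w0 h0 e0 wr hr /andP[x1x xx1] /andP[y1y yy1] K.
pose x2 := x1 + w; pose y2 := y1 + h.
have B x' y' : x1 <= x' <= x2 -> y1 <= y' <= y2 ->
    cm (k x' y' - (k x y + d * ((x' - x) +i* (y' - y)))) <= e * (w + h).
  rewrite /x2 /y2 => /andP[a b] /andP[a' b'].
  have hx : `|x' - x| <= w by rewrite ler_norml; apply/andP; split; lra.
  have hy : `|y' - y| <= h by rewrite ler_norml; apply/andP; split; lra.
  rewrite opprD addrA; apply: le_trans (K _ _ (le_trans hx wr) (le_trans hy hr)) _.
  by rewrite ler_wpM2l// lerD.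
pose cx (y' : R) := k x y + d * ((- x) +i* (y' - y)).
pose cy (x' : R) := k x y + d * ((x' - x) +i* (- y)).
have Ex (x' y' : R) : k x y + d * ((x' - x) +i* (y' - y)) = cx y' + x'%:C * d.
  rewrite /cx -addrA; congr (_ + _); rewrite [_ * d]mulrC -mulrDr; congr (_ * _).
  by apply/eqP; rewrite eq_complex /=; apply/andP; split; apply/eqP; ring.
have Ey (x' y' : R) : k x y + d * ((x' - x) +i* (y' - y)) = cy x' + y'%:C * ('i * d).
  rewrite /cy -addrA; congr (_ + _).
  rewrite (_ : y'%:C * ('i * d) = d * (y'%:C * 'i)) -?mulrDr; last by ring.
  congr (_ * _).
  by apply/eqP; rewrite eq_complex /=; apply/andP; split; apply/eqP; ring.
have x12 : x1 <= x2 by rewrite lerDl.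
have y12 : y1 <= y2 by rewrite lerDl.
have Hb y' : y1 <= y' <= y2 -> cm ((H y' x2 - H y' x1) -
    (cx y' * (x2 - x1)%:C + d * ((x2 ^+ 2 - x1 ^+ 2) / 2)%:C)) <= 2 * (e * (w + h)) * (x2 - x1).
  move=> hy; rewrite -(cprim_affine _ _ lox x12).
  apply: cprim_bound => //; first exact: ccont_affine.
  by move=> x' hx; rewrite -Ex; exact: B.
have Vb x' : x1 <= x' <= x2 -> cm ((V x' y2 - V x' y1) -
    (cy x' * (y2 - y1)%:C + 'i * d * ((y2 ^+ 2 - y1 ^+ 2) / 2)%:C)) <= 2 * (e * (w + h)) * (y2 - y1).
  move=> hx; rewrite -(cprim_affine _ _ loy y12).
  apply: cprim_bound => //; first exact: ccont_affine.
  by move=> y' hy; rewrite -Ey; exact: B.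
have := Hb y1; have := Hb y2; have := Vb x1; have := Vb x2.
rewrite !lexx x12 y12 => /(_ isT) V2 /(_ isT) V1 /(_ isT) H2 /(_ isT) H1.
rewrite -/x2 -/y2 /rect_int.
move: V2 V1 H2 H1.
set v2 := V x2 y2 - _; set v1 := V x1 y2 - _; set h2 := H y2 x2 - _; set h1 := H y1 x2 - _.
set a2 := cy x2 * _ + _; set a1 := cy x1 * _ + _; set b2 := cx y2 * _ + _; set b1 := cx y1 * _ + _.
move=> V2 V1 H2 H1.
have E0 : b1 - b2 + 'i * (a2 - a1) = 0.
  rewrite /b1 /b2 /a2 /a1 /cx /cy.
  case: (k x y) => p q; case: (d) => d1 d2.
  apply/eqP; rewrite eq_complex /=; apply/andP; split; apply/eqP; by field.
have -> : h1 - h2 + 'i * (v2 - v1) = (h1 - b1) - (h2 - b2) + 'i * ((v2 - a2) - (v1 - a1)).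
  rewrite -[LHS]subr0 -[in LHS]E0; ring.
apply: le_trans (cmD _ _) _.
have := cmB (h1 - b1) (h2 - b2); have := cmB (v2 - a2) (v1 - a1).
rewrite cmM cm_i mul1r.
have -> : (4 : R) * e * (w + h) ^+ 2 = 2 * (e * (w + h)) * w + 2 * (e * (w + h)) * w +
   (2 * (e * (w + h)) * h + 2 * (e * (w + h)) * h) by ring.
have ex : x2 - x1 = w by rewrite /x2 addrAC subrr add0r.
have ey : y2 - y1 = h by rewrite /y2 addrAC subrr add0r.
rewrite ex in H1 H2; rewrite ey in V1 V2.
move=> hv hh; apply: lerD.
  by rewrite (le_trans hh)// lerD.
by rewrite (le_trans hv)// lerD.
Qed.

(** Pigeonhole on [rect_split]: [c] is the lower left corner of a quarter that carries at least a
    fourth of the integral. *)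
Lemma rect_quarter (x y w h : R) : exists c : R * R,
  [/\ c.1 = x \/ c.1 = x + w, c.2 = y \/ c.2 = y + h &
   cm (rect_int x (x + w + w) y (y + h + h)) <=
     4 * cm (rect_int c.1 (c.1 + w) c.2 (c.2 + h))].
Proof.
have E := rect_split x (x + w) (x + w + w) y (y + h) (y + h + h).
have [hP|hP] := lerP (cm (rect_int x (x + w + w) y (y + h + h)))
    (4 * cm (rect_int x (x + w) y (y + h))).
  by exists (x, y); split => //=; left.
have [hQ|hQ] := lerP (cm (rect_int x (x + w + w) y (y + h + h)))
    (4 * cm (rect_int (x + w) (x + w + w) y (y + h))).
  by exists (x + w, y); split => //=; [right|left].
have [hS|hS] := lerP (cm (rect_int x (x + w + w) y (y + h + h)))
    (4 * cm (rect_int x (x + w) (y + h) (y + h + h))).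
  by exists (x, y + h); split => //=; [left|right].
exists (x + w, y + h); split => /=; [by right|by right|].
have h4 := cmD (rect_int x (x + w) y (y + h)) (rect_int (x + w) (x + w + w) y (y + h)).
have h5 := cmD (rect_int x (x + w) y (y + h) + rect_int (x + w) (x + w + w) y (y + h))
  (rect_int x (x + w) (y + h) (y + h + h)).
have h6 := cmD (rect_int x (x + w) y (y + h) + rect_int (x + w) (x + w + w) y (y + h)
  + rect_int x (x + w) (y + h) (y + h + h))
  (rect_int (x + w) (x + w + w) (y + h) (y + h + h)).
rewrite -E in h6.
move: hP hQ hS h4 h5 h6.
move: (cm (rect_int x (x + w + w) y (y + h + h))) => M.
move: (cm (rect_int x (x + w) y (y + h))) (cm (rect_int (x + w) (x + w + w) y (y + h)))
  (cm (rect_int x (x + w) (y + h) (y + h + h)))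
  (cm (rect_int (x + w) (x + w + w) (y + h) (y + h + h))) => a b c d.
move: (cm _) (cm _) => e f; lra.
Qed.

(** Bisection leads to a point of the rectangle. After [n] steps the integral is at least [M / 4^n],
    while differentiability at that point bounds it by [4 * e * (w + h)^2 / 4^n]. *)
Theorem goursat (x1 y1 w h : R) : lo < x1 -> lo' < y1 -> 0 <= w -> 0 <= h ->
  (forall x y, x1 <= x <= x1 + w -> y1 <= y <= y1 + h -> exists d, cdiff_at x y d) ->
  rect_int x1 (x1 + w) y1 (y1 + h) = 0.
Proof.
have aux (a b : R) : 0 < a -> 0 <= a * b -> 4 * a * b < a * (8 * b + 8).
  by lra.
move=> lox loy w0 h0 hd.
pose l (w : R) n := w / 2 ^+ n.
have lS u n : l u n = l u n.+1 + l u n.+1.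
  by rewrite /l exprS invfM; field; rewrite expf_neq0.
have l0 u n : 0 <= u -> 0 <= l u n by move=> u0; rewrite divr_ge0// exprn_ge0.
have [q hq] := choice (fun p : nat * (R * R) =>
  rect_quarter p.2.1 p.2.2 (l w p.1.+1) (l h p.1.+1)).
pose c := fix c n := if n is n'.+1 then q (n', c n') else (x1, y1).
pose M := cm (rect_int x1 (x1 + w) y1 (y1 + h)).
have Mn n : M <= 4 ^+ n * cm (rect_int (c n).1 ((c n).1 + l w n) (c n).2 ((c n).2 + l h n)).
  elim: n => [|n IH]; first by rewrite expr0 mul1r /l !expr0 !divr1.
  apply: le_trans IH _; rewrite exprSr -mulrA ler_wpM2l ?exprn_ge0//.
  have [_ _] := hq (n, c n); rewrite /= -!addrA -!lS //.
have c1 n : (c n.+1).1 = (c n).1 \/ (c n.+1).1 = (c n).1 + l w n.+1.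
  by have [] := hq (n, c n).
have c2 n : (c n.+1).2 = (c n).2 \/ (c n.+1).2 = (c n).2 + l h n.+1.
  by have [] := hq (n, c n).
have [X HX] : exists x, forall n, (c n).1 <= x <= (c n).1 + l w n.
  apply: nested_point => n; last exact: l0.
    by have := l0 w n.+1 w0; case: (c1 n) => ->; lra.
  by have := l0 w n.+1 w0; rewrite (lS w n); case: (c1 n) => ->; lra.
have [Y HY] : exists x, forall n, (c n).2 <= x <= (c n).2 + l h n.
  apply: nested_point => n; last exact: l0.
    by have := l0 h n.+1 h0; case: (c2 n) => ->; lra.
  by have := l0 h n.+1 h0; rewrite (lS h n); case: (c2 n) => ->; lra.
have c1lo n : x1 <= (c n).1.
  elim: n => // n IH; have := l0 w n.+1 w0; case: (c1 n) => ->; lra.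
have c2lo n : y1 <= (c n).2.
  elim: n => // n IH; have := l0 h n.+1 h0; case: (c2 n) => ->; lra.
have [d D] : exists d, cdiff_at X Y d.
  have := HX 0%N; have := HY 0%N; rewrite /= /l !expr0 !divr1 => ? ?; exact: hd.
apply/eqP; rewrite -cm_eq0; apply: contraT => M0; rewrite -/M in M0.
have Mp : 0 < M by rewrite lt_def M0 cm_ge0.
pose s := (w + h) ^+ 2; have s0 : 0 <= s := sqr_ge0 _.
(* Chosen to make [4 * e * s < M], also when [s = 0]. *)
pose e := M / (8 * s + 8).
have e0 : 0 < e by rewrite divr_gt0//; lra.
have [r r0 K] := D e e0.
have [n nr] : exists n, l w n <= r /\ l h n <= r.
  have := archi_boundP (divr_ge0 (addr_ge0 w0 h0) (ltW r0)).
  set n := Num.Def.archi_bound _ => hn; exists n.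
  have h2 : n%:R <= 2 ^+ n :> R by rewrite -natrX ler_nat ltnW// ltn_expl.
  have p2 : 0 < 2 ^+ n :> R by rewrite exprn_gt0.
  have : w + h <= r * 2 ^+ n.
    by rewrite -ler_pdivrMl// mulrC; lra.
  by rewrite /l !ler_pdivrMr//; split; lra.
have := rect_small (lt_le_trans lox (c1lo n)) (lt_le_trans loy (c2lo n))
  (l0 w n w0) (l0 h n h0) (ltW e0) nr.1 nr.2 (HX n) (HY n) K.
have : 4 * e * (l w n + l h n) ^+ 2 = (4 ^+ n)^-1 * (4 * e * s).
  have -> : (4 : R) ^+ n = 2 ^+ n * 2 ^+ n by rewrite -exprMn; congr (_ ^+ _); lra.
  by rewrite /l /s -mulrDl; field; rewrite expf_neq0.
move=> -> hh.
have := Mn n; have p4 : 0 < 4 ^+ n :> R by rewrite exprn_gt0.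
move: hh; rewrite ler_pdivlMl// => hh hM.
have : M <= 4 * e * s by exact: le_trans hM hh.
have eM : e * (8 * s + 8) = M by rewrite /e divfK// gt_eqF//; lra.
move=> M4; suff : M < M by rewrite ltxx.
apply: le_lt_trans M4 _; rewrite -eM.
have : 0 <= e * s by rewrite mulr_ge0// ltW.
exact: aux.
Qed.

End Goursat.

Lemma is_derive_approx (K : numFieldType) (f : K^o -> K^o) (x d : K) :
  is_derive (x : K^o) (1 : K^o) f d -> forall e : K, 0 < e ->
  exists2 r : K, 0 < r & forall h : K, `|h| < r ->
    `|f (x + h) - f x - d * h| <= e * `|h|.
Proof.
move=> [df dE] e e0; move: df; rewrite /derivable => /cvg_ex[l Hl].
have ld : l = d.
  by rewrite -dE /derive; apply/esym/cvg_lim => //; exact: Hl.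
move: Hl; rewrite ld => /cvgrPdist_lt/(_ e e0).
rewrite near_withinE near_simpl => /nbhs_normP[r /= r0 Hr].
exists r => // h hr.
have [->|h0] := eqVneq h 0; first by rewrite addr0 subrr mulr0 subr0 !normr0 mulr0.
have := Hr h; rewrite /ball_/= sub0r normrN => /(_ hr h0).
rewrite [h%:A]mulr1 => /ltW H.
have -> : f (x + h) - f x - d * h = - ((d - h^-1 *: (f (h + x) - f x)) * h).
  rewrite mulrBl opprB; congr (_ - _).
  by rewrite [_ *: _]/(_ * _) mulrAC mulVf// mul1r [h + x]addrC.
by rewrite normrN normrM ler_wpM2r.
Qed.

(** * The exponential in real coordinates, and differentiability by moduli *)

Section ComplexExp.
Variable R : realType.
Local Notation C := R[i].

Definition cexp (x y : R) : C := (expR x * cos y) +i* (expR x * sin y).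

Lemma cexpD x y h t : cexp (x + h) (y + t) = cexp x y * cexp h t.
Proof.
rewrite /cexp expRD cosD sinD.
by apply/eqP; rewrite eq_complex /=; apply/andP; split; apply/eqP; ring.
Qed.

Lemma cm_cexp x y : cm (cexp x y) = expR x.
Proof.
rewrite cm_def /= !exprMn -mulrDr cos2Dsin2 mulr1 sqrtr_sqr.
by rewrite gtr0_norm// expR_gt0.
Qed.

(** The derivative of the complex exponential at 0 is 1, assembled from the real derivatives of
    [expR], [cos] and [sin]. *)
Lemma cexp_approx (e : R) : 0 < e -> exists2 r : R, 0 < r &
  forall h t : R, `|h| <= r -> `|t| <= r ->
    cm (cexp h t - 1 - h +i* t) <= e * (`|h| + `|t|).
Proof.
wlog e1 : e / e <= 1 => [H|] e0.
  have [e1|/ltW e1] := lerP e 1; first exact: H.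
  have [r r0 Hr] := H 1 (lexx _) ltr01; exists r => // h t hr tr.
  by apply: le_trans (Hr h t hr tr) _; rewrite ler_wpM2r// addr_ge0.
have d0 : 0 < e / 8 by rewrite divr_gt0.
have [r1 r10 H1] := is_derive_approx (is_derive_expR (0 : R)) d0.
have [r2 r20 H2] := is_derive_approx (is_derive_cos (0 : R)) d0.
have [r3 r30 H3] := is_derive_approx (is_derive_sin (0 : R)) d0.
pose r := Num.min (Num.min r1 r2) (Num.min r3 (e / 8)).
have r0 : 0 < r by rewrite !lt_min r10 r20 r30 d0.
exists (r / 2); first by rewrite divr_gt0.
move=> h t hr tr.
have rr : r / 2 < r by lra.
have : `|h| < r by exact: le_lt_trans rr.
have : `|t| < r by exact: le_lt_trans rr.
rewrite !lt_min => /andP[/andP[_ t2] /andP[t3 t4]] /andP[/andP[h1 _] /andP[_ h4]].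
have := H1 h h1; have := H2 t t2; have := H3 t t3.
rewrite !add0r expR0 cos0 sin0 oppr0 !mul0r !subr0 !mul1r => S3 S2 S1; rewrite ?addr0 in S3.
have cb : `|cos t| <= 1 by rewrite ler_norml cos_geN1 cos_le1.
have eb : `|expR h - 1| <= 2 * `|h|.
  have -> : expR h - 1 = (expR h - 1 - h) + h by ring.
  apply: le_trans (ler_normD _ _) _.
  have : e / 8 * `|h| <= `|h| by rewrite ler_piMl//; lra.
  lra.
have eb3 : `|expR h| <= 2.
  have -> : expR h = (expR h - 1) + 1 by ring.
  apply: le_trans (ler_normD _ _) _; rewrite normr1; lra.
have h0 := normr_ge0 h; have t0 := normr_ge0 t.
apply: le_trans (cm_le _) _.
rewrite mulrDr; rewrite (_ : e * `|h| + e * `|t| = (e / 8 * `|h| + e/4 * `|t|) + (e * `|h| * (7/8) + e * `|t| * (3/4))); last by field.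
apply: lerD.
  rewrite /= (_ : _ - _ - _ = (expR h - 1 - h) * cos t + (1 + h) * (cos t - 1)); last by ring.
  apply: le_trans (ler_normD _ _) _; rewrite !normrM; apply: lerD.
    by rewrite -[leRHS]mulr1 ler_pM.
  have : `|1 + h| <= 2 by apply: le_trans (ler_normD _ _) _; rewrite normr1; lra.
  move=> h2; rewrite (_ : e / 4 * `|t| = 2 * (e / 8 * `|t|)); last by field.
  by rewrite ler_pM.
rewrite /= subr0 (_ : _ - _ = expR h * (sin t - t) + (expR h - 1) * t); last by ring.
apply: le_trans (ler_normD _ _) _; rewrite !normrM.
have A1 : `|expR h| * `|sin t - t| <= 2 * (e / 8 * `|t|) by rewrite ler_pM.
have A2 : `|expR h - 1| * `|t| <= 2 * (e / 8) * `|t|.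
  by rewrite ler_wpM2r// (le_trans eb)// ler_wpM2l// ltW.
have : 0 <= e * `|h| by rewrite mulr_ge0// ltW.
have : 0 <= e * `|t| by rewrite mulr_ge0// ltW.
lra.
Qed.

Definition ccont_at (g : C -> C) (z : C) : Prop := forall e : R, 0 < e ->
  exists2 r : R, 0 < r & forall w, cm (w - z) <= r -> cm (g w - g z) <= e.

Definition cder (g : C -> C) (z d : C) : Prop := forall e : R, 0 < e ->
  exists2 r : R, 0 < r & forall w, cm (w - z) <= r ->
    cm (g w - g z - d * (w - z)) <= e * cm (w - z).

Lemma cder_cont g z d : cder g z d -> ccont_at g z.
Proof.
move=> H e e0; have [r r0 Hr] := H 1 ltr01.
have c0 := cm_ge0 d.
exists (Num.min r (e / (1 + cm d))).
  by rewrite lt_min r0 divr_gt0//; lra.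
move=> w; rewrite le_min => /andP[wr we].
have -> : g w - g z = (g w - g z - d * (w - z)) + d * (w - z) by ring.
apply: le_trans (cmD _ _) _; rewrite cmM.
have := Hr w wr; rewrite mul1r.
have : (1 + cm d) * cm (w - z) <= e.
  by rewrite mulrC -ler_pdivlMr//; lra.
lra.
Qed.

Lemma cexp_cont_at x y (e : R) : 0 < e -> exists2 r : R, 0 < r &
  forall x' y' : R, `|x' - x| <= r -> `|y' - y| <= r ->
    cm (cexp x' y' - cexp x y) <= e.
Proof.
move=> e0; have [r r0 Hr] := cexp_approx ltr01.
have p0 := expR_gt0 x.
exists (Num.min r (e / (4 * expR x))).
  by rewrite lt_min r0 divr_gt0// mulr_gt0.
move=> x' y'; rewrite !le_min => /andP[xr xe] /andP[yr ye].
rewrite -[x'](subrK x) -[y'](subrK y) [_ + x]addrC [_ + y]addrC cexpD.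
rewrite -{2}[cexp x y]mulr1 -mulrBr cmM cm_cexp.
have := Hr _ _ xr yr; rewrite mul1r => H.
have : cm (cexp (x' - x) (y' - y) - 1) <= 2 * (`|x' - x| + `|y' - y|).
  rewrite -[_ - 1](subrK ((x' - x) +i* (y' - y))).
  apply: le_trans (cmD _ _) _.
  have := cm_le ((x' - x) +i* (y' - y)); rewrite /=; lra.
move=> H2; rewrite -ler_pdivlMl//; apply: le_trans H2 _.
move: xe ye; rewrite invfM mulrA [e / 4]mulrC -mulrA; lra.
Qed.

End ComplexExp.

(** * Circle integrals in logarithmic coordinates *)

Section MeanValue.
Variable R : realType.
Local Notation C := R[i].

Lemma ccontP (g : R -> C) :
  (forall t e : R, 0 < e -> exists2 r : R, 0 < r &
     forall t', `|t' - t| <= r -> cm (g t' - g t) <= e) -> ccont g.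
Proof.
move=> H; split=> t; apply/cvgrPdist_le => e e0; have [r r0 Hr] := H t e e0;
  apply/nbhs_normP; exists r => //= t'; rewrite /ball_/= distrC => /ltW/Hr;
  apply: le_trans; rewrite -?ReN -?ReD -?ImN -?ImD cm_distC ?cm_Re ?cm_Im//.
Qed.

(** Induction on the exceptional points: continuity of [J] at each of them glues the constants on
    its two sides. *)
Lemma locally_constant (J : R -> C) (E : seq R) (X : R) :
  (forall x e : R, x <= X -> 0 < e -> exists2 r : R, 0 < r &
     forall x', x' <= X -> `|x' - x| <= r -> cm (J x' - J x) <= e) ->
  (forall a c, a <= c -> c <= X -> (forall x, a <= x <= c -> x \notin E) -> J a = J c) ->
  forall a c, a <= c -> c <= X -> J a = J c.
Proof.
move=> Jc; elim: E => [|e E IH] H a c ac cX; first exact: H.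
apply: IH ac cX => a' c' ac cX aE.
have eqJ x y : (forall d : R, 0 < d -> cm (J x - J y) <= d) -> J x = J y.
  move=> h; apply/eqP; rewrite -subr_eq0 -cm_eq0; apply: contraT => n0.
  have p0 : 0 < cm (J x - J y) by rewrite lt_def n0 cm_ge0.
  by have := h _ (divr_gt0 p0 (ltr0n _ 2)); lra.
have nE x y : x <= y -> y <= X -> a' <= x -> y <= c' -> (y < e \/ e < x) -> J x = J y.
  move=> xy yX ax yc h; apply: H => // z /andP[xz zy].
  rewrite inE negb_or aE ?andbT; last by apply/andP; split; lra.
  by apply/eqP => ez; case: h; lra.
have [ea|ea] := ltP e a'; first by apply: nE => //; right.
have [ce|ce] := ltP c' e; first by apply: nE => //; left.
have eX : e <= X by lra.
transitivity (J e).
  move: ea; rewrite le_eqVlt => /orP[/eqP -> //|ae]; apply: eqJ => d d0.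
  have [r r0 Hr] := Jc e d eX d0.
  pose x := Num.max a' (e - r).
  have xe : x < e by rewrite gt_max ae/=; lra.
  have ax : a' <= x by rewrite le_max lexx.
  have rx : e - r <= x by rewrite le_max lexx orbT.
  have -> : J a' = J x by apply: nE => //; first [lra | by left].
  by apply: Hr; first lra; rewrite ler_norml; apply/andP; split; lra.
move: ce; rewrite le_eqVlt => /orP[/eqP -> //|ae]; apply/esym/eqJ => d d0.
have [r r0 Hr] := Jc e d eX d0.
pose x := Num.min c' (e + r).
have xe : e < x by rewrite lt_min ae/=; lra.
have ax : x <= c' by rewrite ge_min lexx.
have rx : x <= e + r by rewrite ge_min lexx orbT.
have <- : J x = J c' by apply: nE => //; first [lra | by right].
by apply: Hr; first lra; rewrite ler_norml; apply/andP; split; lra.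
Qed.

Lemma uniform_on_segment (k : R -> R -> C) (x0 s t : R) :
  (forall y e : R, 0 < e -> exists2 r : R, 0 < r & forall x' y' : R,
     `|x' - x0| <= r -> `|y' - y| <= r -> cm (k x' y' - k x0 y) <= e) ->
  forall e : R, 0 < e -> exists2 r : R, 0 < r & forall x' y : R,
    `|x' - x0| <= r -> s <= y <= t -> cm (k x' y - k x0 y) <= e.
Proof.
move=> Hk e e0.
have /compact_near_coveringP := @segment_compact R s t.
move=> /(_ R (nbhs x0) (fun x' y => cm (k x' y - k x0 y) <= e) _).
case.
  move=> y _; have [r r0 Hr] := Hk y (e / 2) (divr_gt0 e0 (ltr0n _ 2)).
  exists (ball y r, ball x0 r) => /=.
    by split; apply: nbhsx_ballx.
  move=> [y' x'] /= [yy xx].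
  rewrite /ball/= in yy xx.
  have h1 : cm (k x' y' - k x0 y) <= e / 2.
    by apply: Hr; rewrite distrC ltW.
  have h2 : cm (k x0 y' - k x0 y) <= e / 2.
    by apply: Hr; rewrite ?subrr ?normr0 ?ltW// distrC.
  have -> : k x' y' - k x0 y' = (k x' y' - k x0 y) - (k x0 y' - k x0 y) by ring.
  by apply: le_trans (cmB _ _) _; lra.
move=> r /= r0 Hr; exists (r / 2); first by rewrite divr_gt0.
move=> x' y xr yst; apply: (Hr x') => //=.
by rewrite /ball/= distrC (le_lt_trans xr)//; lra.
Qed.

Lemma rect_int_periodic (lo lo' : R) (k : R -> R -> C) (a c s t : R) :
  (fun x => k x t) = (fun x => k x s) -> rect_int lo lo' k a c s t = 0 ->
  cprim lo' (k a) t - cprim lo' (k a) s = cprim lo' (k c) t - cprim lo' (k c) s.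
Proof.
move=> kp; rewrite /rect_int kp subrr add0r => /eqP.
rewrite mulf_eq0 -cm_eq0 cm_i oner_eq0 orFb subr_eq0 => /eqP h.
exact/esym.
Qed.

(* The function [x + iy |-> q (b + exp (x + iy))] is integrated along a rectangle
   of height [2 pi]: the horizontal sides cancel by periodicity, and letting the
   left side go to [-oo] yields the mean value property. *)
Lemma mean_value (q : C -> C) (b : C) (r r' M : R) (E : seq R) :
  0 < r -> r < r' ->
  (forall w, cm (w - b) < r' -> ccont_at q w) ->
  (forall w, 0 < cm (w - b) < r' -> ln (cm (w - b)) \notin E -> exists d, cder q w d) ->
  (forall y : R, 0 <= y <= 2 * pi -> cm (q (b + cexp (ln r) y)) <= M) ->
  cm (q b) <= 2 * M.
Proof.
move=> r0 rr qc qd qM.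
pose X := ln r; have eX : expR X = r by rewrite lnK ?posrE.
pose r2 := (r + r') / 2; pose X' := ln r2.
have r20 : 0 < r2 by rewrite /r2; lra.
have eX' : expR X' = r2 by rewrite lnK ?posrE.
have XX' : X < X' by rewrite ltr_ln ?posrE// /r2; lra.
(* [goursat] asks for continuity along all lines, but [q] is controlled only on the disc of radius
   [r']. Freezing the first coordinate at [X'] extends [k] to the whole plane. *)
pose k (x y : R) := q (b + cexp (Num.min x X') y).
have cmb (x y : R) : cm (b + cexp (Num.min x X') y - b) < r'.
  rewrite addrAC subrr add0r cm_cexp.
  apply: (@le_lt_trans _ _ r2); last by rewrite /r2; lra.
  by rewrite -eX' ler_expR ge_min lexx orbT.
have minL (x x' : R) : `|Num.min x' X' - Num.min x X'| <= `|x' - x|.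
  have := ler_norm (x' - x); have := ler_norm (x - x'); rewrite distrC.
  rewrite ler_norml !/Num.min; case: ifP => h1; case: ifP => h2 h3 h4; apply/andP; split; lra.
have kc (x y e : R) : 0 < e -> exists2 r : R, 0 < r & forall x' y' : R,
     `|x' - x| <= r -> `|y' - y| <= r -> cm (k x' y' - k x y) <= e.
  move=> e0; have [s s0 Hs] := qc _ (cmb x y) e e0.
  have [u u0 Hu] := cexp_cont_at (Num.min x X') y s0.
  exists u => // x' y' hx hy; apply: Hs.
  rewrite opprD addrACA subrr add0r.
  by apply: Hu => //; exact: le_trans (minL _ _) hx.
have k1 y : ccont (fun x => k x y).
  apply: ccontP => x e e0; have [u u0 Hu] := kc x y e e0.
  by exists u => // x' hx; apply: Hu => //; rewrite subrr normr0 ltW.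
have k2 x : ccont (k x).
  apply: ccontP => y e e0; have [u u0 Hu] := kc x y e e0.
  by exists u => // x' hx; apply: Hu => //; rewrite subrr normr0 ltW.
pose p2 : R := 2 * pi.
have p20 : 0 < p2 by rewrite mulr_gt0// pi_gt0.
pose J x := cprim (-1) (k x) p2 - cprim (-1) (k x) 0.
have lo0 : (-1 : R) < 0 by lra.
have JB x x' e : (forall y : R, 0 <= y <= p2 -> cm (k x' y - k x y) <= e) ->
    cm (J x' - J x) <= 2 * e * p2.
  move=> h; rewrite -[X in _ <= _ * X]subr0; apply: cprim_bound => //; exact: ltW.
have JA x a e : (forall y : R, 0 <= y <= p2 -> cm (k x y - a) <= e) ->
    cm (J x - a * p2%:C) <= 2 * e * p2.
  move=> h; have := @cprim_affine R (-1) 0 p2 a 0 lo0 (ltW p20).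
  rewrite mul0r addr0 subr0 => <-; rewrite -[X in _ <= _ * X]subr0.
  apply: cprim_bound => //; [exact: ccont_affine|exact: ltW|].
  by move=> y hy; rewrite mulr0 addr0; exact: h.
have Jeq a c : a <= c -> c <= X -> (forall x, a <= x <= c -> x \notin E) -> J a = J c.
  move=> ac cX aE.
  have loa : a - 1 < a by lra.
  have := @goursat R (a - 1) (-1) k k1 k2 a 0 (c - a) p2 loa lo0.
  rewrite subr_ge0 => /(_ ac (ltW p20)).
  rewrite add0r [a + _]addrC subrK => H.
  have kp : (fun x => k x p2) = (fun x => k x 0).
    by apply/funext => x; rewrite /k /cexp /p2 cos0 sin0 [2 * pi]mulrC mulr_natr cos2pi sin2pi.
  have : rect_int (a - 1) (-1) k a c 0 p2 = 0.
    apply: H => x y /andP[ax xc] _.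
    have xX : x < X' by lra.
    have mx : Num.min x X' = x by rewrite min_l// ltW.
    have cw : cm (b + cexp x y - b) = expR x by rewrite addrAC subrr add0r cm_cexp.
    have [||d Hd] := qd (b + cexp x y).
    - by have := cmb x y; rewrite mx => ->; rewrite cw expR_gt0.
    - by rewrite cw expRK aE// ax xc.
    exists (d * cexp x y) => e e0.
    have d0 := cm_ge0 d; have ex0 := expR_gt0 x.
    have e1 : 0 < e / (4 * expR x + 1) by rewrite divr_gt0//; lra.
    have [s s0 Hs] := Hd _ e1.
    have e2 : 0 < Num.min 1 (e / (2 * (cm d * expR x + 1))).
      by rewrite lt_min ltr01 divr_gt0// mulr_gt0// ltr_wpDl// mulr_ge0// ltW.
    have [u u0 Hu] := cexp_approx e2.
    have [v v0 Hv] := cexp_cont_at x y s0.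
    (* The bound [X' - x] keeps [x'] in the range where the truncation at [X'] is inactive. *)
    pose t := Num.min (X' - x) (Num.min u v).
    have t0 : 0 < t by rewrite !lt_min u0 v0 subr_gt0 xX.
    exists t => // x' y'; rewrite !le_min => /and3P[x1 x2 x3] /and3P[y1 y2 y3].
    have mx' : Num.min x' X' = x'.
      by rewrite min_l//; have := ler_norm (x' - x); lra.
    rewrite /k mx mx'.
    set w := b + cexp x y; set w' := b + cexp x' y'.
    have ww : w' - w = cexp x y * (cexp (x' - x) (y' - y) - 1).
      rewrite mulrBr mulr1 -cexpD [x + _]addrC [y + _]addrC !subrK /w /w'.
      by rewrite opprD addrACA subrr add0r.
    set z := (x' - x) +i* (y' - y).
    set D := `|x' - x| + `|y' - y|.
    have D0 : 0 <= D by rewrite addr_ge0.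
    have HA := Hu _ _ x2 y2; rewrite -/z -/D in HA.
    have HA1 : cm (cexp (x' - x) (y' - y) - 1 - z) <= D.
      apply: le_trans HA _; rewrite -[leRHS]mul1r ler_wpM2r//.
      by rewrite ge_min lexx.
    have HA2 : (cm d * expR x + 1) * cm (cexp (x' - x) (y' - y) - 1 - z) <= e / 2 * D.
      have q0 : 0 < cm d * expR x + 1 by rewrite ltr_wpDl// mulr_ge0// ltW.
      rewrite mulrC -ler_pdivlMr//; apply: le_trans HA _.
      rewrite mulrAC ler_wpM2r//.
      apply: (@le_trans _ _ (e / (2 * (cm d * expR x + 1)))).
        by rewrite ge_min lexx orbT.
      by rewrite invfM mulrA.
    have HB : cm (w' - w) <= expR x * (2 * D).
      rewrite ww cmM cm_cexp ler_wpM2l ?(ltW ex0)//.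
      rewrite -[_ - 1](subrK z); apply: le_trans (cmD _ _) _.
      have := cm_le z; rewrite /= -/D; lra.
    have HC := Hs w'.
    have HC1 : cm (w' - w) <= s.
      rewrite /w /w' opprD addrACA subrr add0r; exact: Hv.
    have := HC HC1; set Q := q w' - q w => HQ.
    have -> : Q - d * cexp x y * z = (Q - d * (w' - w)) +
        d * (cexp x y * (cexp (x' - x) (y' - y) - 1 - z)).
      by rewrite ww; ring.
    apply: le_trans (cmD _ _) _; rewrite !cmM cm_cexp.
    have HD : e / (4 * expR x + 1) * cm (w' - w) <= e / 2 * D.
      rewrite mulrAC ler_pdivrMr; last lra.
      apply: (@le_trans _ _ (e * (expR x * (2 * D)))).
        by rewrite ler_wpM2l// ltW.
      rewrite (_ : e / 2 * D * (4 * expR x + 1) = e * (expR x * (2 * D)) + e / 2 * D); last by field.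
      by rewrite lerDl mulr_ge0// ltW// divr_gt0.
    have G0 := cm_ge0 (cexp (x' - x) (y' - y) - 1 - z).
    have HE : cm d * (expR x * cm (cexp (x' - x) (y' - y) - 1 - z)) <= e / 2 * D.
      by apply: le_trans HA2; rewrite mulrA ler_wpM2r// lerDl.
    have -> : e * D = e / 2 * D + e / 2 * D by rewrite -mulrDl -splitr.
    exact: lerD (le_trans HQ HD) HE.
  exact: rect_int_periodic.
have Jc (x e : R) : x <= X -> 0 < e -> exists2 r : R, 0 < r &
     forall x', x' <= X -> `|x' - x| <= r -> cm (J x' - J x) <= e.
  move=> _ e0; have e1 : 0 < e / (2 * p2) by rewrite divr_gt0// mulr_gt0.
  have [s s0 Hs] := @uniform_on_segment k x 0 p2 (fun y => kc x y) _ e1.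
  exists s => // x' _ xs; have := JB x x' _ (fun y hy => Hs x' y xs hy).
  by rewrite (_ : 2 * _ * p2 = e)//; field; rewrite gt_eqF.
have JX := locally_constant Jc Jeq.
have Jlim : J X = q b * p2%:C.
  apply/eqP; rewrite -subr_eq0 -cm_eq0; apply: contraT => n0.
  have p0 : 0 < cm (J X - q b * p2%:C) by rewrite lt_def n0 cm_ge0.
  set g := cm _ in n0 p0.
  have e1 : 0 < g / (4 * p2) by rewrite divr_gt0// mulr_gt0.
  have b0 : cm (b - b) < r' by rewrite subrr cm0; lra.
  have [s s0 Hs] := qc b b0 _ e1.
  pose x := Num.min X (ln s).
  have xs : expR x <= s.
    by rewrite -[leRHS]lnK ?posrE// ler_expR ge_min lexx orbT.
  have xX : x <= X by rewrite ge_min lexx.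
  have := JA x (q b) (g / (4 * p2)).
  rewrite (JX _ _ xX (lexx _)) -/g (_ : 2 * _ * p2 = g / 2); last by field; rewrite gt_eqF.
  move=> h; suff : g <= g / 2 by lra.
  apply: h => y _; apply: Hs; rewrite addrAC subrr add0r cm_cexp.
  by rewrite min_l//; lra.
have := JA X 0 M; rewrite mul0r subr0 Jlim cmM cm_real gtr0_norm//.
rewrite ler_pM2r//; apply=> y hy; rewrite subr0 /k min_l ?(ltW XX')//.
exact: qM.
Qed.

End MeanValue.

(** * Moduli versus filters *)

Section Bridge.
Variable R : realType.
Local Notation C := R[i].
Local Notation Co := (R[i])^o.
Implicit Types (f g : Co -> Co) (z w d : Co).

Lemma posC (e : Co) : 0 < e -> exists2 r : R, 0 < r & e = r%:C.
Proof.
move=> e0; exists (complex.Re e).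
  by move: e0; rewrite ltcE => /andP[].
by move: e0; rewrite ltcE => /andP[/eqP e1 _]; case: e e1 => a b /= ->.
Qed.

Lemma posRC (r : R) : 0 < r -> 0 < r%:C :> Co.
Proof. by rewrite -(ltcR 0). Qed.

Lemma nbhsC z (P : set Co) :
  nbhs z P <-> exists2 r : R, 0 < r & forall w, cm (w - z) <= r -> P w.
Proof.
split=> [/nbhs_normP[e /posC[r r0 ->] H]|[r r0 H]].
  exists (r / 2); first by rewrite divr_gt0.
  move=> w wz; apply: H; rewrite /ball_/= cmE ltcR cm_distC; lra.
apply/(@nbhs_normP _ Co); exists r%:C; first exact: posRC.
by move=> w; rewrite /ball_/= cmE ltcR cm_distC => /ltW/H.
Qed.

Lemma dnbhsC z (P : set Co) : (\forall w \near z^', P w) <->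
  exists2 r : R, 0 < r & forall w, w != z -> cm (w - z) <= r -> P w.
Proof.
rewrite near_withinE near_simpl; split.
  by move=> /nbhsC[r r0 H]; exists r => // w wz /H; apply.
by move=> [r r0 H]; apply/nbhsC; exists r => // w wr wz; exact: H.
Qed.

Lemma cvgC (T : Type) (F : set_system T) {FF : Filter F} (g : T -> Co) (l : Co) :
  g x @[x --> F] --> l <->
  forall e : R, 0 < e -> \forall x \near F, cm (g x - l) <= e.
Proof.
split=> [/cvgrPdist_le H e e0|H].
  have := H _ (posRC e0); apply: filterS => x.
  by rewrite cmE lecR cm_distC.
apply/cvgrPdist_le => _ /posC[e e0 ->]; have := H e e0; apply: filterS => x.
by rewrite cmE lecR cm_distC.
Qed.

Lemma ccont_atP g z : ccont_at g z <-> {for z, continuous g}.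
Proof.
split=> [H|/cvgC H e e0].
  by apply/(@cvgC _ (nbhs z) _ g (g z)) => e e0; apply/nbhsC; exact: H.
by have /nbhsC := H e e0.
Qed.

Lemma derivable_cder g z : derivable g z 1 -> exists d, cder g z d.
Proof.
move=> dg; exists ('D_1 g z) => e e0.
have dgz := derivableP dg.
have [r0 /posC[r rp ->] H] := is_derive_approx dgz (posRC e0).
exists (r / 2); first by rewrite divr_gt0.
move=> w wz; have := H (w - z); rewrite cmE ltcR.
have wr : cm (w - z) < r by lra.
by move=> /(_ wr); rewrite [z + _]addrC subrK -rmorphM cmE lecR.
Qed.

Lemma cder_derive g z d : cder g z d -> is_derive z 1 g d.
Proof.
move=> H.
have K : h^-1 *: ((g \o shift z) (h *: (1 : Co)) - g z) @[h --> (0 : Co)^'] --> d.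
  apply/(@cvgC _ (nbhs (0 : Co)^') _ _ d) => e e0; apply/dnbhsC; have [r r0 Hr] := H e e0.
  exists r => // h h0; rewrite subr0 => hr.
  have := Hr (h + z); rewrite addrK => /(_ hr) K.
  have -> : h^-1 *: ((g \o shift z) (h *: (1 : Co)) - g z) - d =
     h^-1 * (g (h + z) - g z - d * h).
    rewrite /= [h%:A]mulr1 [RHS]mulrBr; congr (_ - _).
    by rewrite mulrCA mulVf// mulr1.
  by rewrite cmM cmV ler_pdivrMl ?cm_gt0// [leRHS]mulrC.
apply: DeriveDef; first by apply: cvgP; exact: K.
exact: (cvg_lim _ K).
Qed.

Definition holo g z : Prop := exists d, cder g z d.

Lemma holoP g z : holo g z <-> derivable g z 1.
Proof.
split=> [[d /cder_derive H]|/derivable_cder//]; exact: ex_derive.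
Qed.

Lemma holo_ccont g z : holo g z -> ccont_at g z.
Proof. by move=> [d /cder_cont]. Qed.

Lemma near_ccont g g' z :
  (exists2 r : R, 0 < r & forall w, cm (w - z) <= r -> g w = g' w) ->
  ccont_at g z -> ccont_at g' z.
Proof.
move=> [r r0 gg] H e e0; have [s s0 Hs] := H e e0.
exists (Num.min r s); first by rewrite lt_min r0.
move=> w; rewrite le_min => /andP[wr ws].
rewrite -gg// -gg; first exact: Hs.
by rewrite subrr cm0 ltW.
Qed.

Lemma near_holo g g' z :
  (exists2 r : R, 0 < r & forall w, cm (w - z) <= r -> g w = g' w) ->
  holo g z -> holo g' z.
Proof.
move=> [r r0 gg] [d H]; exists d => e e0; have [s s0 Hs] := H e e0.
exists (Num.min r s); first by rewrite lt_min r0.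
move=> w; rewrite le_min => /andP[wr ws].
rewrite -gg// -gg; first exact: Hs.
by rewrite subrr cm0 ltW.
Qed.

Lemma holo_subC (x z : Co) : holo (fun w : Co => w - x) z.
Proof. by exists 1 => e e0; exists e => // w _; rewrite mul1r (_ : _ - _ - _ = 0) ?cm0 ?mulr_ge0 ?cm_ge0 ?ltW//; ring. Qed.

Lemma holo_cst (a z : Co) : holo (fun=> a) z.
Proof. by exists 0 => e e0; exists e => // w _; rewrite mul0r subrr subr0 cm0 mulr_ge0 ?cm_ge0 ?ltW. Qed.

Lemma holoM f g z : holo f z -> holo g z -> holo (fun w => f w * g w) z.
Proof.
move=> /holoP df /holoP dg; apply/holoP; have H := derivableM df dg.
by rewrite (_ : (fun w : Co => _) = (f * g)%R).
Qed.

Lemma holoD f g z : holo f z -> holo g z -> holo (fun w => f w + g w) z.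
Proof.
move=> /holoP df /holoP dg; apply/holoP; have H := derivableD df dg.
by rewrite (_ : (fun w : Co => _) = (f + g)%R).
Qed.

Lemma holoB f g z : holo f z -> holo g z -> holo (fun w => f w - g w) z.
Proof.
move=> /holoP df /holoP dg; apply/holoP; have H := derivableB df dg.
by rewrite (_ : (fun w : Co => _) = (f - g)%R).
Qed.

Lemma holoV f z : f z != 0 -> holo f z -> holo (fun w => (f w)^-1) z.
Proof. by move=> fz /holoP df; apply/holoP; exact: derivableV fz df. Qed.

Lemma holo_shift f (a z : Co) : holo f (z + a) -> holo (fun w => f (w + a)) z.
Proof.
move=> [d H]; exists d => e e0.
have [r r0 Hr] := H e e0; exists r => // w wr.
have := Hr (w + a); rewrite (_ : w + a - (z + a) = w - z); last first.
  by rewrite opprD addrACA subrr addr0.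
exact.
Qed.

End Bridge.

(** * The identity theorem *)

Section Identity.
Variable R : realType.
Local Notation C := R[i].
Local Notation Co := (R[i])^o.
Implicit Types (f g h q : Co -> Co) (c z w x : Co).

Lemma ccont_div q x w : w != x -> ccont_at q w ->
  ccont_at (fun w : Co => q w / (w - x) : Co) w.
Proof.
move=> wx /ccont_atP qw; apply/ccont_atP.
have w0 : w - x != 0 by rewrite subr_eq0.
have H : (fun w : Co => w - x) @ w --> w - x.
  apply/(ccont_atP (fun w : Co => w - x) w) => e e0; exists e => // w'.
  by rewrite opprB addrA subrK.
exact: cvgM qw (cvgV w0 H).
Qed.

Lemma holo_div q x w : w != x -> holo q w -> holo (fun w => q w / (w - x)) w.
Proof.
move=> wx qw; apply: holoM => //; apply: holoV; first by rewrite subr_eq0.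
exact: holo_subC.
Qed.

Lemma neq_near x w : w != x -> exists2 r : R, 0 < r &
  forall w', cm (w' - w) <= r -> w' != x.
Proof.
rewrite -subr_eq0 -cm_gt0 => h; exists (cm (w - x) / 2); first by rewrite divr_gt0.
move=> w' hw; apply/eqP => e; move: hw; rewrite e cm_distC; lra.
Qed.

Lemma divide_zeros h c (r : R) (s : seq Co) : uniq s ->
  (forall w, cm (w - c) < r -> holo h w) ->
  (forall x, x \in s -> cm (x - c) < r /\ h x = 0) ->
  exists q : Co -> Co,
   [/\ forall w, cm (w - c) < r -> ccont_at q w,
       forall w, cm (w - c) < r -> w \notin s -> holo q w &
       forall w, cm (w - c) < r -> h w = q w * \prod_(x <- s) (w - x)].
Proof.
elim: s => [|x s IH] /= us dh hs.
  exists h; split=> [w wr|w wr _|w _]; [|exact: dh|by rewrite big_nil mulr1].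
  exact/holo_ccont/dh.
have /andP[xs us'] := us.
have [|q [q1 q2 q3]] := IH us' dh.
  by move=> y ys; apply: hs; rewrite inE ys orbT.
have [xr hx] := hs x (mem_head _ _).
(* The factors already removed do not vanish at [x], as [s] has no repetition. *)
have qx : q x = 0.
  have := q3 x xr; rewrite hx => /esym/eqP; rewrite mulf_eq0 => /orP[/eqP//|].
  rewrite prodf_seq_eq0 => /hasP[y ys]; rewrite /= subr_eq0 => /eqP xy.
  by rewrite xy ys in xs.
have [d Hd] := q2 x xr xs.
pose q' w := if w == x then d else q w / (w - x).
have q'E w : w != x -> exists2 r : R, 0 < r &
    forall w', cm (w' - w) <= r -> q w' / (w' - x) = q' w'.
  move=> /neq_near[t t0 Ht]; exists t => // w' /Ht wx.
  by rewrite /q' (negbTE wx).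
exists q'; split=> w wr.
- have [->|wx] := eqVneq w x.
    move=> e e0; have [t t0 Ht] := Hd e e0; exists t => // w' w'r.
    rewrite /q' eqxx; case: eqVneq => [_|wx]; first by rewrite subrr cm0 ltW.
    have := Ht w' w'r; rewrite qx subr0.
    have p0 : 0 < cm (w' - x) by rewrite cm_gt0 subr_eq0.
    rewrite -ler_pdivrMr// -cmV -cmM mulrBl mulfK// subr_eq0//.
  apply: near_ccont (q'E w wx) _; exact/ccont_div/q1.
- rewrite inE negb_or => /andP[wx ws].
  apply: near_holo (q'E w wx) _; exact/holo_div/q2.
rewrite big_cons q3// /q'; case: eqVneq => [->|wx].
  by rewrite qx subrr !mul0r mulr0.
by rewrite mulrA divfK// subr_eq0.
Qed.

Lemma cm_prod (s : seq Co) (F : Co -> Co) :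
  cm (\prod_(x <- s) F x) = \prod_(x <- s) cm (F x).
Proof. by elim/big_ind2 : _ => [|x1 x2 y1 y2 <- <-|//]; rewrite ?cm1 ?cmM. Qed.

Lemma circle_bound h z (r : R) :
  (forall y : R, holo h (z + cexp (ln r) y)) ->
  exists2 M : R, 0 <= M & forall y : R, 0 <= y <= 2 * pi ->
    cm (h (z + cexp (ln r) y)) <= M.
Proof.
move=> dh; pose u (y : R) := cm (h (z + cexp (ln r) y)).
have cu : continuous u.
  move=> y; apply/cvgrPdist_le => e e0.
  have [s s0 Hs] := holo_ccont (dh y) e0.
  have [t t0 Ht] := cexp_cont_at (ln r) y s0.
  apply/nbhs_normP; exists t => // y'; rewrite /ball_/= distrC => /ltW hy.
  have H : cm (h (z + cexp (ln r) y') - h (z + cexp (ln r) y)) <= e.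
    apply: Hs; rewrite opprD addrACA subrr add0r; apply: Ht => //.
    by rewrite subrr normr0 ltW.
  rewrite /u ler_norml; apply/andP; split.
    have := cmD (h (z + cexp (ln r) y') - h (z + cexp (ln r) y)) (h (z + cexp (ln r) y)).
    rewrite subrK; lra.
  have := cmD (h (z + cexp (ln r) y) - h (z + cexp (ln r) y')) (h (z + cexp (ln r) y')).
  rewrite subrK cm_distC; lra.
have p0 : 0 <= 2 * pi :> R by rewrite mulr_ge0// pi_ge0.
have [y0 _ H] := EVT_max p0 (continuous_subspaceT cu).
exists (u y0); first exact: cm_ge0.
by move=> y hy; apply: H; rewrite in_itv.
Qed.

Lemma prodr_le_const (s : seq Co) (F : Co -> R) (a : R) :
  (forall x, x \in s -> 0 <= F x <= a) -> 0 <= a ->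
  0 <= \prod_(x <- s) F x <= a ^+ size s.
Proof.
move=> H a0; elim: s H => [|x s IH] H; first by rewrite big_nil expr0 ler01 lexx.
rewrite big_cons exprS /=.
have /andP[h1 h2] := H x (mem_head _ _).
have /andP[g1 g2] := IH (fun y ys => H y (mem_behead (s := x :: s) ys)).
by rewrite mulr_ge0//= ler_pM.
Qed.

Lemma prodr_ge_const (s : seq Co) (F : Co -> R) (a : R) :
  (forall x, x \in s -> a <= F x) -> 0 <= a ->
  a ^+ size s <= \prod_(x <- s) F x.
Proof.
move=> H a0; elim: s H => [|x s IH] H; first by rewrite big_nil expr0.
rewrite big_cons exprS /=; apply: ler_pM => //; first exact: exprn_ge0.
  exact: H (mem_head _ _).
by apply: IH => y ys; apply: H; rewrite inE ys orbT.
Qed.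

(* Schwarz's lemma with many zeros: dividing [h] by the product over [N] zeros
   near the centre multiplies the bound at the centre by [3^-N]. *)
Lemma disc_zero h c (r : R) (u : nat -> Co) : 0 < r ->
  (forall w, cm (w - c) < r -> holo h w) -> injective u ->
  (forall n, cm (u n - c) < r / 16 /\ h (u n) = 0) ->
  forall z, cm (z - c) < r / 16 -> h z = 0.
Proof.
move=> r0 dh iu hu z zc.
have r2 : 0 < r / 2 by rewrite divr_gt0.
have el : expR (ln (r / 2)) = r / 2 by rewrite lnK// posrE.
have cir y : cm (z + cexp (ln (r / 2)) y - c) < r.
  rewrite addrAC; apply: le_lt_trans (cmD _ _) _; rewrite cm_cexp el; lra.
have [M M0 HM] := circle_bound (fun y => dh _ (cir y)).
have key N : cm (h z) <= 2 * M * (3^-1) ^+ N.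
  pose s := mkseq u N.
  have us : uniq s by rewrite mkseq_uniq.
  have hs x : x \in s -> cm (x - c) < r / 16 /\ h x = 0.
    by move=> /mapP[n _ ->]; exact: hu.
  have [q [q1 q2 q3]] : exists q : Co -> Co,
   [/\ forall w, cm (w - c) < r -> ccont_at q w,
       forall w, cm (w - c) < r -> w \notin s -> holo q w &
       forall w, cm (w - c) < r -> h w = q w * \prod_(x <- s) (w - x)].
    apply: divide_zeros => // x /hs[h1 h2]; split => //; lra.
  have zr : cm (z - c) < r by lra.
  rewrite q3// cmM.
  have in_r w : cm (w - z) < (3 / 4) * r -> cm (w - c) < r.
    move=> wz; rewrite -[w](subrK z) -addrA.
    apply: le_lt_trans (cmD _ _) _; lra.
  have sz x : x \in s -> cm (x - z) <= r / 8.
    move=> /hs[h1 _]; rewrite -[x](subrK c) -addrA.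
    apply: le_trans (cmD _ _) _; rewrite (cm_distC c z); lra.
  (* The circle of radius [r / 2] about [z] keeps a distance of at least [r / 2 - r / 8] from the
     zeros, whereas [z] is within [r / 8] of each of them. The ratio of the two is the 3 of the
     final estimate. *)
  have r38 : 0 < (3 / 8) * r by rewrite mulr_gt0//; lra.
  have qM : cm (q z) <= 2 * (M / ((3 / 8) * r) ^+ N).
    apply: (@mean_value R q z (r / 2) ((3 / 4) * r) _ [seq ln (cm (x - z)) | x <- s]) => //; first lra.
    - by move=> w wz; apply/q1/in_r.
    - move=> w /andP[w0 wz] wE; apply: q2; first exact: in_r.
      by apply: contraNN wE => ws; apply/mapP; exists w.
    - move=> y hy; set w := z + _.
      have wr : cm (w - c) < r := cir y.
      have := HM y hy; rewrite -/w q3// cmM cm_prod.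
      have P : ((3 / 8) * r) ^+ N <= \prod_(x <- s) cm (w - x).
        rewrite -[N in leLHS](size_mkseq u N); apply: prodr_ge_const; last exact: ltW.
        move=> x xs; have := sz x xs.
        have : cm (w - z) = r / 2 by rewrite /w addrAC subrr add0r cm_cexp.
        have := cmD (w - x) (x - z); rewrite subrKA; lra.
      rewrite ler_pdivlMr ?exprn_gt0// => H; apply: le_trans H.
      by rewrite ler_wpM2l// cm_ge0.
  have := @prodr_le_const s (fun x => cm (z - x)) (r / 8).
  rewrite -cm_prod => /(_ _ _)/andP[||p0 p1].
  - by move=> x /sz; rewrite cm_ge0/= cm_distC.
  - by rewrite divr_ge0// ltW.
  rewrite size_mkseq in p1.
  apply: le_trans (ler_pM (cm_ge0 _) p0 qM p1) _.
  rewrite -!mulrA !ler_wpM2l//.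
  rewrite -exprVn -exprMn.
  have -> : (3 * (8^-1 * r))^-1 * (r / 8) = 3^-1 by field; rewrite gt_eqF.
  exact: lexx.
apply/eqP; rewrite -cm_eq0; apply: contraT => n0.
have p0 : 0 < cm (h z) by rewrite lt_def n0 cm_ge0.
have := archi_boundP (divr_ge0 (mulr_ge0 (ler0n R 2) M0) (ltW p0)).
set N := Num.Def.archi_bound _ => HN.
have := key N.
have h3 : N%:R <= 3 ^+ N :> R by rewrite -natrX ler_nat ltnW// ltn_expl.
have p3 : 0 < 3 ^+ N :> R by rewrite exprn_gt0.
rewrite exprVn ler_pdivlMr// => H.
move: HN; rewrite ltr_pdivrMr// => HN.
have : cm (h z) * N%:R <= cm (h z) * 3 ^+ N by rewrite ler_wpM2l// ltW.
by move=> ?; lra.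
Qed.

End Identity.

(** * Propagation of zeros along segments and around punctures *)

Section Continuation.
Variable R : realType.
Local Notation C := R[i].
Local Notation Co := (R[i])^o.
Implicit Types (h : Co -> Co) (c z w x p : Co).

Definition zero_near h c := exists2 r : R, 0 < r & forall w, cm (w - c) <= r -> h w = 0.

(** A supremum argument: near every [t], [P] passes between any two points, so the initial interval
    on which it holds cannot stop before 1. *)
Lemma unit_interval_induction (P : R -> Prop) : P 0 ->
  (forall t, 0 <= t <= 1 -> exists2 r : R, 0 < r &
     forall u v, 0 <= u <= 1 -> 0 <= v <= 1 -> `|u - t| < r -> `|v - t| < r ->
        P u -> P v) -> P 1.
Proof.
move=> P0 H; pose A := [set t : R | 0 <= t <= 1 /\ forall u, 0 <= u <= t -> P u].
have A0 : A 0.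
  split; first by rewrite lexx ler01.
  by move=> u /andP[u0 u1]; have -> : u = 0 by lra.
have Aub : ubound A 1 by move=> t [/andP[_]].
have Ahs : has_sup A by split; [exists 0|exists 1].
have s0 : 0 <= sup A by apply: ub_le_sup => //; exists 1.
have s1 : sup A <= 1 by apply: ge_sup => //; exists 0.
have [r r0 Hr] := H (sup A) (introT andP (conj s0 s1)).
have [t [/andP[t0 t1] At] ts] := sup_adherent r0 Ahs.
have tsup : t <= sup A by apply: ub_le_sup; [exists 1|split => //; rewrite t0].
have Pt : P t by apply: At; rewrite t0 lexx.
have Pr v : 0 <= v <= 1 -> `|v - sup A| < r -> P v.
  move=> hv vr; apply: (Hr t v) => //; first by rewrite t0.
  by rewrite ltr_norml; apply/andP; split; lra.
have [hs|hs] := ltP (sup A) 1; last first.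
  by apply: Pr; rewrite ?ler01 ?lexx//; rewrite ltr_norml; apply/andP; split; lra.
pose v := Num.min 1 (sup A + r / 2).
have v1 : v <= 1 by rewrite ge_min lexx.
have v2 : v <= sup A + r / 2 by rewrite ge_min lexx orbT.
have v3 : sup A < v by rewrite lt_min hs/=; lra.
have : A v.
  split; first by apply/andP; split => //; lra.
  move=> u /andP[u0 uv]; have [ut|ut] := leP u t; first by apply: At; rewrite u0.
  apply: Pr; first by apply/andP; split => //; lra.
  by rewrite ltr_norml; apply/andP; split; lra.
move=> /(ub_le_sup _) => /(_ (ex_intro _ 1 Aub)); lra.
Qed.

(** Provides the sequence of distinct zeros that [disc_zero] takes as input. *)
Lemma zero_near_infinite h p c (r : R) : zero_near h c -> cm (c - p) < r ->
  exists u : nat -> Co, injective u /\ forall n, cm (u n - p) < r /\ h (u n) = 0.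
Proof.
move=> [s s0 Hs] cr.
pose e := Num.min s (r - cm (c - p)) / 2.
have m0 : 0 < Num.min s (r - cm (c - p)) by rewrite lt_min s0 subr_gt0.
have e0 : 0 < e by rewrite divr_gt0.
have es : e <= s by have : Num.min s (r - cm (c - p)) <= s by [rewrite ge_min lexx]; rewrite /e; lra.
have er : e < r - cm (c - p).
  have : Num.min s (r - cm (c - p)) <= r - cm (c - p) by rewrite ge_min lexx orbT.
  by rewrite /e; lra.
clearbody e.
exists (fun n => c + (e / n.+1%:R)%:C); split=> [m n|n].
  move=> /addrI/(@complexI R)/(mulfI (lt0r_neq0 e0))/invr_inj/eqP.
  by rewrite eqr_nat => /eqP [].
have cn : cm (e / n.+1%:R)%:C <= e.
  rewrite cm_real ger0_norm ?divr_ge0 ?(ltW e0)// ler_pdivrMr//.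
  by rewrite ler_peMr ?(ltW e0)// ler1n.
split; last by apply: Hs; rewrite addrAC subrr add0r (le_trans cn).
rewrite addrAC; apply: le_lt_trans (cmD _ _) _; lra.
Qed.

Definition open_set (O : set Co) := forall w, O w ->
  exists2 r : R, 0 < r & forall w', cm (w' - w) < r -> O w'.

Lemma convex_zero (O : set Co) h c z : open_set O ->
  (forall t : R, 0 <= t <= 1 -> O (c + t%:C * (z - c))) ->
  (forall w, O w -> holo h w) -> zero_near h c -> zero_near h z.
Proof.
move=> oO seg dh hc.
pose g (t : R) : Co := c + t%:C * (z - c).
have gB u v : cm (g u - g v) = `|u - v| * cm (z - c).
  by rewrite /g opprD addrACA subrr add0r -mulrBl cmM -rmorphB cm_real.
have := @unit_interval_induction (fun t => zero_near h (g t)).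
have g0 : g 0 = c by rewrite /g mul0r addr0.
have g1 : g 1 = z by rewrite /g mul1r addrC subrK.
rewrite g0 g1; apply => // t ht.
have [r r0 Hr] := oO _ (seg t ht); rewrite -/(g t) in Hr.
have k0 : 0 < cm (z - c) + 1 by rewrite ltr_wpDl// cm_ge0.
exists (r / 16 / (cm (z - c) + 1)); first by rewrite !divr_gt0.
have gr v : `|v - t| < r / 16 / (cm (z - c) + 1) -> cm (g v - g t) < r / 16.
  rewrite ltr_pdivlMr// gB; apply: le_lt_trans.
  by rewrite ler_wpM2l// lerDl.
move=> u v hu hv /gr ur /gr vr Zu.
have [q [iq Hq]] := zero_near_infinite Zu ur.
have H := disc_zero r0 (fun w hw => dh w (Hr w hw)) iq Hq.
exists ((r / 16 - cm (g v - g t)) / 2); first by rewrite divr_gt0// subr_gt0.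
move=> w; rewrite -/(g v) => wv; apply: H; rewrite -/(g t).
have := cmD (w - g v) (g v - g t); rewrite subrKA; lra.
Qed.

(** The half of the disc facing the conjugate of [u]. It is open and convex, avoids [p], and makes a
    quarter turn when [u] is multiplied by ['i]. *)
Definition halfdisc p (u : Co) (r : R) : set Co :=
  [set w | cm (w - p) < r /\ 0 < complex.Re ((w - p) * u)].

Lemma halfdisc_open p u r : cm u = 1 -> open_set (halfdisc p u r).
Proof.
move=> u1 w [w1 w2].
exists (Num.min (r - cm (w - p)) (complex.Re ((w - p) * u))).
  by rewrite lt_min subr_gt0 w1.
move=> w'; rewrite lt_min => /andP[a b]; split.
  by have := cmD (w' - w) (w - p); rewrite subrKA; lra.
have -> : (w' - p) * u = (w' - w) * u + (w - p) * u by rewrite -mulrDl subrKA.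
rewrite ReD; have := cm_Re ((w' - w) * u); rewrite cmM u1 mulr1 ler_norml.
by move=> /andP[h _]; lra.
Qed.

Lemma halfdisc_convex p u r c z (t : R) : 0 <= t <= 1 ->
  halfdisc p u r c -> halfdisc p u r z -> halfdisc p u r (c + t%:C * (z - c)).
Proof.
move=> /andP[t0 t1] [c1 c2] [z1 z2].
have e : c + t%:C * (z - c) - p = (1 - t)%:C * (c - p) + t%:C * (z - p).
  by rewrite rmorphB/=; ring.
split; rewrite e.
  apply: le_lt_trans (cmD _ _) _; rewrite !cmM !cm_real !ger0_norm ?subr_ge0//.
  have [->|tn] := eqVneq t 0; first by rewrite subr0 mul1r mul0r addr0.
  have tp : 0 < t by rewrite lt_def tn.
  nra.
rewrite mulrDl ReD -!mulrA.
have Rm (a : R) (b : Co) : complex.Re (a%:C * b) = a * complex.Re b.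
  by case: b => ? ?; rewrite /= mul0r subr0.
rewrite !Rm.
have [->|tn] := eqVneq t 0; first by rewrite subr0 mul1r mul0r addr0.
have tp : 0 < t by rewrite lt_def tn.
nra.
Qed.

Lemma halfdisc_zero h p u r : cm u = 1 -> (forall w, halfdisc p u r w -> holo h w) ->
  (exists2 c, halfdisc p u r c & zero_near h c) ->
  forall z, halfdisc p u r z -> zero_near h z.
Proof.
move=> u1 dh [c hc Zc] z hz.
apply: (@convex_zero (halfdisc p u r) h c z) => //; first exact: halfdisc_open.
by move=> t ht; apply: halfdisc_convex.
Qed.

Lemma halfdisc_turn h p u r : 0 < r -> cm u = 1 ->
  (forall w, cm (w - p) < r -> w != p -> holo h w) ->
  (forall z, halfdisc p u r z -> zero_near h z) ->
  forall z, halfdisc p (u * 'i) r z -> zero_near h z.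
Proof.
move=> r0 u1 dh Hu.
have un : u != 0 by rewrite -cm_gt0 u1.
have d w v : halfdisc p v r w -> holo h w.
  move=> [w1 w2]; apply: dh => //; apply/eqP => e.
  by move: w2; rewrite e subrr mul0r ltxx.
apply: halfdisc_zero => [|w|]; first by rewrite cmM u1 cm_i mulr1.
  exact: d.
(* A point in both half-discs: [(c - p) * u] is a positive multiple of [1 - 'i], and
   [(c - p) * u * 'i] of [1 + 'i]. *)
pose c := p + (r / 4)%:C * (1 - 'i) / u.
have cp : c - p = (r / 4)%:C * (1 - 'i) / u by rewrite /c addrAC subrr add0r.
have cc : cm (c - p) < r.
  rewrite cp !cmM cmV u1 invr1 mulr1 cm_real gtr0_norm ?divr_gt0//.
  have := cmB (1 : C) 'i; rewrite cm1 cm_i => h2.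
  by have := cm_ge0 (1 - 'i : C); nra.
have cu : halfdisc p u r c.
  by split=> //; rewrite cp divfK//= mul0r subr0 subr0 mulr1 divr_gt0.
exists c; last exact: Hu.
split=> //; rewrite cp mulrA divfK//= !(mul0r, mulr0, subr0, sub0r, mulr1, addr0, add0r).
by rewrite mulrN1 opprK divr_gt0.
Qed.

(* A punctured disc is covered by four half-discs, consecutive ones overlapping. *)
Lemma punctured_zero h p r : 0 < r ->
  (forall w, cm (w - p) < r -> w != p -> holo h w) ->
  (exists c, [/\ cm (c - p) < r, c != p & zero_near h c]) ->
  forall z, cm (z - p) < r -> z != p -> zero_near h z.
Proof.
move=> r0 dh [c [cr cp Zc]].
have cases w : cm (w - p) < r -> w != p -> exists k, halfdisc p ('i ^+ k) r w.
  move=> wr wp.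
  have : w - p != 0 by rewrite subr_eq0.
  rewrite eq_complex negb_and /halfdisc => /orP[n0|n0].
    have [l|l] := ltP 0 (complex.Re (w - p)).
      by exists 0%N; split=> //; rewrite expr0 mulr1.
    exists 2%N; split=> //; rewrite sqr_i mulrN1 ReN oppr_gt0 lt_neqAle l andbT.
    exact: n0.
  have [l|l] := ltP 0 (complex.Im (w - p)).
    exists 3%N; split=> //; rewrite exprS sqr_i mulrN1 mulrN ReN ReiNIm.
    by rewrite opprK.
  exists 1%N; split=> //; rewrite expr1 ReiNIm oppr_gt0 lt_neqAle l andbT.
  exact: n0.
have i1 k : cm ('i ^+ k : C) = 1.
  by elim: k => [|k IH]; rewrite ?expr0 ?cm1// exprS cmM cm_i mul1r.
have d k w : halfdisc p ('i ^+ k) r w -> holo h w.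
  move=> [w1 w2]; apply: dh => //; apply/eqP => e.
  by move: w2; rewrite e subrr mul0r ltxx.
have [k ck] := cases c cr cp.
have Hk : forall z, halfdisc p ('i ^+ k) r z -> zero_near h z.
  by apply: halfdisc_zero => //; [exact: d|exists c].
have Hj j : forall z, halfdisc p ('i ^+ (k + j)) r z -> zero_near h z.
  elim: j => [|j IH]; first by rewrite addn0.
  by rewrite addnS exprSr; apply: halfdisc_turn.
have i4 : ('i : C) ^+ 4 = 1 by rewrite -[4%N]/(2 * 2)%N exprM sqr_i sqrrN expr1n.
move=> z zr zp; have [l zl] := cases z zr zp.
(* Starting from [k], these quarter turns end at exponent [4 * k + l], the same half-disc as [l]; no
   subtraction of naturals occurs. *)
apply: (Hj (3 * k + l)%N).
rewrite (_ : (k + (3 * k + l) = 4 * k + l)%N); last by rewrite addnA -mulSn.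
by rewrite exprD exprM i4 expr1n mul1r.
Qed.

Definition discrete_set (S : set Co) := forall z, exists2 r : R, 0 < r &
  forall w, cm (w - z) < r -> w != z -> ~ S w.

(* Analytic continuation: [h] vanishes on a punctured neighbourhood of every
   point of a segment as soon as it does at one end. *)
Lemma identity_theorem (S : set Co) h c : discrete_set S ->
  (forall z, ~ S z -> holo h z) -> ~ S c -> zero_near h c ->
  forall z, ~ S z -> h z = 0.
Proof.
move=> dS dh Sc Zc z Sz.
pose g (t : R) : Co := c + t%:C * (z - c).
have gB u v : cm (g u - g v) = `|u - v| * cm (z - c).
  by rewrite /g opprD addrACA subrr add0r -mulrBl cmM -rmorphB cm_real.
(* The neighbourhood is punctured because [g t] may belong to [S]. *)
pose P t := exists2 r : R, 0 < r & forall w, cm (w - g t) < r -> w != g t -> h w = 0.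
suff [r r0 Hr] : P 1.
  have gz : g 1 = z by rewrite /g mul1r addrC subrK.
  rewrite gz in Hr.
  apply/eqP; rewrite -cm_eq0; apply: contraT => n0.
  have p0 : 0 < cm (h z) by rewrite lt_def n0 cm_ge0.
  have e0 : 0 < cm (h z) / 2 by rewrite divr_gt0.
  have [s s0 Hs] := holo_ccont (dh z Sz) e0.
  pose e := Num.min (r / 2) s.
  have ep : 0 < e by rewrite lt_min s0 divr_gt0.
  have er : e <= r / 2 by rewrite ge_min lexx.
  have es : e <= s by rewrite ge_min lexx orbT.
  have ce : cm (z + e%:C - z) = e.
    by rewrite addrAC subrr add0r cm_real gtr0_norm.
  have := Hs (z + e%:C); rewrite ce Hr ?ce.
  - by move=> /(_ es); rewrite sub0r cmN; lra.
  - lra.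
  - by rewrite -subr_eq0 -cm_gt0 ce.
apply: unit_interval_induction.
  case: Zc => r r0 Hr; exists r => // w; rewrite /g mul0r addr0 => wr _.
  by apply: Hr; exact: ltW.
move=> t _; have [r r0 Hr] := dS (g t).
have k0 : 0 < cm (z - c) + 1 by rewrite ltr_wpDl// cm_ge0.
exists (r / (cm (z - c) + 1)); first by rewrite divr_gt0.
have gr v : `|v - t| < r / (cm (z - c) + 1) -> cm (g v - g t) < r.
  rewrite ltr_pdivlMr// gB; apply: le_lt_trans.
  by rewrite ler_wpM2l// lerDl.
move=> u v _ _ /gr ur /gr vr [s s0 Hs].
have H : forall x, cm (x - g t) < r -> x != g t -> zero_near h x.
  apply: punctured_zero => //.
    by move=> w wr wt; apply: dh; exact: Hr.
  (* A centre of vanishing other than [g t] is required; at least one of [g u + m / 2] and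
     [g u + m / 4] qualifies. *)
  pose m := Num.min s (r - cm (g u - g t)).
  have m0 : 0 < m by rewrite lt_min s0 subr_gt0.
  have ms : m <= s by rewrite ge_min lexx.
  have mr : m <= r - cm (g u - g t) by rewrite ge_min lexx orbT.
  have near_u (a : R) : 0 < a -> a < m -> g u + a%:C != g t ->
      exists c, [/\ cm (c - g t) < r, c != g t & zero_near h c].
    move=> a0 am nt; exists (g u + a%:C).
    have ca : cm (g u + a%:C - g u) = a by rewrite addrAC subrr add0r cm_real gtr0_norm.
    split=> //.
      by rewrite addrAC; apply: le_lt_trans (cmD _ _) _; rewrite cm_real gtr0_norm//; lra.
    exists (Num.min (a / 2) (m - a) / 2).
      by rewrite divr_gt0// lt_min subr_gt0 am divr_gt0.
    move=> w hw.
    have h1 : Num.min (a / 2) (m - a) <= a / 2 by rewrite ge_min lexx.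
    have h2 : Num.min (a / 2) (m - a) <= m - a by rewrite ge_min lexx orbT.
    apply: Hs.
      have := cmD (w - (g u + a%:C)) (g u + a%:C - g u); rewrite subrKA ca; lra.
    apply/eqP => e; move: hw; rewrite e cm_distC ca; lra.
  have [e|ne] := eqVneq (g u + (m / 2)%:C) (g t); last by apply: (near_u (m / 2)) => //; lra.
  apply: (near_u (m / 4)); [lra|lra|].
  rewrite -e; apply/eqP => /addrI/(@complexI R); lra.
have [vt|vt] := eqVneq (g v) (g t).
  exists r => // w; rewrite vt => wr wt; have [a a0 Ha] := H w wr wt.
  by apply: Ha; rewrite subrr cm0 ltW.
have [a a0 Ha] := H (g v) vr vt; exists a => // w wa _.
by apply: Ha; exact: ltW.
Qed.

Lemma identity_theorem_seq (S : set Co) h c (u : nat -> Co) : discrete_set S ->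
  (forall z, ~ S z -> holo h z) -> ~ S c -> injective u ->
  (forall n, h (u n) = 0) ->
  (forall r : R, 0 < r -> exists N, forall n, (N <= n)%N -> cm (u n - c) < r) ->
  forall z, ~ S z -> h z = 0.
Proof.
move=> dS dh Sc iu hu uc; apply: (@identity_theorem S h c) => //.
have [r r0 Hr] := dS c.
have [N HN] := uc (r / 16) (divr_gt0 r0 (ltr0n _ 16)).
have dc w : cm (w - c) < r -> holo h w.
  by move=> wr; have [->|wc] := eqVneq w c; apply: dh => //; exact: Hr.
have iuN : injective (fun n => u (N + n)%N) by move=> m n /iu/addnI.
have zu n : cm (u (N + n)%N - c) < r / 16 /\ h (u (N + n)%N) = 0.
  by split; [apply: HN; exact: leq_addr|exact: hu].
have H := disc_zero r0 dc iuN zu.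
exists (r / 32); first by rewrite divr_gt0.
by move=> w wr; apply: H; lra.
Qed.

End Continuation.

(** * Sums of simple poles *)

Section PoleSeries.
Variable R : realType.
Local Notation C := R[i].
Local Notation Co := (R[i])^o.
Implicit Types (z w : Co) (B : nat -> seq (R * R)) (b : R * R).

Definition clim (a : nat -> C) (x : C) : Prop :=
  forall e : R, 0 < e -> exists N, forall n, (N <= n)%N -> cm (a n - x) <= e.

Lemma climP (a : nat -> Co) (x : Co) : a @ \oo --> x <-> clim a x.
Proof.
split=> [/(@cvgC _ _ \oo) H e e0|H].
  by have [N _ HN] := H e e0; exists N => n /HN.
apply/(@cvgC _ _ \oo) => e e0; have [N HN] := H e e0.
by exists N => // n /HN.
Qed.

Lemma clim_ReIm (a : nat -> C) (x y : R) :
  (fun n => complex.Re (a n)) @ \oo --> x ->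
  (fun n => complex.Im (a n)) @ \oo --> y -> clim a (x +i* y).
Proof.
move=> /cvgrPdist_le hx /cvgrPdist_le hy e e0.
have e2 : 0 < e / 2 by rewrite divr_gt0.
have [N1 _ H1] := hx _ e2; have [N2 _ H2] := hy _ e2.
exists (maxn N1 N2) => n; rewrite geq_max => /andP[/H1/= h1 /H2/= h2].
apply: le_trans (cm_le _) _; rewrite ReD ImD ReN ImN /= [leRHS]splitr.
by apply: lerD; rewrite distrC.
Qed.

Lemma clim_unique (a : nat -> C) (x y : C) : clim a x -> clim a y -> x = y.
Proof.
move=> hx hy.
apply/eqP; rewrite -subr_eq0 -cm_eq0; apply: contraT => n0.
have p0 : 0 < cm (x - y) by rewrite lt_def n0 cm_ge0.
have e0 : 0 < cm (x - y) / 4 by rewrite divr_gt0.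
have [N1 H1] := hx _ e0; have [N2 H2] := hy _ e0.
have := H1 (maxn N1 N2) (leq_maxl _ _); have := H2 (maxn N1 N2) (leq_maxr _ _).
set v := a _ => /= h2 h1.
have := cmD (x - v) (v - y); rewrite subrKA (cm_distC x v); lra.
Qed.

Lemma eq_clim (a b : nat -> C) (x : C) : a =1 b -> clim a x -> clim b x.
Proof. by move=> /funext ->. Qed.

Lemma clim_cst (x : C) : clim (fun=> x) x.
Proof. by move=> e e0; exists 0%N => n _; rewrite subrr cm0 ltW. Qed.

Lemma climD (a b : nat -> C) (x y : C) : clim a x -> clim b y ->
  clim (fun n => a n + b n) (x + y).
Proof.
move=> ax bx e e0; have e2 : 0 < e / 2 by rewrite divr_gt0.
have [N1 H1] := ax _ e2; have [N2 H2] := bx _ e2.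
exists (maxn N1 N2) => n; rewrite geq_max => /andP[/H1/= h1 /H2/= h2].
rewrite opprD addrACA; apply: le_trans (cmD _ _) _; lra.
Qed.

Lemma climN (a : nat -> C) (x : C) : clim a x -> clim (fun n => - a n) (- x).
Proof.
by move=> ax e e0; have [N H] := ax e e0; exists N => n /H; rewrite -opprD cmN.
Qed.

Lemma climB (a b : nat -> C) (x y : C) : clim a x -> clim b y ->
  clim (fun n => a n - b n) (x - y).
Proof. by move=> ax /climN; apply: climD. Qed.

Lemma climMr (a : nat -> C) (x k : C) : clim a x -> clim (fun n => a n * k) (x * k).
Proof.
move=> ax e e0; have k0 : 0 < cm k + 1 by rewrite ltr_wpDl// cm_ge0.
have [N H] := ax _ (divr_gt0 e0 k0); exists N => n /H h.
rewrite -mulrBl cmM -[leRHS](divfK (lt0r_neq0 k0)).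
by apply: ler_pM; rewrite ?cm_ge0// lerDl.
Qed.

Lemma clim_real (u : nat -> R) (x : R) : u @ \oo --> x ->
  clim (fun n => (u n)%:C) x%:C.
Proof.
move=> /cvgrPdist_le H e e0; have [N _ HN] := H e e0; exists N => n /HN/= h.
by rewrite -rmorphB cm_real distrC.
Qed.

Lemma bounded_series_cvg (t : nat -> R) (M : R) : (forall p, 0 <= t p) ->
  (forall N : nat, \sum_(p < N) t p <= M) ->
  exists2 s : R, (fun N : nat => \sum_(p < N) t p) @ \oo --> s & s <= M.
Proof.
move=> t0 tM.
have c : cvgn (fun N : nat => \sum_(p < N) t p).
  apply: nondecreasing_is_cvgn; last by exists M => _ [n _ <-].
  apply/nondecreasing_seqP => n; by rewrite big_ord_recr/= lerDl.
exists (limn (fun N : nat => \sum_(p < N) t p)) => //.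
by apply: limr_le => //; near=> n; exact: tM.
Unshelve. all: by end_near. Qed.

Lemma abs_series_real (a t : nat -> R) (M : R) : (forall p, `|a p| <= t p) ->
  (forall N : nat, \sum_(p < N) t p <= M) ->
  exists s : R, (fun N : nat => \sum_(p < N) a p) @ \oo --> s.
Proof.
move=> at_ tM.
have t0 p : 0 <= t p := le_trans (normr_ge0 _) (at_ p).
have [s1 h1 _] := bounded_series_cvg t0 tM.
have [||s2 h2 _] := @bounded_series_cvg (fun p => a p + t p) (2 * M).
- by move=> p; have := at_ p; rewrite ler_norml => /andP[]; lra.
- move=> N; apply: (@le_trans _ _ (\sum_(p < N) 2 * t p)).
    by apply: ler_sum => p _; have := at_ p; rewrite ler_norml => /andP[]; lra.
  by rewrite -mulr_sumr ler_wpM2l.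
exists (s2 - s1).
rewrite (_ : (fun N : nat => _) = (fun N : nat =>
  \sum_(p < N) (a p + t p) - \sum_(p < N) t p)); first exact: cvgB.
by apply/funext => N; rewrite -sumrB; apply: eq_bigr => p _; rewrite addrK.
Qed.

Lemma abs_series (a : nat -> C) (t : nat -> R) (K M : R) : 0 <= K ->
  (forall p, cm (a p) <= K * t p) -> (forall N : nat, \sum_(p < N) t p <= M) ->
  exists2 s : C, clim (fun N : nat => \sum_(p < N) a p) s & cm s <= K * M.
Proof.
move=> K0 at_ tM.
have tM' (N : nat) : \sum_(p < N) K * t p <= K * M.
  by rewrite -mulr_sumr ler_wpM2l.
have ReS (N : nat) : complex.Re (\sum_(p < N) a p) = \sum_(p < N) complex.Re (a p).
  by elim/big_rec2 : _ => //= p x y _ <-; rewrite ReD.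
have ImS (N : nat) : complex.Im (\sum_(p < N) a p) = \sum_(p < N) complex.Im (a p).
  by elim/big_rec2 : _ => //= p x y _ <-; rewrite ImD.
have [x hx] := abs_series_real (fun p => le_trans (cm_Re (a p)) (at_ p)) tM'.
have [y hy] := abs_series_real (fun p => le_trans (cm_Im (a p)) (at_ p)) tM'.
have H : clim (fun N : nat => \sum_(p < N) a p) (x +i* y).
  apply: clim_ReIm.
    by rewrite (_ : (fun n => _) = (fun N : nat => \sum_(p < N) complex.Re (a p)))//; apply/funext.
  by rewrite (_ : (fun n => _) = (fun N : nat => \sum_(p < N) complex.Im (a p)))//; apply/funext.
exists (x +i* y) => //; apply/ler_addgt0Pl => e e0.
have [N /(_ N (leqnn N)) h] := H e e0.
rewrite -[x +i* y](subrK (\sum_(p < N) a p)); apply: le_trans (cmD _ _) _.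
apply: lerD; first by rewrite cm_distC.
apply: le_trans (cm_sum _ _) _; apply: le_trans (tM' N); exact: ler_sum.
Qed.

Definition wt B (p : nat) : R := \sum_(b <- B p) b.2 / (1 - b.1).

(** Weights are measured at the reference point 1. Away from the poles [|z - b|] is at least a fixed
    multiple of [1 - b] ([pole_sep]), so convergence at 1 dominates convergence at every such [z].
    The bound [- p] leaves finitely many blocks near any point. *)
Definition pole_family B (M : R) : Prop :=
  (forall p b, b \in B p -> b.1 <= - p%:R /\ 0 <= b.2) /\
  (forall N : nat, \sum_(p < N) wt B p <= M).

Definition blk B (p : nat) z : C := \sum_(b <- B p) b.2%:C / (z - b.1%:C).
Definition pole_sum B z : Co := limn ((fun N : nat => \sum_(p < N) blk B p z) : nat -> Co).
Definition pole_of B z : Prop := exists p, exists2 b, b \in B p & z = b.1%:C.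

Lemma pole_sep_seq z (s : seq (R * R)) :
  (forall b, b \in s -> z != b.1%:C) -> (forall b, b \in s -> b.1 <= 0) ->
  exists2 d : R, 0 < d & forall b, b \in s -> d * (1 - b.1) <= cm (z - b.1%:C).
Proof.
elim: s => [|b s IH] zs s0; first by exists 1.
have [||d d0 Hd] := IH.
- by move=> b' b's; apply: zs; rewrite inE b's orbT.
- by move=> b' b's; apply: s0; rewrite inE b's orbT.
have b0 := s0 b (mem_head _ _).
have q0 : 0 < cm (z - b.1%:C) by rewrite cm_gt0 subr_eq0 zs// mem_head.
have k0 : 0 < 1 - b.1 by lra.
exists (Num.min d (cm (z - b.1%:C) / (1 - b.1))).
  by rewrite lt_min d0 divr_gt0.
move=> b'; rewrite inE => /orP[/eqP ->|b's].
  by rewrite -ler_pdivlMr// ge_min lexx orbT.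
apply: le_trans (Hd _ b's); rewrite ler_wpM2r// ?ge_min ?lexx//.
by have := s0 b'; rewrite inE b's orbT => /(_ isT); lra.
Qed.

(** For [p >= 2 * (1 + |z|)] the constant [1/2] works by the triangle inequality; the earlier blocks
    contain finitely many poles. *)
Lemma pole_sep B M z : pole_family B M -> ~ pole_of B z ->
  exists2 d : R, 0 < d & forall p b, b \in B p -> d * (1 - b.1) <= cm (z - b.1%:C).
Proof.
move=> [B1 _] zB.
have := archi_boundP (mulr_ge0 (ler0n R 2) (addr_ge0 ler01 (cm_ge0 z))).
set n := Num.Def.archi_bound _ => hn.
have [||d d0 Hd] := @pole_sep_seq z (flatten [seq B p | p <- iota 0 n]).
- move=> b /flatten_mapP[p _ bp]; apply/eqP => e; apply: zB; exists p; by exists b.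
- move=> b /flatten_mapP[p _ /B1[h _]]; apply: le_trans h _.
  by rewrite oppr_le0.
exists (Num.min d 2^-1); first by rewrite lt_min d0 invr_gt0 ltr0n.
move=> p b bp; have [h _] := B1 p b bp.
have p0 : 0 <= p%:R :> R by [].
have k0 : 0 <= 1 - b.1 by lra.
have [pn|np] := ltnP p n.
  apply: le_trans (Hd b _).
    by rewrite ler_wpM2r// ge_min lexx.
  by apply/flatten_mapP; exists p => //; rewrite mem_iota.
have np' : n%:R <= p%:R :> R by rewrite ler_nat.
apply: (@le_trans _ _ (2^-1 * (1 - b.1))).
  by rewrite ler_wpM2r// ge_min lexx orbT.
have := cmB z (z - b.1%:C); rewrite opprB addrC subrK cm_real.
rewrite ler0_norm; lra.
Qed.

Lemma cm_pole_term b z (d : R) : 0 < d -> 0 <= b.2 -> b.1 <= 0 ->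
  d * (1 - b.1) <= cm (z - b.1%:C) ->
  cm (b.2%:C / (z - b.1%:C)) <= d^-1 * (b.2 / (1 - b.1)).
Proof.
move=> d0 b0 b1 h; rewrite cmM cmV cm_real ger0_norm// mulrCA -invfM ler_wpM2l//.
by rewrite lef_pV2// posrE ?mulr_gt0//; [apply: lt_le_trans h; rewrite mulr_gt0//|]; lra.
Qed.

Lemma fam_le0 B M p b : pole_family B M -> b \in B p -> b.1 <= 0.
Proof.
move=> [B1 _] /B1[h _]; apply: le_trans h _; by rewrite oppr_le0.
Qed.

Lemma blk_bound B M z (d : R) p : pole_family B M -> 0 < d ->
  (forall p b, b \in B p -> d * (1 - b.1) <= cm (z - b.1%:C)) ->
  cm (blk B p z) <= d^-1 * wt B p.
Proof.
move=> BM d0 H; apply: le_trans (cm_sum _ _) _; rewrite /wt mulr_sumr.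
rewrite big_seq [leRHS]big_seq; apply: ler_sum => b bp.
by apply: cm_pole_term => //; [case: BM => B1 _; case: (B1 p b bp)|exact: fam_le0 BM bp|exact: H bp].
Qed.

Lemma pole_sum_cvg B M z : pole_family B M -> ~ pole_of B z ->
  clim (fun N : nat => \sum_(p < N) blk B p z) (pole_sum B z).
Proof.
move=> BM zB; have [d d0 Hd] := pole_sep BM zB.
have d0' : 0 <= d^-1 by rewrite invr_ge0 ltW.
have [s Hs _] := abs_series d0' (fun p => blk_bound p BM d0 Hd) BM.2.
suff -> : pole_sum B z = s by [].
by apply: (@cvg_lim Co) => //; apply/climP.
Qed.

Definition dblk B (p : nat) z : C := - \sum_(b <- B p) b.2%:C / (z - b.1%:C) ^+ 2.

(** Termwise differentiation. The remainder of a single pole is [(w - z)^2 / ((z - b)^2 * (w - b))]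
    times its weight; for [w] within [d / 2] of [z] the separation constant at [w] is [d / 2], which
    gives [K = 2 / d^3]. *)
Lemma pole_sum_holo B M z : pole_family B M -> ~ pole_of B z -> holo (pole_sum B) z.
Proof.
move=> BM zB; have [d d0 Hd] := pole_sep BM zB.
have d0' : 0 <= d^-1 by rewrite invr_ge0 ltW.
have k1 p b : b \in B p -> 1 <= 1 - b.1.
  by move=> bp; have := fam_le0 BM bp; lra.
have dbound p : cm (dblk B p z) <= d^-1 ^+ 2 * wt B p.
  rewrite /dblk cmN; apply: le_trans (cm_sum _ _) _; rewrite /wt mulr_sumr.
  rewrite big_seq [leRHS]big_seq; apply: ler_sum => b bp.
  have [_ b0] := BM.1 p b bp; have h := Hd p b bp; have k := k1 p b bp.
  rewrite cmM cmV cm_real ger0_norm// mulrCA ler_wpM2l//.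
  rewrite expr2 cmM invfM.
  have kp : 0 < 1 - b.1 by lra.
  have dk : 0 < d * (1 - b.1) by rewrite mulr_gt0.
  have hp : 0 < cm (z - b.1%:C) by exact: lt_le_trans h.
  have h1 : (cm (z - b.1%:C))^-1 <= d^-1 * (1 - b.1)^-1.
    by rewrite -invfM lef_pV2 ?posrE.
  have h2 : (cm (z - b.1%:C))^-1 <= d^-1.
    apply: le_trans h1 _; rewrite ler_piMr// invf_le1//.
  rewrite expr2 -mulrA; apply: ler_pM => //; by rewrite invr_ge0 cm_ge0.
have [D HD _] := abs_series (exprn_ge0 2 d0') dbound BM.2.
exists D => e e0.
pose K := 2 * d^-1 ^+ 3.
have K0 : 0 < K by rewrite mulr_gt0// exprn_gt0// invr_gt0.
have M0 : 0 <= M by have := BM.2 0%N; rewrite big_ord0.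
pose r := Num.min (d / 2) (e / (K * (M + 1))).
have KM0 : 0 < K * (M + 1) by rewrite mulr_gt0//; lra.
exists r; first by rewrite lt_min !divr_gt0.
move=> w; rewrite le_min => /andP[wd we].
have Hw p b : b \in B p -> d / 2 * (1 - b.1) <= cm (w - b.1%:C).
  move=> bp; have h := Hd p b bp; have k := k1 p b bp.
  have := cmD (z - w) (w - b.1%:C); rewrite subrKA (cm_distC z w) => h1.
  have : d / 2 <= d / 2 * (1 - b.1) by rewrite ler_peMr// ltW// divr_gt0.
  lra.
have d20 : 0 < d / 2 by rewrite divr_gt0.
have d20' : 0 <= (d / 2)^-1 by rewrite invr_ge0 ltW.
have [s Hs sM] := abs_series d20' (fun p => blk_bound p BM d20 Hw) BM.2.
have sw : pole_sum B w = s by apply: (@cvg_lim Co) => //; apply/climP.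
have Hz := pole_sum_cvg BM zB.
have ebound p : cm (blk B p w - blk B p z - dblk B p z * (w - z)) <=
     (K * cm (w - z) ^+ 2) * wt B p.
  rewrite /blk /dblk mulNr opprK mulr_suml -sumrB -big_split/=.
  apply: le_trans (cm_sum _ _) _; rewrite /wt mulr_sumr.
  rewrite big_seq [leRHS]big_seq; apply: ler_sum => b bp.
  have [_ b0] := BM.1 p b bp; have h := Hd p b bp; have k := k1 p b bp.
  have h' := Hw p b bp.
  have kp : 0 < 1 - b.1 by lra.
  have hp : 0 < cm (z - b.1%:C) by apply: lt_le_trans h; rewrite mulr_gt0.
  have hp' : 0 < cm (w - b.1%:C) by apply: lt_le_trans h'; rewrite mulr_gt0.
  have zn : z - b.1%:C != 0 by rewrite -cm_gt0.
  have wn : w - b.1%:C != 0 by rewrite -cm_gt0.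
  have -> : b.2%:C / (w - b.1%:C) - b.2%:C / (z - b.1%:C) +
     b.2%:C / (z - b.1%:C) ^+ 2 * (w - z) =
     b.2%:C * ((w - z) * (w - z) / ((z - b.1%:C) * (z - b.1%:C) * (w - b.1%:C))).
    by field; rewrite zn wn.
  rewrite cmM cm_real ger0_norm// [leRHS]mulrCA ler_wpM2l//.
  rewrite !cmM cmV !cmM -expr2 [leRHS]mulrAC [leLHS]mulrC ler_wpM2r ?exprn_ge0 ?cm_ge0//.
  have h1 : (cm (z - b.1%:C))^-1 <= d^-1.
    rewrite lef_pV2 ?posrE//; apply: le_trans h; by rewrite ler_peMr// ltW.
  have h2 : (cm (w - b.1%:C))^-1 <= 2 * d^-1 * (1 - b.1)^-1.
    rewrite (_ : 2 * d^-1 = (d / 2)^-1); last by rewrite invfM invrK mulrC.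
    by rewrite -invfM lef_pV2 ?posrE// mulr_gt0.
  rewrite !invfM /K (_ : 2 * d^-1 ^+ 3 / (1 - b.1) = d^-1 * d^-1 * (2 * d^-1 * (1 - b.1)^-1)); last by ring.
  by apply: ler_pM => //; rewrite ?mulr_ge0 ?invr_ge0 ?cm_ge0//; apply: ler_pM => //; rewrite ?invr_ge0 ?cm_ge0.
have Kw : 0 <= K * cm (w - z) ^+ 2 by rewrite mulr_ge0 ?exprn_ge0 ?cm_ge0// ltW.
have [E HE EM] := abs_series Kw ebound BM.2.
have EE : pole_sum B w - pole_sum B z - D * (w - z) = E.
  apply: clim_unique HE; rewrite sw.
  apply: eq_clim (climB (climB Hs Hz) (climMr (w - z) HD)) => N.
  by rewrite mulr_suml -!sumrB.
rewrite EE; apply: le_trans EM _.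
have c0 := cm_ge0 (w - z).
have h : cm (w - z) * (K * (M + 1)) <= e by rewrite -ler_pdivlMr.
rewrite expr2 (_ : K * _ * M = cm (w - z) * K * M * cm (w - z)); last by ring.
rewrite ler_wpM2r//; apply: le_trans h; rewrite -mulrA ler_wpM2l// ler_wpM2l// ?ltW//; lra.
Qed.

End PoleSeries.

(** * Residues, removal of one pole, and bounds in the right half-plane *)

Section PoleRemoval.
Variable R : realType.
Local Notation C := R[i].
Local Notation Co := (R[i])^o.
Implicit Types (z w : Co) (B : nat -> seq (R * R)) (b : R * R) (M : R).

Definition drop_pole B (z0 : C) (p : nat) : seq (R * R) :=
  [seq b <- B p | b.1%:C != z0].

(** Sums over all occurrences of [z0], so that it makes sense before the poles are known to be
    distinct. The range of [p] is exhaustive by [pole_index_lt]. *)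
Definition residue B (z0 : C) : R :=
  \sum_(p < Num.Def.archi_bound (cm z0)) \sum_(b <- B p | b.1%:C == z0) b.2.

Lemma drop_pole_family B M z0 : pole_family B M -> pole_family (drop_pole B z0) M.
Proof.
move=> [B1 BM]; split.
  by move=> p b; rewrite mem_filter => /andP[_ /B1].
move=> N; apply: le_trans (BM N); apply: ler_sum => p _.
rewrite /wt big_filter [leRHS](bigID (fun b => b.1%:C != z0))/= lerDl.
rewrite big_seq_cond; apply: sumr_ge0 => b /andP[bp _].
have [h1 h2] := B1 _ _ bp; rewrite divr_ge0//.
by have : 0 <= p%:R :> R by []; lra.
Qed.

Lemma pole_of_drop B z0 w : pole_of (drop_pole B z0) w -> pole_of B w.
Proof. by move=> [p [b]]; rewrite mem_filter => /andP[_ bp] ->; exists p, b. Qed.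

Lemma drop_poleN B z0 : ~ pole_of (drop_pole B z0) z0.
Proof. by move=> [p [b]]; rewrite mem_filter => /andP[/eqP h _] /esym. Qed.

Lemma pole_of_dropP B z0 w : w != z0 -> pole_of B w -> pole_of (drop_pole B z0) w.
Proof.
move=> wz [p [b bp e]]; exists p, b => //.
by rewrite mem_filter bp -e wz.
Qed.

Lemma pole_index_lt B M p b z0 : pole_family B M -> b \in B p -> b.1%:C = z0 ->
  (p < Num.Def.archi_bound (cm z0))%N.
Proof.
move=> [B1 _] bp e; have [h _] := B1 _ _ bp.
have p0 : 0 <= p%:R :> R by [].
have := archi_boundP (cm_ge0 z0); rewrite -e cm_real -(ltr_nat R).
apply: le_lt_trans; rewrite ler0_norm; lra.
Qed.

Lemma pole_sum_drop B M z0 z : pole_family B M -> ~ pole_of B z ->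
  pole_sum B z = pole_sum (drop_pole B z0) z + (residue B z0)%:C / (z - z0).
Proof.
move=> BM zB; have zB' : ~ pole_of (drop_pole B z0) z by move=> /pole_of_drop.
have H := pole_sum_cvg (drop_pole_family z0 BM) zB'.
apply: clim_unique (pole_sum_cvg BM zB) _ => e e0.
have [N0 HN] := H e e0.
exists (maxn N0 (Num.Def.archi_bound (cm z0))) => n; rewrite geq_max => /andP[/HN h n0].
suff -> : \sum_(p < n) blk B p z = \sum_(p < n) blk (drop_pole B z0) p z +
    (residue B z0)%:C / (z - z0) by rewrite opprD addrACA subrr addr0.
have E p : blk B p z = blk (drop_pole B z0) p z +
    (\sum_(b <- B p | b.1%:C == z0) b.2)%:C / (z - z0).
  rewrite /blk /drop_pole big_filter (bigID (fun b => b.1%:C != z0))/=; congr (_ + _).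
  rewrite rmorph_sum mulr_suml; apply: eq_big => [b|b]; first by rewrite negbK.
  by rewrite negbK => /eqP ->.
under eq_bigr do rewrite E.
rewrite big_split/=; congr (_ + _).
rewrite -mulr_suml; congr (_ / _); rewrite /residue rmorph_sum/=.
rewrite -!(big_mkord xpredT (fun p => (\sum_(b <- B p | b.1%:C == z0) b.2)%:C)).
rewrite (@big_cat_nat _ _ _ (Num.Def.archi_bound (cm z0)))//=.
rewrite [X in _ + X]big_nat [X in _ + X]big1 ?addr0// => p /andP[np _].
rewrite big_seq_cond big1// => b /andP[bp /eqP be].
by have := pole_index_lt BM bp be; rewrite ltnNge np.
Qed.

Lemma residue_ge0 B M z0 : pole_family B M -> 0 <= residue B z0.
Proof.
move=> [B1 _]; apply: sumr_ge0 => p _; rewrite big_seq_cond.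
by apply: sumr_ge0 => b /andP[bp _]; have [] := B1 _ _ bp.
Qed.

Lemma residue_eq0 B M z0 : pole_family B M -> ~ pole_of B z0 -> residue B z0 = 0.
Proof.
move=> BM zB; rewrite /residue big1// => p _; rewrite big_seq_cond big1// => b /andP[bp /eqP e].
by case: zB; exists p, b.
Qed.

Lemma residue_gt0 B M z0 : pole_family B M ->
  (forall p b, b \in B p -> 0 < b.2) -> pole_of B z0 -> 0 < residue B z0.
Proof.
move=> BM B0 [p [b bp /esym e]]; have lt := pole_index_lt BM bp e.
rewrite /residue (bigD1 (Ordinal lt))//=; apply: ltr_pwDl; last first.
  apply: sumr_ge0 => q _; rewrite big_seq_cond.
  by apply: sumr_ge0 => c /andP[cp _]; have [] := BM.1 _ _ cp.
have /perm_to_rem pr := bp.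
rewrite (perm_big _ pr)/= big_cons e eqxx; apply: ltr_pwDl; first exact: B0 bp.
rewrite big_seq_cond; apply: sumr_ge0 => c /andP[/mem_rem cp _].
by have [] := BM.1 _ _ cp.
Qed.

Lemma residue_uniq B M p b : pole_family B M -> b \in B p ->
  uniq [seq c.1 | c <- B p] ->
  (forall q c, c \in B q -> c.1 = b.1 -> q = p) -> residue B b.1%:C = b.2.
Proof.
move=> BM bp up H; have lt := pole_index_lt BM bp erefl.
rewrite /residue (bigD1 (Ordinal lt))//= [X in _ + X]big1 ?addr0.
  have /perm_to_rem pr := bp.
  rewrite (perm_big _ pr)/= big_cons eqxx big_seq_cond big1 ?addr0//.
  move=> c /andP[cr /eqP/(@complexI R) e].
  have : uniq [seq c.1 | c <- b :: rem b (B p)].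
    by rewrite (perm_uniq (s2 := [seq c.1 | c <- B p])) ?(perm_map _ _)// perm_sym.
  rewrite /= => /andP[/negP[]]; rewrite -e; exact: map_f.
move=> q qp; rewrite big_seq_cond big1// => c /andP[cq /eqP/(@complexI R) e].
by case/eqP: qp; apply: val_inj => /=; exact: H cq e.
Qed.

Lemma discrete_poles B M : pole_family B M -> discrete_set (pole_of B).
Proof.
move=> BM z; have [d d0 Hd] := pole_sep (drop_pole_family z BM) (@drop_poleN B z).
exists d => // w wz wn /(pole_of_dropP wn)[p [b bp e]].
have := Hd p b bp; rewrite -e cm_distC.
have := fam_le0 (drop_pole_family z BM) bp => b0.
have : d <= d * (1 - b.1) by rewrite ler_peMr ?(ltW d0)//; lra.
lra.
Qed.

Lemma clim_Re_ge (a : nat -> C) (x : C) (m : R) : clim a x ->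
  (forall n, (0 < n)%N -> m <= complex.Re (a n)) -> m <= complex.Re x.
Proof.
move=> ax am; apply/ler_addgt0Pl => e e0.
have [N HN] := ax e e0; have h := HN N.+1 (leqnSn N).
have := am N.+1 isT; have := cm_Re (a N.+1 - x); rewrite ReD ReN ler_norml => /andP[_].
lra.
Qed.

Lemma Re_pole_term b z : 0 <= b.2 -> b.1 <= 0 -> 0 < complex.Re z ->
  0 <= complex.Re (b.2%:C / (z - b.1%:C)).
Proof.
case: z => x y /= b0 b1 x0; rewrite !(mul0r, subr0, addr0, sub0r, mulr0, oppr0, opprK).
rewrite mulr_ge0// divr_ge0//; first lra.
by rewrite addr_ge0// sqr_ge0.
Qed.

Lemma Re_pole_term_gt0 b z : 0 < b.2 -> b.1 <= 0 -> 0 < complex.Re z ->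
  0 < complex.Re (b.2%:C / (z - b.1%:C)).
Proof.
case: z => x y /= b0 b1 x0; rewrite !(mul0r, subr0, addr0, sub0r, mulr0, oppr0, opprK).
rewrite mulr_gt0// divr_gt0//; first lra.
by rewrite ltr_pwDl ?sqr_ge0// exprn_gt0//; lra.
Qed.

Lemma not_pole_Re B M z : pole_family B M -> 0 < complex.Re z -> ~ pole_of B z.
Proof.
move=> BM z0 [p [b bp e]]; have := fam_le0 BM bp.
by move: z0; rewrite e /=; lra.
Qed.

(** Every term has nonnegative real part in the right half-plane, and the one in block 0 a positive
    real part. Thus [P] has no zero there, and [f] no pole. *)
Lemma pole_sum_Re_gt0 B M b z : pole_family B M -> B 0%N = [:: b] -> 0 < b.2 ->
  0 < complex.Re z -> 0 < complex.Re (pole_sum B z).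
Proof.
move=> BM B0 b0 z0; have zB := not_pole_Re BM z0.
have bB : b \in B 0%N by rewrite B0 mem_head.
have b1 := fam_le0 BM bB.
apply: lt_le_trans (Re_pole_term_gt0 b0 b1 z0) _.
apply: clim_Re_ge (pole_sum_cvg BM zB) _ => -[//|n] _.
rewrite big_ord_recl /blk B0 big_seq1 ReD lerDl.
elim/big_ind : _ => //= [x y hx hy|p _]; first by rewrite ReD addr_ge0.
rewrite /blk big_seq; elim/big_ind : _ => //= [x y hx hy|c cp].
  by rewrite ReD addr_ge0.
have [_ c0] := BM.1 _ _ cp; apply: Re_pole_term => //; exact: fam_le0 BM cp.
Qed.

Definition rblk B (p : nat) (x : R) : R := \sum_(b <- B p) b.2 / (x - b.1).

Lemma blk_real B p (x : R) : blk B p x%:C = (rblk B p x)%:C.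
Proof.
rewrite /blk /rblk rmorph_sum; apply: eq_bigr => b _.
by rewrite rmorphM fmorphV rmorphB.
Qed.

Lemma pole_sum_real B M (x v : R) : pole_family B M -> 0 < x ->
  (fun N : nat => \sum_(p < N) rblk B p x) @ \oo --> v -> pole_sum B x%:C = v%:C.
Proof.
move=> BM x0 H; have zB : ~ pole_of B (x%:C : Co) by apply: (not_pole_Re BM).
apply: clim_unique (pole_sum_cvg BM zB) _.
apply: eq_clim (clim_real H) => N; rewrite rmorph_sum; apply: eq_bigr => p _.
by rewrite blk_real.
Qed.

(** Each term changes by at most the factor [|z| / (x - |z|)], so the error is relative to the value
    [v] at [x]. This serves [f_shift_cvg]. *)
Lemma pole_sum_shift B M (x v : R) z : pole_family B M -> cm z < x ->
  (fun N : nat => \sum_(p < N) rblk B p x) @ \oo --> v ->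
  cm (pole_sum B (x%:C : Co) - pole_sum B (z + x%:C)) <= cm z / (x - cm z) * v.
Proof.
move=> BM zx Hv; have z0 := cm_ge0 z.
have x0 : 0 < x by lra.
have xz0 : 0 < x - cm z by lra.
have zB : ~ pole_of B (x%:C : Co) by apply: (not_pole_Re BM).
have Rz : 0 < complex.Re (z + x%:C).
  by rewrite ReD /=; have := cm_Re z; rewrite ler_norml => /andP[h _]; lra.
have zB' : ~ pole_of B (z + x%:C) by apply: (not_pole_Re BM).
have r0 p : 0 <= rblk B p x.
  rewrite /rblk big_seq; apply: sumr_ge0 => b bp.
  by have := fam_le0 BM bp; have [_ b2] := BM.1 _ _ bp => b1; rewrite divr_ge0//; lra.
have rv (N : nat) : \sum_(p < N) rblk B p x <= v.
  rewrite -(cvg_lim _ Hv)//; apply: nondecreasing_cvgn_le; last by apply: cvgP Hv.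
  by apply/nondecreasing_seqP => n; rewrite big_ord_recr/= lerDl.
have bound p : cm (blk B p x%:C - blk B p (z + x%:C)) <= cm z / (x - cm z) * rblk B p x.
  rewrite /blk -sumrB; apply: le_trans (cm_sum _ _) _; rewrite /rblk mulr_sumr.
  rewrite big_seq [leRHS]big_seq; apply: ler_sum => b bp.
  have b1 := fam_le0 BM bp; have [_ b2] := BM.1 _ _ bp.
  have xb : 0 < x - b.1 by lra.
  have h : x - cm z <= cm (z + x%:C - b.1%:C).
    have := cmB (z + x%:C - b.1%:C) z; rewrite (_ : _ - _ - z = (x - b.1)%:C); last first.
      by rewrite rmorphB; ring.
    by rewrite cm_real gtr0_norm//; lra.
  have n1 : x%:C - b.1%:C != 0 :> C by rewrite -rmorphB -cm_gt0 cm_real gtr0_norm.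
  have n2 : z + x%:C - b.1%:C != 0 by rewrite -cm_gt0; lra.
  rewrite (_ : _ - _ = z * ((z + x%:C - b.1%:C)^-1 * (b.2%:C / (x%:C - b.1%:C)))); last first.
    by field; rewrite n1 n2.
  rewrite !cmM !cmV -rmorphB !cm_real (gtr0_norm xb) (ger0_norm b2) -mulrA ler_wpM2l//.
  by rewrite ler_wpM2r ?divr_ge0 ?(ltW xb)// lef_pV2 ?posrE//; lra.
have K0 : 0 <= cm z / (x - cm z) by rewrite divr_ge0// ltW.
have [s Hs sM] := abs_series K0 bound rv.
suff <- : s = pole_sum B (x%:C : Co) - pole_sum B (z + x%:C) by [].
apply: clim_unique Hs _.
apply: eq_clim (climB (pole_sum_cvg BM zB) (pole_sum_cvg BM zB')) => N.
by rewrite -sumrB.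
Qed.

End PoleRemoval.

(** * The function P *)

Section ConcretePoles.
Variable R : realType.
Local Notation C := R[i].
Local Notation Co := (R[i])^o.
Local Notation B := (@B R).
Implicit Types (b : R * R) (X : R) (z : Co).

Lemma A_1 : A (1 : R) = 1.
Proof. by have := A_S R 1; rewrite S_1. Qed.

Lemma A_gt0 X : 0 < X -> 0 < A X.
Proof. by move=> X0; rewrite -(A_0 R) A_lt. Qed.

Lemma B_weight_gt0 p b : b \in B p -> 0 < b.2.
Proof.
move=> /mapP[c cV ->] /=; apply: mulr_gt0; last by apply: dA_gt0; exact: phi_ge0.
by apply: mulr_gt0; [exact: V_weight_gt0 cV|exact: dphi_gt0].
Qed.

(** Here [c.1 < 0] puts [phi c.1] strictly between 0 and [phi 0 = 1], and [A] fixes 0 and 1; the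
    shift in [xi] is by [p + 2]. *)
Lemma B_loc p b : b \in B p.+1 -> - p.+1%:R - 1 < b.1 < - p.+1%:R.
Proof.
move=> /mapP[c cV ->] /=; rewrite /xi.
have c0 := V_lt0 cV.
have h1 : 0 < A (phi c.1) by rewrite A_gt0// phi_gt0.
have h2 : A (phi c.1) < 1.
  by rewrite -A_1 A_lt ?phi_ge0// -(phi0 R) phi_lt.
by rewrite -[p.+2%:R]natr1; apply/andP; split; lra.
Qed.

Definition rho0 : R := rho (0, 1).

Lemma B_0 : B 0%N = [:: (0, rho0)].
Proof. by rewrite /B /= /xi /= phi0 A_1 subrr. Qed.

Lemma rho0_gt0 : 0 < rho0.
Proof. by apply: (@B_weight_gt0 0%N (0, rho0)); rewrite B_0 mem_head. Qed.

Lemma B_le p b : b \in B p -> b.1 <= - p%:R.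
Proof.
case: p => [|p]; last by move=> /B_loc/andP[_ /ltW].
by rewrite B_0 inE => /eqP -> /=; rewrite oppr0.
Qed.

Lemma B_ge p b : b \in B p -> - p%:R - 1 < b.1.
Proof.
case: p => [|p]; last by move=> /B_loc/andP[].
by rewrite B_0 inE => /eqP -> /=; lra.
Qed.

Lemma B_index p q b c : b \in B p -> c \in B q -> b.1 = c.1 -> p = q.
Proof.
have H p' q' b' c' : b' \in B p' -> c' \in B q' -> b'.1 = c'.1 -> ~ (p' < q')%N.
  move=> bp cq e pq; have := B_ge bp; have := B_le cq.
  have : p'%:R + 1 <= q'%:R :> R by rewrite natr1 ler_nat.
  by rewrite e; lra.
move=> bp cq e; case: (ltngtP p q) => // lt; exfalso.
  exact: H bp cq e lt.
exact: H cq bp (esym e) lt.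
Qed.

Lemma size_B p : size (B p.+1) = (2 ^ p)%N.
Proof. by rewrite size_map size_V. Qed.

Lemma sorted_B p : sorted (@rlt R) (B p).
Proof.
rewrite sorted_map; apply: sub_sorted (sorted_V R p) => x y.
by rewrite /rlt/= /xi ltrD2r => h; rewrite A_lt ?phi_ge0// phi_lt.
Qed.

Lemma uniq_B p : uniq [seq b.1 | b <- B p].
Proof.
apply: (@sorted_uniq _ (fun x y : R => x < y)).
- exact: lt_trans.
- exact: ltxx.
by rewrite sorted_map; apply: sub_sorted (sorted_B p).
Qed.

Lemma B_family : pole_family B 1.
Proof.
split=> [p b bp|N]; first by rewrite B_le// ltW// (B_weight_gt0 bp).
have := Bsum_sum_le N (@ltr01 R); rewrite invr1; apply: le_trans.
by apply: ler_sum => p _; rewrite A_1.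
Qed.

Lemma rblk_B_cvg X : 0 < X -> (fun N : nat => \sum_(p < N) rblk B p (A X)) @ \oo --> X^-1.
Proof. exact: Bsum_cvg. Qed.

Definition P : C -> C := pole_sum B.

(** The reciprocal of [P] thus inverts [A] on the positive half-line. *)
Lemma P_A X : 0 < X -> P (A X)%:C = (X^-1)%:C.
Proof.
move=> X0; apply: (pole_sum_real B_family); first exact: A_gt0.
exact: rblk_B_cvg.
Qed.

Lemma residue_B p b : b \in B p -> residue B b.1%:C = b.2.
Proof.
move=> bp; apply: (residue_uniq B_family bp (uniq_B p)) => q c cq e.
exact: B_index cq bp e.
Qed.

(** By [AB_le], the points [Y * (1 - 1 / (n + 2))] have images under [A] that accumulate at [A Y]
    from the left. *)
Lemma A_left (Y : R) : 0 < Y -> exists u : nat -> R,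
  [/\ injective u, forall n, 0 < u n, forall n, A (u n) < A Y &
    forall r : R, 0 < r -> exists N, forall n, (N <= n)%N -> `|A (u n) - A Y| < r].
Proof.
move=> Y0; pose u n : R := Y * (1 - n.+2%:R^-1).
have i1 n : 0 < n.+2%:R^-1 :> R by rewrite invr_gt0.
have i2 n : n.+2%:R^-1 < 1 :> R by rewrite invf_lt1// ltr1n.
have u0 n : 0 < u n by rewrite mulr_gt0// subr_gt0.
have uY n : u n < Y by rewrite /u gtr_pMr// gtrBl.
exists u; split=> //.
- move=> m n /(mulfI (lt0r_neq0 Y0))/addrI/oppr_inj/invr_inj/eqP.
  by rewrite eqr_nat => /eqP[].
- by move=> n; rewrite A_lt// ltW.
move=> r r0; have d0 := dA_gt0 (ltW Y0).
have k0 : 0 <= dA Y * Y / r by rewrite divr_ge0 ?mulr_ge0// ltW.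
exists (Num.Def.archi_bound (dA Y * Y / r)) => n Nn.
have lA : A (u n) < A Y by rewrite A_lt// ltW.
rewrite distrC gtr0_norm ?subr_gt0//.
apply: le_lt_trans (AB_le (ltW (u0 n)) (uY n)) _.
have -> : Y - u n = Y / n.+2%:R by rewrite /u; ring.
rewrite mulrA ltr_pdivrMr// [ltRHS]mulrC -ltr_pdivrMr//.
apply: lt_le_trans (archi_boundP k0) _.
by rewrite ler_nat (leq_trans Nn)// -addn2 leq_addr.
Qed.

(* The values [A X] are dense enough on the positive half-line to determine
   a meromorphic function. *)
Lemma identity_A (S : set Co) (h : Co -> Co) : discrete_set S ->
  (forall z, ~ S z -> holo h z) ->
  (forall X, 0 < X -> ~ S (A X)%:C -> h (A X)%:C = 0) ->
  forall z, ~ S z -> h z = 0.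
Proof.
move=> dS dh hA.
(* The accumulation point must avoid [S], and 1 itself may belong to it. A point [A Y] is taken in a
   punctured neighbourhood of 1 free of [S], and zeros are made to accumulate there. *)
have [r1 r10 Hr1] := dS (1%:C).
have [u [_ u0 uA uc]] := A_left (@ltr01 R); rewrite A_1 in uA uc.
have [N HN] := uc r1 r10.
pose Y := u N; have Y0 : 0 < Y := u0 N.
have cYX (X Z : R) : cm ((A X)%:C - (A Z)%:C) = `|A X - A Z|.
  by rewrite -rmorphB cm_real.
have SY : ~ S (A Y)%:C.
  apply: Hr1; first by rewrite -rmorphB cm_real HN.
  by apply/eqP => /(@complexI R) e; have := uA N; rewrite -/Y e ltxx.
have [r2 r20 Hr2] := dS (A Y)%:C.
have [v [iv v0 vA vc]] := A_left Y0.
have [N2 HN2] := vc r2 r20.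
pose w n : Co := (A (v (N2 + n)%N))%:C.
have iA (a b : R) : 0 < a -> 0 < b -> A a = A b -> a = b.
  move=> a0 b0 e; case: (ltgtP a b) => // lt.
    by have := A_lt (ltW a0) lt; rewrite e ltxx.
  by have := A_lt (ltW b0) lt; rewrite e ltxx.
apply: (@identity_theorem_seq R S h (A Y)%:C w) => //.
- by move=> m n /(@complexI R)/(iA _ _ (v0 _) (v0 _))/iv/addnI.
- move=> n; apply: hA => //; apply: Hr2.
    by rewrite cYX; apply: HN2; rewrite leq_addr.
  by apply/eqP => /(@complexI R) e; have := vA (N2 + n)%N; rewrite e ltxx.
- move=> r r0; have [N3 HN3] := vc r r0; exists N3 => n n3.
  by rewrite cYX; apply: HN3; rewrite (leq_trans n3)// leq_addl.
Qed.

End ConcretePoles.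

(** * The Hausdorff moment problem *)

Section MomentUnicity.
Variable R : realType.

Local Notation D01 := (`[0, 1]%classic : set R).

Lemma bounded_integrable01 (mu : probability R R) (g : R -> R) : continuous g ->
  mu.-integrable D01 (EFin \o g).
Proof.
move=> cg; apply: measurable_bounded_integrable => //.
- by rewrite (le_lt_trans (probability_le1 _ _))// ltry.
- by apply/measurable_funTS; exact: continuous_measurable_fun.
have /compact_bounded[M [_ HM]] : compact (g @` D01).
  by apply: continuous_compact; [exact: continuous_subspaceT|exact: segment_compact].
exists M; split; first exact: num_real.
move=> x Mx y Dy; apply: HM => //; by exists y.
Qed.

Lemma supported_mass (rho : probability R R) : rho (~` D01) = 0%E -> rho D01 = 1%E.
Proof.
move=> r0; rewrite -(probability_setT rho) -(setUv D01) measureU//.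
- by transitivity (rho D01 + 0)%E; [rewrite adde0|congr (_ + _)%E; exact: esym r0].
- exact: measurableC.
- exact: setICr.
Qed.

(** The factor [t ^+ k] closes the induction on [K]: one more power of [1 - t ^+ n] splits into the
    exponents [k] and [k + n]. *)
Definition bump (n K k : nat) (t : R) : R := t ^+ k * (1 - t ^+ n) ^+ K.

Lemma continuous_bump n K k : continuous (bump n K k).
Proof.
move=> t; apply: (@cvgM _ _ _ _ (fun t : R => t ^+ k) (fun t : R => (1 - t ^+ n) ^+ K)).
  exact: exprn_continuous.
apply: (@continuous_comp _ _ _ (fun t : R => 1 - t ^+ n) (fun t : R => t ^+ K)).
  by apply: cvgB; [exact: cvg_cst|exact: exprn_continuous].
exact: exprn_continuous.
Qed.

Lemma bump_moments (mu nu : probability R R) n K k :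
  (forall n, \int[mu]_(t in D01) ((t ^+ n)%:E) = \int[nu]_(t in D01) ((t ^+ n)%:E))%E ->
  (\int[mu]_(t in D01) ((bump n K k t)%:E) = \int[nu]_(t in D01) ((bump n K k t)%:E))%E.
Proof.
move=> H; elim: K k => [|K IH] k.
  rewrite /bump; under eq_integral do rewrite expr0 mulr1.
  by under [RHS]eq_integral do rewrite expr0 mulr1.
have E (rho : probability R R) : (\int[rho]_(t in D01) ((bump n K.+1 k t)%:E) =
   \int[rho]_(t in D01) ((bump n K k t)%:E) - \int[rho]_(t in D01) ((bump n K (k + n) t)%:E))%E.
  rewrite -integralB_EFin//; last 2 first.
  - by apply: (bounded_integrable01 rho); exact: continuous_bump.
  - by apply: (bounded_integrable01 rho); exact: continuous_bump.
  apply: eq_integral => t _; rewrite -EFinB; congr (_%:E).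
  by rewrite /bump exprS exprD; ring.
by rewrite !E !IH.
Qed.

(** Places the switch of [(1 - t ^+ n) ^+ K] between [a] and [b]: since [(b / a)^n] is unbounded,
    [K] close to [e / a^n] makes [K * t^n] small at [a] and large at [b]. *)
Lemma exists_threshold (a b e : R) : 0 < a -> a < b -> b <= 1 -> 0 < e ->
  exists n K : nat, K%:R * a ^+ n <= e /\ e^-1 <= K%:R * b ^+ n.
Proof.
move=> a0 ab b1 e0.
have b0 : 0 < b by lra.
(* The additional 1 pays for the truncation of [e / a ^+ n] to an integer. *)
pose c := (e^-1 + 1) / e.
have [n Hn] : exists n, c <= (b / a) ^+ n.
  pose x := b / a - 1.
  have x0 : 0 < x by rewrite /x subr_gt0 ltr_pdivlMr// mul1r.
  have c0' : 0 < c by rewrite divr_gt0// addr_gt0// invr_gt0.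
  have c0 : 0 <= c / x by rewrite divr_ge0// ltW.
  have := archi_boundP c0; set n := Num.Def.archi_bound _ => hn.
  exists n; have -> : b / a = 1 + x by rewrite /x addrC subrK.
  have : 1 + x *+ n <= (1 + x) ^+ n.
    elim: n {hn} => [|n IH]; first by rewrite mulr0n addr0 expr0.
    rewrite exprS mulrSr; have : 0 <= x *+ n by rewrite mulrn_wge0// ltW.
    by nra.
  move: hn; rewrite ltr_pdivrMr// -mulr_natl mulrC; lra.
have an : 0 < a ^+ n by rewrite exprn_gt0.
have bn : 0 < b ^+ n by rewrite exprn_gt0.
have q0 : 0 <= e / a ^+ n by rewrite divr_ge0// ltW.
exists n, (Num.truncn (e / a ^+ n)).
have /andP[h1 h2] := Num.Theory.truncn_itv q0.
split; first by rewrite -ler_pdivlMr.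
have h3 : e / a ^+ n - 1 <= (Num.truncn (e / a ^+ n))%:R.
  by move: h2; rewrite -natr1; lra.
apply: le_trans (ler_wpM2r (ltW bn) h3).
rewrite mulrBl mul1r mulrAC -mulrA -expr_div_n.
have bn1 : b ^+ n <= 1 by rewrite exprn_ile1// ltW.
have : e * c <= e * (b / a) ^+ n by rewrite ler_wpM2l// ltW.
rewrite /c mulrCA divff ?mulr1 ?gt_eqF//; lra.
Qed.

Lemma one_minus_pow_ge (s : R) K : 0 <= s <= 1 -> 1 - K%:R * s <= (1 - s) ^+ K.
Proof.
move=> /andP[s0 s1]; elim: K => [|K IH]; first by rewrite mul0r subr0 expr0.
rewrite exprS -natr1.
have : 0 <= K%:R * s by rewrite mulr_ge0.
have h : (1 - s) * (1 - K%:R * s) <= (1 - s) * (1 - s) ^+ K.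
  by rewrite ler_wpM2l// subr_ge0.
nra.
Qed.

Lemma one_minus_pow_le (s : R) K : 0 <= s <= 1 -> (1 - s) ^+ K * (1 + K%:R * s) <= 1.
Proof.
move=> /andP[s0 s1]; elim: K => [|K IH]; first by rewrite mul0r addr0 expr0 mulr1.
apply: le_trans IH; rewrite exprSr -mulrA ler_wpM2l ?exprn_ge0 ?subr_ge0//.
rewrite -natr1; have : 0 <= K%:R * s by rewrite mulr_ge0.
have : 0 <= K%:R * s * s by rewrite !mulr_ge0.
by have := sqr_ge0 s; lra.
Qed.

(* The test functions [1 - (1 - t^n)^K], whose integrals the moments determine,
   are at most [e] on [[0, a]] and at least [1 - e] on [[b, 1]]. *)
Lemma tail_le (mu nu : probability R R) (a b : R) :
  mu (~` D01) = 0%E -> nu (~` D01) = 0%E ->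
  (forall n, \int[mu]_(t in D01) ((t ^+ n)%:E) = \int[nu]_(t in D01) ((t ^+ n)%:E))%E ->
  0 < a -> a < b -> (mu `]b, +oo[%classic <= nu `]a, +oo[%classic)%E.
Proof.
move=> mu0 nu0 H a0 ab.
have cut (rho : probability R R) (c : R) : rho (~` D01) = 0%E ->
    rho `]c, +oo[%classic = rho (D01 `&` `]c, +oo[%classic).
  move=> r0; rewrite -[X in rho X = _]setIT -(setUv D01) setIUr measureU//.
  - transitivity (rho (`]c, +oo[%classic `&` D01) + 0)%E; last by rewrite adde0 setIC.
    congr (_ + _)%E; apply: subset_measure0 r0; [|exact: measurableC|exact: subIsetr].
    by apply: measurableI => //; exact: measurableC.
  - exact: measurableI.
  - by apply: measurableI => //; exact: measurableC.
  - by rewrite setIACA setICr setI0.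
rewrite (cut mu b mu0) (cut nu a nu0).
have [b1|b1] := leP 1 b.
  rewrite (_ : D01 `&` `]b, +oo[%classic = set0) ?measure0//.
  by apply/seteqP; split => // x [/=]; rewrite !in_itv/= andbT => /andP[_ x1] bx; move: (lt_le_trans bx x1); rewrite ltNge b1.
set X := mu _; set Y := nu _.
have Xf : X \is a fin_num by rewrite fin_num_measure//; exact: measurableI.
have Yf : Y \is a fin_num by rewrite fin_num_measure//; exact: measurableI.
rewrite -(fineK Xf) -(fineK Yf) lee_fin.
suff K (e : R) : 0 < e -> (1 - e) * fine X <= fine Y + e.
  have x1 : fine X <= 1.
    by rewrite -lee_fin fineK// probability_le1//; exact: measurableI.
  have x0 : 0 <= fine X by apply: fine_ge0; exact: measure_ge0.
  apply/ler_addgt0Pl => e e0; have := K (e / 2) (divr_gt0 e0 (ltr0n _ 2)); nra.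
have Y0 : 0 <= fine Y by apply: fine_ge0; exact: measure_ge0.
have X0 : 0 <= fine X by apply: fine_ge0; exact: measure_ge0.
move=> e0; have [e1|e1] := leP 1 e; first by nra.
have [n [K [h1 h2]]] := exists_threshold a0 ab (ltW b1) e0.
have mb : measurable (D01 `&` `]b, +oo[%classic) by exact: measurableI.
have ma : measurable (D01 `&` `]a, +oo[%classic) by exact: measurableI.
have W01 t : D01 t -> 0 <= t ^+ n <= 1.
  by move=> /=; rewrite in_itv/= => /andP[t0 t1]; rewrite exprn_ge0//= exprn_ile1.
have cW : continuous (fun t : R => 1 - bump n K 0 t).
  by move=> t; apply: cvgB; [exact: cvg_cst|exact: continuous_bump].
have bump0 t : bump n K 0 t = (1 - t ^+ n) ^+ K by rewrite /bump expr0 mul1r.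
have W0 t : D01 t -> 0 <= 1 - bump n K 0 t.
  move=> /W01/andP[t0 t1]; rewrite bump0 subr_ge0 exprn_ile1//; lra.
have iW (rho : probability R R) : (\int[rho]_(t in D01) ((1 - bump n K 0 t)%:E) =
    rho D01 - \int[rho]_(t in D01) ((bump n K 0 t)%:E))%E.
  under eq_integral do rewrite EFinB.
  rewrite integralB_EFin//.
  - by rewrite integral_cst// mul1e.
  - by apply: (bounded_integrable01 rho (g := cst 1)) => t; exact: cvg_cst.
  - by apply: (bounded_integrable01 rho); exact: continuous_bump.
have WE : (\int[mu]_(t in D01) ((1 - bump n K 0 t)%:E) =
   \int[nu]_(t in D01) ((1 - bump n K 0 t)%:E))%E.
  by rewrite !iW (bump_moments _ _ _ H) !supported_mass.
pose W (t : R) : R := 1 - bump n K 0 t.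
have mW (D : set R) : measurable_fun D (EFin \o W).
  apply/measurable_EFinP; apply: measurable_funTS; apply: continuous_measurable_fun; exact: cW.
have low : (((1 - e) * fine X)%:E <= \int[mu]_(t in D01) ((1 - bump n K 0 t)%:E))%E.
  apply: (@le_trans _ _ (\int[mu]_(t in D01 `&` `]b, +oo[%classic) ((1 - bump n K 0 t)%:E))%E); last first.
    apply: ge0_subset_integral => //; try (by exact: mW); try (by move=> t /W0; rewrite lee_fin).
  rewrite EFinM fineK// -integral_cst//; apply: ge0_le_integral => //.
  - by move=> t _; rewrite lee_fin subr_ge0 ltW.
  - move=> t [Dt /=]; rewrite in_itv/= andbT => bt; rewrite lee_fin lerD2l lerN2 bump0.
    have t01 := W01 t Dt; have /andP[t0 t1] := t01.
    have := one_minus_pow_le K t01; set q := 1 + K%:R * _ => hq.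
    have bn : b ^+ n <= t ^+ n by rewrite lerXn2r ?nnegrE//; lra.
    have hK : K%:R * b ^+ n <= K%:R * t ^+ n by rewrite ler_wpM2l.
    have q1 : e^-1 <= q by rewrite /q; lra.
    have q0 : 0 < q by rewrite (lt_le_trans _ q1)// invr_gt0.
    rewrite -(ler_pM2r q0); apply: le_trans hq _.
    by rewrite mulrC -ler_pdivrMr// mul1r.
have upp : (\int[nu]_(t in D01) ((1 - bump n K 0 t)%:E) <= (fine Y + e)%:E)%E.
  have mb' : measurable (D01 `&` `]-oo, a]%classic) by exact: measurableI.
  have E : D01 = (D01 `&` `]a, +oo[%classic) `|` (D01 `&` `]-oo, a]%classic).
    rewrite -setIUr (_ : _ `|` _ = setT) ?setIT//.
    by apply/seteqP; split => // x _ /=; rewrite !in_itv/= andbT; case: (ltP a x) => h; [left|right].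
  rewrite [X in (integral _ X _)%E]E ge0_integral_setU//; last 2 first.
  - by rewrite -E => t /W0; rewrite lee_fin.
  - apply/disj_setPS => t [[_ /=] + [_ /=]]; rewrite !in_itv/= andbT => h1' h2'; move: (lt_le_trans h1' h2'); by rewrite ltxx.
  rewrite EFinD; apply: leeD.
    rewrite fineK// -[leRHS]mul1e -integral_cst//; apply: ge0_le_integral => //.
    - by move=> t [/W0]; rewrite lee_fin.
    - move=> t [/W01 t01 _]; rewrite lee_fin gerBl bump0 exprn_ge0//; lra.
  apply: (@le_trans _ _ (\int[nu]_(t in D01 `&` `]-oo, a]%classic) (cst e%:E t))%E).
    apply: ge0_le_integral => //.
    - by move=> t [/W0]; rewrite lee_fin.
    - move=> t [Dt /=]; rewrite in_itv/= => ta; rewrite lee_fin bump0.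
      have t01 := W01 t Dt; have := one_minus_pow_ge K t01.
      have t0 : 0 <= t by move: Dt; rewrite /= in_itv/= => /andP[].
      have an : t ^+ n <= a ^+ n by rewrite lerXn2r ?nnegrE//; lra.
      have : K%:R * t ^+ n <= K%:R * a ^+ n by rewrite ler_wpM2l.
      lra.
  rewrite integral_cst// -[leRHS]mule1 lee_wpmul2l ?lee_fin ?(ltW e0)//.
  exact: probability_le1.
rewrite -lee_fin; apply: le_trans low _; rewrite WE; exact: upp.
Qed.

(** Open right half-lines generate the Borel sets and are stable under intersection. The interval
    between [a] and [b] lost in [tail_le] is recovered by continuity from below. *)
Theorem hausdorff_moment_unique (mu nu : probability R R) :
  mu (~` D01) = 0%E -> nu (~` D01) = 0%E ->
  (forall n, \int[mu]_(t in D01) ((t ^+ n)%:E) = \int[nu]_(t in D01) ((t ^+ n)%:E))%E ->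
  forall A : set R, measurable A -> mu A = nu A.
Proof.
have le (mu' nu' : probability R R) c : mu' (~` D01) = 0%E -> nu' (~` D01) = 0%E ->
  (forall n, \int[mu']_(t in D01) ((t ^+ n)%:E) = \int[nu']_(t in D01) ((t ^+ n)%:E))%E ->
  0 <= c -> (mu' `]c, +oo[%classic <= nu' `]c, +oo[%classic)%E.
  move=> mu0 nu0 H c0.
  have E : `]c, +oo[%classic = \bigcup_n `](c + n.+1%:R^-1), +oo[%classic :> set R.
    apply/seteqP; split=> x /=.
      rewrite in_itv/= andbT => cx.
      have d0 : 0 <= (x - c)^-1 by rewrite invr_ge0; lra.
      have := archi_boundP d0; set n := Num.Def.archi_bound _ => hn.
      exists n => //=; rewrite in_itv/= andbT.
      have : n.+1%:R^-1 < x - c.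
        rewrite invf_plt ?posrE// ?subr_gt0//; apply: lt_le_trans hn _.
        by rewrite ler_nat.
      by rewrite ltrBrDl.
    move=> [n _ /=]; rewrite !in_itv/= !andbT.
    by apply: le_lt_trans; rewrite lerDl invr_ge0.
  rewrite {1}E; have cv : (mu' \o (fun n => `](c + n.+1%:R^-1), +oo[%classic)) @ \oo -->
       mu' (\bigcup_n `](c + n.+1%:R^-1), +oo[%classic).
    apply: nondecreasing_cvg_mu => //; first exact: bigcupT_measurable.
    move=> n m nm; apply/subsetPset => x /=; rewrite !in_itv/= !andbT.
    have : m.+1%:R^-1 <= n.+1%:R^-1 :> R by rewrite lef_pV2 ?posrE// ler_nat.
    by move=> h; apply: le_lt_trans; rewrite lerD2l.
  rewrite -(cvg_lim _ cv)//; apply: lime_le; first by apply: cvgP cv.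
  near=> n; rewrite /=.
  have i0 : 0 < n.+1%:R^-1 :> R by rewrite invr_gt0.
  apply: (@le_trans _ _ (nu' `](c + n.+1%:R^-1 / 2), +oo[%classic)).
    apply: tail_le => //; last by rewrite ltrD2l ltr_pdivrMr// ltr_pMr// ltr1n.
    by apply: ltr_wpDl => //; rewrite divr_gt0.
  apply: le_measure; rewrite ?inE//.
  move=> x /=; rewrite !in_itv/= !andbT; apply: le_lt_trans.
  by rewrite lerDl divr_ge0// ltW.
move=> mu0 nu0 H.
apply: (measure_unique (@RGenOInfty.G R) (fun n => `](- n%:R), +oo[%classic)).
- exact: RGenOInfty.measurableE.
- move=> A1 A2 [x ->] [y ->]; exists (Num.max x y).
  by apply/seteqP; split=> z /=; rewrite !in_itv/= !andbT gt_max => /andP.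
- by move=> n; exists (- n%:R).
- apply/seteqP; split=> // x _.
  have := archi_boundP (normr_ge0 x); set n := Num.Def.archi_bound _ => hn.
  exists n => //=; rewrite in_itv/= andbT.
  by have := ler_norm (- x); rewrite normrN; lra.
- move=> _ [c ->]; have [c0|c0] := leP 0 c.
    by apply/eqP; rewrite eq_le !le//.
  have one (rho : probability R R) : rho (~` D01) = 0%E -> rho `]c, +oo[%classic = 1%E.
    move=> r0; apply/eqP; rewrite eq_le probability_le1//=.
    rewrite -(supported_mass r0); apply: le_measure; rewrite ?inE//.
    by move=> x /=; rewrite !in_itv/= andbT => /andP[x0 _]; lra.
  by transitivity (1%E : \bar R); [exact: one|exact: esym (one nu nu0)].
- by move=> n; rewrite (le_lt_trans (probability_le1 _ _))// ltry.
Unshelve. all: by end_near. Qed.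

End MomentUnicity.

(** * The density *)

Section Density.
Variable R : realType.
Local Notation leb := (@lebesgue_measure R).

Record pdfun := Pdfun {
  pdfun_fun :> R -> R;
  pdfun_ge0 : forall x, 0 <= pdfun_fun x;
  pdfun_measurable : measurable_fun setT pdfun_fun;
  pdfun_mass : (\int[leb]_x (pdfun_fun x)%:E = 1)%E }.

Definition density_prob (h : pdfun) : set R -> \bar R :=
  fun V => (\int[leb]_(x in V) (h x)%:E)%E.

Section DensityProb.
Variable h : pdfun.

Let density0 : density_prob h set0 = 0%E.
Proof. by rewrite /density_prob integral_set0. Qed.

Let density_ge0 A : (0 <= density_prob h A)%E.
Proof. by apply: integral_ge0 => x _; rewrite lee_fin pdfun_ge0. Qed.

Let density_sigma_additive : semi_sigma_additive (density_prob h).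
Proof.
move=> /= F mF tF mUF; rewrite /density_prob; apply: cvg_toP.
  apply: ereal_nondecreasing_is_cvgn => m n mn.
  apply: lee_sum_nneg_natr => // k _ _; apply: integral_ge0 => /= x Fkx.
  by rewrite lee_fin pdfun_ge0.
rewrite ge0_integral_bigcup//=.
- by apply/measurable_funTS/measurableT_comp => //; exact: pdfun_measurable.
- by move=> x _; rewrite lee_fin pdfun_ge0.
Qed.

HB.instance Definition _ := isMeasure.Build _ _ _ (density_prob h)
  density0 density_ge0 density_sigma_additive.

Let density_setT : density_prob h setT = 1%:E.
Proof. exact: pdfun_mass. Qed.

HB.instance Definition _ :=
  @Measure_isProbability.Build _ _ _ (density_prob h) density_setT.

End DensityProb.

(* Lebesgue measure lives on [measurableTypeR R], which has the Borel sets of [R]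
   but another display. *)
Definition borel_copy (nu : {finite_measure set R -> \bar R}) :
  set (measurableTypeR R) -> \bar R := nu.

Section BorelCopy.
Variable nu : {finite_measure set R -> \bar R}.

Let copy0 : borel_copy nu set0 = 0%E. Proof. exact: measure0. Qed.

Let copy_ge0 A : (0 <= borel_copy nu A)%E. Proof. exact: measure_ge0. Qed.

Let copy_sigma_additive : semi_sigma_additive (borel_copy nu).
Proof. by move=> F mF tF mUF; exact: (@measure_semi_sigma_additive _ _ _ nu). Qed.

HB.instance Definition _ := isMeasure.Build _ _ _ (borel_copy nu)
  copy0 copy_ge0 copy_sigma_additive.

Let copy_finite : fin_num_fun (borel_copy nu).
Proof. by move=> A mA; exact: (fin_num_measure nu). Qed.

HB.instance Definition _ := @Measure_isFinite.Build _ _ _ (borel_copy nu) copy_finite.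

Lemma integral_borel_copy (U : set R) (f : R -> \bar R) :
  measurable U -> measurable_fun setT f -> nu.-integrable U f ->
  (\int[nu]_(x in U) f x = \int[borel_copy nu]_(x in U) f x)%E.
Proof.
move=> mU mf fi; symmetry.
pose phi (x : R) : measurableTypeR R := x.
have mphi : measurable_fun setT phi by move=> _ A mA; rewrite setTI.
exact: (@integral_pushforward _ _ _ _ _ phi mphi nu U f mf fi mU).
Qed.

Lemma integrable_borel_copy (U : set R) (f : R -> \bar R) :
  measurable U -> measurable_fun setT f -> nu.-integrable U f ->
  (borel_copy nu).-integrable U f.
Proof.
move=> mU mf fi.
pose phi (x : R) : measurableTypeR R := x.
have mphi : measurable_fun setT phi by move=> _ A mA; rewrite setTI.
exact: (@integrable_pushforward _ _ _ _ _ phi mphi nu U f mf fi mU).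
Qed.

End BorelCopy.

(** The Radon-Nikodym derivative has the same integrals as [h] over Borel sets, hence agrees with it
    almost everywhere. *)
Lemma integral_density (nu : {finite_measure set R -> \bar R}) (h : R -> R)
    (U : set R) (f : R -> \bar R) :
  measurable_fun setT h ->
  (forall V, measurable V -> nu V = \int[leb]_(x in V) (h x)%:E)%E ->
  measurable U -> measurable_fun setT f -> nu.-integrable U f ->
  (\int[nu]_(x in U) f x = \int[leb]_(x in U) (f x * (h x)%:E))%E.
Proof.
move=> mh nuE mU mf fi.
have dom : borel_copy nu `<< leb.
  apply/null_content_dominatesP => V mV V0; rewrite /borel_copy nuE//.
  apply: null_set_integral => //; apply/measurable_EFinP; exact: measurable_funTS.
rewrite integral_borel_copy//.
rewrite -(Radon_Nikodym_change_of_variables dom)//=; last exact: integrable_borel_copy.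
apply: ae_eq_integral => //.
- apply: emeasurable_funM => //; first exact: measurable_funTS.
  apply: (measurable_int leb); apply: (integrableS _ _ (@subsetT _ _)) => //=.
  by apply: Radon_Nikodym_integrable; exact: dom.
- apply: emeasurable_funM => //=; first exact: measurable_funTS.
  by apply/measurableT_comp => //=; exact: measurable_funTS.
- apply: ae_eqe_mul2l => /=.
  rewrite Radon_NikodymE//=.
  case: cid => /= g [g1 g2 g3].
  apply: integral_ae_eq => //=.
  + exact: integrableS g2.
  + by apply/measurable_funTS/measurableT_comp.
  + by move=> E E01 mE; rewrite -g3//= -nuE.
Qed.

Lemma integral_powR (a : R) : 0 <= a ->
  (\int[leb]_(x in `]0%R, 1%R[) (x `^ a)%:E = ((a + 1)^-1)%:E)%E.
Proof.
move=> a0.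
have a1 : 0 < a + 1 by lra.
have c0 (c : R) : 0 <= c -> x `^ c @[x --> (0:R)^'+] --> 0 `^ c.
  rewrite le_eqVlt => /orP[/eqP <-|cp].
    rewrite powRr0; apply: cvg_near_cst; near=> x; by rewrite powRr0.
  by rewrite powR0 ?gt_eqF//; exact: powR_cvg0.
have cc (c x : R) : 0 < x -> {for x, continuous (fun x : R => x `^ c)}.
  move=> x0; apply: differentiable_continuous; apply/derivable1_diffP.
  by apply: derivable_powR; rewrite in_itv/= x0.
have -> : (\int[leb]_(x in `]0%R, 1%R[) (x `^ a)%:E = \int[leb]_(x in `[0%R, 1%R]) (x `^ a)%:E)%E.
  symmetry; apply: integral_itv_bndoo; apply/measurable_EFinP.
  by apply: measurable_funTS; exact: measurable_powR.
rewrite (@continuous_FTC2 _ _ (fun x => (a + 1)^-1 * x `^ (a + 1)))//.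
- by rewrite powR1 mulr1 powR0 ?gt_eqF// mulr0 sube0.
- apply/continuous_within_itvP => //; split.
  + by move=> x; rewrite in_itv/= => /andP[x0 _]; exact: cc.
  + exact: c0.
  + by apply: cvg_at_left_filter; exact: cc.
- split.
  + move=> x; rewrite in_itv/= => /andP[x0 _]; apply: derivableM; first exact: derivable_cst.
    by apply: derivable_powR; rewrite in_itv/= x0.
  + by apply: cvgM; [exact: cvg_cst|apply: c0; exact: ltW].
  + by apply: cvgM; [exact: cvg_cst|apply: cvg_at_left_filter; exact: cc].
move=> x; rewrite in_itv/= => /andP[x0 _]; rewrite derive1E deriveM; last 2 first.
  exact: derivable_cst.
  by apply: derivable_powR; rewrite in_itv/= x0.
rewrite derive_cst scaler0 addr0 -derive1E powR_derive1 ?in_itv/= ?x0//.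
by rewrite addrK scalerA mulVf ?scale1r// gt_eqF.
Unshelve. all: by end_near. Qed.

End Density.

(** * The series of powers: convergence, shape and integrals *)

Section DensitySeries.
Variable R : realType.
Local Notation leb := (@lebesgue_measure R).
Implicit Types (B : nat -> seq (R * R)) (t x v M : R).

(** Exponential decay in the exponent, weakened to the shape [1 / (1 + s)] of the weights in [wt],
    so that the density series is dominated at each fixed [t]. *)
Lemma powR_decay t : 0 < t < 1 -> exists2 K : R, 0 <= K &
  forall s : R, 0 <= s -> t `^ s <= K / (1 + s).
Proof.
move=> /andP[t0 t1]; pose c := - ln t.
have c0 : 0 < c by rewrite /c oppr_gt0 ln_lt0// t0.
exists (1 + c^-1); first by rewrite addr_ge0// invr_ge0 ltW.
move=> s s0; rewrite ler_pdivlMr; last by lra.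
rewrite /powR gt_eqF// (_ : s * ln t = - (c * s)); last by rewrite /c; ring.
have e1 : 1 + c * s <= expR (c * s) by apply: expR_ge1Dx.
rewrite expRN mulrC ler_pdivrMr ?expR_gt0//.
have i0 : 0 < c^-1 by rewrite invr_gt0.
apply: (@le_trans _ _ ((1 + c^-1) * (1 + c * s))); last by rewrite ler_wpM2l//; lra.
rewrite mulrDl mul1r mulrDr mulr1 mulKf ?gt_eqF//.
have : 0 <= c * s by rewrite mulr_ge0// ltW.
lra.
Qed.

Definition tblk B (p : nat) t : R := \sum_(b <- B p) b.2 * t `^ (- b.1).
Definition dens B t : R := limn (fun N : nat => \sum_(p < N) tblk B p t).

Lemma tblk_ge0 B M p t : pole_family B M -> 0 <= tblk B p t.
Proof.
move=> BM; rewrite /tblk big_seq; apply: sumr_ge0 => b bp.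
by have [_ b0] := BM.1 _ _ bp; rewrite mulr_ge0// powR_ge0.
Qed.

Lemma dens_cvg B M t : pole_family B M -> 0 < t < 1 ->
  (fun N : nat => \sum_(p < N) tblk B p t) @ \oo --> dens B t.
Proof.
move=> BM t01; have [K K0 HK] := powR_decay t01.
have [||s hs _] := @bounded_series_cvg R (fun p => tblk B p t) (K * M).
- by move=> p; exact: tblk_ge0 BM.
- move=> N; apply: le_trans (ler_wpM2l K0 (BM.2 N)).
  rewrite mulr_sumr; apply: ler_sum => p _.
  rewrite mulr_sumr /tblk big_seq [leRHS]big_seq; apply: ler_sum => b bp.
  have [_ b0] := BM.1 _ _ bp; have b1 := fam_le0 BM bp.
  rewrite mulrCA ler_wpM2l//; apply: HK; lra.
by rewrite /dens (cvg_lim _ hs).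
Qed.

Lemma le_dens B M x t : pole_family B M -> 0 < x -> x <= t -> t < 1 ->
  dens B x <= dens B t.
Proof.
move=> BM x0 xt t1.
have hx : 0 < x < 1 by rewrite x0 (le_lt_trans xt).
have ht : 0 < t < 1 by rewrite t1 (lt_le_trans x0).
apply: (ler_cvg_to (dens_cvg BM hx) (dens_cvg BM ht)); near=> N.
apply: ler_sum => p _; rewrite /tblk big_seq [leRHS]big_seq; apply: ler_sum => b bp.
have [_ b0] := BM.1 _ _ bp; have b1 := fam_le0 BM bp.
by rewrite ler_wpM2l// ge0_ler_powR ?nnegrE ?oppr_ge0 ?(ltW x0)// (le_trans (ltW x0)).
Unshelve. all: by end_near. Qed.

(** Powers with exponent 0 or at least 1 are convex on the positive half-line; exponents strictly in
    between would be concave. *)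
Lemma convex_tblk B M p x t (l : R) : pole_family B M ->
  (forall b, b \in B p -> b.1 = 0 \/ b.1 <= - 1) ->
  0 < x -> 0 < t -> 0 <= l <= 1 ->
  tblk B p (l * x + (1 - l) * t) <= l * tblk B p x + (1 - l) * tblk B p t.
Proof.
move=> BM Bp x0 t0 /andP[l0 l1].
rewrite /tblk !mulr_sumr -big_split/= big_seq [leRHS]big_seq; apply: ler_sum => b bp.
have [_ b0] := BM.1 _ _ bp.
rewrite !(mulrCA _ b.2) -mulrDr ler_wpM2l//.
have [->|b1] := Bp _ bp; first by rewrite oppr0 !powRr0; lra.
have p1 : 1 <= - b.1 by lra.
have := @convex_powR R (- b.1) p1 (Itv01 l0 l1) x t.
rewrite !inE/= !in_itv/= !andbT !convRE/=; apply; exact: ltW.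
Qed.

Lemma conv_gt0 (a b l : R) : 0 < a -> 0 < b -> 0 <= l <= 1 -> 0 < l * a + (1 - l) * b.
Proof.
move=> a0 b0 /andP[l0 l1]; have [->|ln] := eqVneq l 1; first by lra.
have h1 : 0 <= l * a by rewrite mulr_ge0// ltW.
have h2 : 0 < (1 - l) * b by rewrite mulr_gt0// subr_gt0 lt_neqAle ln.
lra.
Qed.

Lemma convex_dens B M x t (l : R) : pole_family B M ->
  (forall p b, b \in B p -> b.1 = 0 \/ b.1 <= - 1) ->
  0 < x < 1 -> 0 < t < 1 -> 0 <= l <= 1 ->
  dens B (l * x + (1 - l) * t) <= l * dens B x + (1 - l) * dens B t.
Proof.
move=> BM Bp x01 t01 l01.
have m01 : 0 < l * x + (1 - l) * t < 1.
  move: x01 t01 => /andP[x0 x1] /andP[t0 t1].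
  apply/andP; split; first exact: conv_gt0.
  rewrite -subr_gt0 (_ : _ - _ = l * (1 - x) + (1 - l) * (1 - t)); last by ring.
  by apply: conv_gt0; rewrite ?subr_gt0.
have hx := dens_cvg BM x01; have ht := dens_cvg BM t01.
have hm := dens_cvg BM m01.
have hr : (fun N : nat => l * (\sum_(p < N) tblk B p x) + (1 - l) * (\sum_(p < N) tblk B p t))
    @ \oo --> l * dens B x + (1 - l) * dens B t.
  apply: cvgD; apply: cvgM; [exact: cvg_cst|exact: hx|exact: cvg_cst|exact: ht].
apply: (ler_cvg_to hm hr); near=> N.
rewrite /= !mulr_sumr -big_split/=; apply: ler_sum => p _.
move: x01 t01 => /andP[x0 x1] /andP[t0 t1].
exact: convex_tblk BM (Bp p) x0 t0 l01.
Unshelve. all: by end_near. Qed.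

Lemma measurable_dens B M : pole_family B M ->
  measurable_fun (`]0, 1[%classic : set R) (dens B).
Proof.
move=> BM; apply: (@measurable_fun_cvg _ _ _ _ (fun N t => \sum_(p < N) tblk B p t)).
  move=> N; apply: measurable_sum => p; apply: measurable_sum => b.
  apply: measurable_funM; first exact: measurable_cst.
  apply: measurable_funTS; exact: measurable_powR.
by move=> t /=; rewrite in_itv/= => t01; exact: dens_cvg BM t01.
Qed.

Lemma integral_tblk x (s : seq (R * R)) : 0 <= x ->
  (forall b, b \in s -> b.1 <= 0 /\ 0 <= b.2) ->
  (\int[leb]_(t in `]0%R, 1%R[) (t `^ x * \sum_(b <- s) b.2 * t `^ (- b.1))%:E =
   (\sum_(b <- s) b.2 / (x + 1 - b.1))%:E)%E.
Proof.
move=> x0; elim: s => [|b s IH] Hs.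
  rewrite big_nil; under eq_integral do rewrite big_nil mulr0.
  by rewrite integral0.
have [b1 b2] := Hs b (mem_head _ _).
have Hs' c : c \in s -> c.1 <= 0 /\ 0 <= c.2 by move=> cs; apply: Hs; rewrite inE cs orbT.
rewrite big_cons EFinD -(IH Hs').
transitivity (\int[leb]_(t in `]0%R, 1%R[) ((b.2 * t `^ (x - b.1))%:E +
  (t `^ x * \sum_(b <- s) b.2 * t `^ (- b.1))%:E))%E.
  apply: eq_integral => t /[!inE]/=; rewrite in_itv/= => /andP[t0 _].
  rewrite big_cons -EFinD; congr (_%:E); rewrite mulrDr mulrCA -powRD//.
  by apply/implyP => _; exact: lt0r_neq0.
have m1 c : measurable_fun (`]0, 1[%classic : set R) (fun t : R => t `^ c).
  by apply: measurable_funTS; exact: measurable_powR.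
have ge0 t : 0 <= t `^ x * \sum_(b <- s) b.2 * t `^ (- b.1).
  rewrite mulr_ge0 ?powR_ge0// big_seq sumr_ge0// => c /Hs'[_ c0].
  by rewrite mulr_ge0 ?powR_ge0.
rewrite ge0_integralD//; last 4 first.
- by move=> t _; rewrite lee_fin mulr_ge0 ?powR_ge0.
- apply/measurable_EFinP; apply: measurable_funM; [exact: measurable_cst|exact: m1].
- by move=> t _; rewrite lee_fin.
- apply/measurable_EFinP; apply: measurable_funM; first exact: m1.
  by apply: measurable_sum => c; apply: measurable_funM; [exact: measurable_cst|exact: m1].
congr (_ + _)%E; under eq_integral do rewrite EFinM.
rewrite ge0_integralZl_EFin//; last 2 first.
- by move=> t _; rewrite lee_fin powR_ge0.
- by apply/measurable_EFinP; exact: m1.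
rewrite integral_powR; last by lra.
by rewrite -EFinM; congr (_ / _)%:E; ring.
Qed.

Lemma integral_dens B M x v : pole_family B M -> 0 <= x ->
  (fun N : nat => \sum_(p < N) rblk B p (x + 1)) @ \oo --> v ->
  (\int[leb]_(t in `]0%R, 1%R[) (t `^ x * dens B t)%:E = v%:E)%E.
Proof.
move=> BM x0 Hv.
have ge0 p t : 0 <= t `^ x * tblk B p t.
  by rewrite mulr_ge0 ?powR_ge0//; exact: tblk_ge0 BM.
transitivity (\int[leb]_(t in `]0%R, 1%R[) (\sum_(p <oo) (t `^ x * tblk B p t)%:E))%E.
  apply: eq_integral => t /[!inE]/=; rewrite in_itv/= => t01.
  apply/esym/cvg_lim => //.
  rewrite (_ : (fun N => _) = EFin \o (fun N => t `^ x * \sum_(p < N) tblk B p t)).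
    by apply: cvg_EFin; [exact: nearW|apply: cvgM; [exact: cvg_cst|exact: dens_cvg BM t01]].
  by apply/funext => N /=; rewrite mulr_sumr big_mkord sumEFin.
rewrite integral_nneseries//; last 2 first.
- move=> p; apply/measurable_EFinP; apply: measurable_funM.
    by apply: measurable_funTS; exact: measurable_powR.
  apply: measurable_sum => b; apply: measurable_funM; first exact: measurable_cst.
  by apply: measurable_funTS; exact: measurable_powR.
- by move=> p t _; rewrite lee_fin.
apply/cvg_lim => //.
rewrite (_ : (fun N => _) = EFin \o (fun N => \sum_(p < N) rblk B p (x + 1))).
  by apply: cvg_EFin; [exact: nearW|exact: Hv].
apply/funext => N /=; rewrite big_mkord -sumEFin; apply: eq_bigr => p _.
apply: integral_tblk => // b bp; split; first exact: fam_le0 BM bp.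
by have [] := BM.1 _ _ bp.
Qed.

End DensitySeries.

(** * The integral of the kernel of [f] at real arguments *)

Section KernelIntegrals.
Variable R : realType.
Local Notation D01 := (`[0, 1]%classic : set R).
Implicit Types (mu : probability R R) (g h : R -> R) (t x : R).

Lemma mu_integrable01 mu g (M : R) : measurable_fun setT g ->
  (forall t, 0 <= t <= 1 -> `|g t| <= M) -> mu.-integrable D01 (EFin \o g).
Proof.
move=> mg gM; apply: measurable_bounded_integrable => //.
- by rewrite (le_lt_trans (probability_le1 _ _))// ltry.
- exact: measurable_funTS.
exists M; split; first exact: num_real.
by move=> y My t /=; rewrite in_itv/= => t01; rewrite (le_trans (gM t t01))// ltW.
Qed.

Lemma powR01 t x : 0 <= t <= 1 -> 0 <= x -> 0 <= t `^ x <= 1.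
Proof.
move=> /andP[t0 t1] x0; rewrite powR_ge0/=.
have e : 1 `^ x = 1 :> R by rewrite powR1.
by rewrite -[leRHS]e ge0_ler_powR ?nnegrE.
Qed.

(** A real form of [fker]. The inverse is written as a power to make measurability immediate, and
    the indicator supplies the value at [t = 1], where the first summand vanishes. *)
Definition kern x t : R := (1 - t `^ x) * (1 - t) `^ (- 1) + x * \1_[set 1] t.

Lemma kern1 x : kern x 1 = x.
Proof. by rewrite /kern powR1 subrr mul0r add0r indicE mem_set// mulr1. Qed.

Lemma kernE x t : 0 <= t <= 1 -> t != 1 -> kern x t = (1 - t `^ x) / (1 - t).
Proof.
move=> /andP[t0 t1] tn; rewrite /kern powR_inv1 ?subr_ge0// indicE memNset ?mulr0 ?addr0//.
exact/eqP.
Qed.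

Lemma kern_mul x t : 0 <= t <= 1 -> (1 - t) * kern x t = 1 - t `^ x.
Proof.
move=> t01; have [->|tn] := eqVneq t 1; first by rewrite subrr mul0r powR1 subrr.
by rewrite kernE// mulrCA divff ?mulr1// subr_eq0 eq_sym.
Qed.

Lemma kern_step x t l : 0 <= t <= 1 ->
  t ^+ l * kern x t = (t ^+ l - t ^+ l * t `^ x) + t ^+ l.+1 * kern x t.
Proof.
move=> t01; have := kern_mul x t01.
rewrite -{2}[t ^+ l]mulr1 -mulrBr => <-; rewrite exprSr; ring.
Qed.

Lemma measurable_kern x : measurable_fun setT (kern x).
Proof.
apply: measurable_funD.
  apply: measurable_funM.
    by apply: measurable_funB; [exact: measurable_cst|exact: measurable_powR].
  apply: (@measurableT_comp _ _ _ _ _ _ (fun s : R => s `^ (- 1))).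
    exact: measurable_powR.
  by apply: measurable_funB; [exact: measurable_cst|exact: measurable_id].
apply: measurable_funM; first exact: measurable_cst.
exact: measurable_indic.
Qed.

(** For an integer [n >= x], Bernoulli's inequality gives [1 - t^x <= 1 - t^n <= n * (1 - t)]. *)
Lemma kern_bound x : 0 < x -> exists n : nat, forall t, 0 <= t <= 1 -> 0 <= kern x t <= n%:R.
Proof.
move=> x0; exists (Num.Def.archi_bound x) => t t01.
have := archi_boundP (ltW x0); set n := Num.Def.archi_bound x => hn.
have [->|tn] := eqVneq t 1; first by rewrite kern1 !ltW.
have /andP[t0 t1] := t01.
have d0 : 0 < 1 - t by rewrite subr_gt0 lt_neqAle tn.
have /andP[p0 p1] := powR01 t01 (ltW x0).
rewrite kernE// divr_ge0 ?subr_ge0//= ler_pdivrMr//.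
have h : t ^+ n <= t `^ x.
  have [t00|tp] := eqVneq t 0.
    rewrite t00 expr0n powR0 ?gt_eqF//; case: n hn => //= hn; move: (lt_trans x0 hn).
  rewrite -powR_mulrn// ger_powR//; last exact: ltW.
  by rewrite t1 lt_def tp t0.
have t01' : 0 <= 1 - t <= 1 by apply/andP; split; lra.
have := one_minus_pow_ge n t01'; rewrite subKr; lra.
Qed.

Lemma exprn01 l t : 0 <= t <= 1 -> 0 <= t ^+ l <= 1.
Proof. by move=> /andP[t0 t1]; rewrite exprn_ge0//= exprn_ile1. Qed.

Lemma measurable_exprn l : measurable_fun setT (fun t : R => t ^+ l).
Proof. by apply: continuous_measurable_fun; exact: exprn_continuous. Qed.

Lemma integrable_exprn01 mu l : mu.-integrable D01 (EFin \o (fun t : R => t ^+ l)).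
Proof.
apply: (@mu_integrable01 _ _ 1); first exact: measurable_exprn.
by move=> t /(exprn01 l)/andP[h1 h2]; rewrite ger0_norm.
Qed.

Lemma integrable_kern mu x l : 0 < x ->
  mu.-integrable D01 (EFin \o (fun t : R => t ^+ l * kern x t)).
Proof.
move=> x0; have [n Hn] := kern_bound x0; apply: (@mu_integrable01 _ _ n%:R).
  by apply: measurable_funM; [exact: measurable_exprn|exact: measurable_kern].
move=> t t01; have /andP[h1 h2] := exprn01 l t01; have /andP[h3 h4] := Hn t t01.
by rewrite ger0_norm ?mulr_ge0// -[leRHS]mul1r ler_pM.
Qed.

Variables (mu : probability R R) (u v : nat -> R) (x : R).
Hypothesis x0 : 0 < x.
Hypothesis mu_pow : forall l, (\int[mu]_(t in D01) (t ^+ l)%:E = (u l)%:E)%E.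
Hypothesis mu_powx : forall l, (\int[mu]_(t in D01) (t ^+ l * t `^ x)%:E = (v l)%:E)%E.

(** The geometric expansion of [1 / (1 - t)], stopped after [L] terms with its exact remainder. *)
Lemma integral_kern_step L : Rintegral mu D01 (kern x) =
  \sum_(l < L) (u l - v l) + Rintegral mu D01 (fun t => t ^+ L * kern x t).
Proof.
have mp := measurable_exprn; have ip := integrable_exprn01 mu.
have ik l := integrable_kern mu l x0.
have ipx l : mu.-integrable D01 (EFin \o (fun t : R => t ^+ l * t `^ x)).
  apply: (@mu_integrable01 _ _ 1).
    by apply: measurable_funM => //; exact: measurable_powR.
  move=> t t01; have /andP[h1 h2] := exprn01 l t01.
  have /andP[h3 h4] := powR01 t01 (ltW x0).
  by rewrite ger0_norm ?mulr_ge0// mulr_ile1.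
elim: L => [|L IH].
  by rewrite big_ord0 add0r; apply: eq_Rintegral => t _; rewrite expr0 mul1r.
rewrite IH big_ord_recr/= -addrA; congr (_ + _).
transitivity (Rintegral mu D01 (fun t => (t ^+ L - t ^+ L * t `^ x) + t ^+ L.+1 * kern x t)).
  by apply: eq_Rintegral => t /[!inE]/=; rewrite in_itv/= => t01; exact: kern_step.
rewrite RintegralD//; last first.
  apply: (@mu_integrable01 _ _ 2).
    apply: measurable_funB => //; apply: measurable_funM => //; exact: measurable_powR.
  move=> t t01; have /andP[h1 h2] := exprn01 L t01; have /andP[h3 h4] := powR01 t01 (ltW x0).
  by rewrite (le_trans (ler_normB _ _))// normrM !ger0_norm// -[2]/(1 + 1) lerD// mulr_ile1.
congr (_ + _); rewrite RintegralB//.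
by rewrite /Rintegral mu_pow mu_powx.
Qed.

(** The remainder is at most [n * u L], where [n] bounds the kernel. *)
Lemma integral_kern y : u @ \oo --> 0 ->
  (fun L : nat => \sum_(l < L) (u l - v l)) @ \oo --> y ->
  Rintegral mu D01 (kern x) = y.
Proof.
move=> u0 hy; have [n Hn] := kern_bound x0.
have mp := measurable_exprn; have ip := integrable_exprn01 mu.
have ik l := integrable_kern mu l x0.
pose E L := Rintegral mu D01 (fun t => t ^+ L * kern x t).
have E0 L : 0 <= E L.
  apply: Rintegral_ge0 => t /=; rewrite in_itv/= => t01.
  by have /andP[h1 _] := exprn01 L t01; have /andP[h3 _] := Hn t t01; rewrite mulr_ge0.
have Eu L : E L <= n%:R * u L.
  have -> : n%:R * u L = Rintegral mu D01 (fun t => n%:R * t ^+ L).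
    by rewrite RintegralZl// /Rintegral mu_pow.
  apply: le_Rintegral => //.
    apply: (@mu_integrable01 _ _ n%:R); first by apply: measurable_funM => //; exact: measurable_cst.
    move=> t t01; have /andP[h1 h2] := exprn01 L t01.
    by rewrite ger0_norm ?mulr_ge0// -[leRHS]mulr1 ler_wpM2l.
  move=> t /=; rewrite in_itv/= => t01.
  have /andP[h1 _] := exprn01 L t01; have /andP[_ h3] := Hn t t01.
  by rewrite mulrC ler_wpM2r.
have cE : E @ \oo --> 0.
  apply: (@squeeze_cvgr _ _ _ _ (cst 0) (fun L => n%:R * u L)).
  - by apply: nearW => L; rewrite E0 Eu.
  - exact: cvg_cst.
  - by rewrite -(mulr0 n%:R); apply: cvgM; [exact: cvg_cst|exact: u0].
have h : (fun L : nat => \sum_(l < L) (u l - v l) + E L) @ \oo --> y.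
  by rewrite -[y]addr0; apply: cvgD; [exact: hy|exact: cE].
rewrite (_ : (fun L => _) = cst (Rintegral mu D01 (kern x))) in h.
  by apply: (cvg_unique _ _ h) => //; exact: cvg_cst.
by apply/funext => L; rewrite /= -integral_kern_step.
Qed.

End KernelIntegrals.

Section ComplexKernels.
Variable R : realType.
Local Notation D01 := (`[0, 1]%classic : set R).
Implicit Types (mu : probability R R) (t x : R).

Lemma cpow_real t x : 0 <= t -> 0 < x -> cpow t x%:C = (t `^ x)%:C.
Proof.
rewrite /cpow le_eqVlt => /orP[/eqP <-|t0] x0; first by rewrite ltxx powR0 ?gt_eqF.
by rewrite t0 /= mul0r cos0 sin0 mulr1 mulr0 /powR gt_eqF.
Qed.

Lemma fker_real t x : 0 <= t <= 1 -> 0 < x -> fker x%:C t = (kern x t)%:C.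
Proof.
move=> t01 x0; rewrite /fker; have [->|tn] := eqVneq t 1; first by rewrite kern1.
have /andP[t0 t1] := t01.
by rewrite cpow_real// kernE// rmorphM fmorphV !rmorphB.
Qed.

Lemma cintegral_real mu (g : R -> R[i]) (h : R -> R) :
  (forall t, 0 <= t <= 1 -> g t = (h t)%:C) ->
  cintegral mu g = (Rintegral mu D01 h)%:C.
Proof.
move=> gh; rewrite /cintegral; congr (_ +i* _).
  by apply: eq_Rintegral => t /[!inE]/=; rewrite in_itv/= => /gh ->.
transitivity (Rintegral mu D01 (cst 0)); last by rewrite Rintegral_cst// mul0r.
by apply: eq_Rintegral => t /[!inE]/=; rewrite in_itv/= => /gh ->.
Qed.

Lemma F_int_real mu x : 0 < x ->
  F_int mu x%:C = (Rintegral mu D01 (fun t => t `^ x))%:C.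
Proof.
by move=> x0; apply: cintegral_real => t /andP[t0 _]; exact: cpow_real.
Qed.

Lemma f_int_real mu x : 0 < x ->
  f_int mu x%:C = (Rintegral mu D01 (kern x))%:C.
Proof. by move=> x0; apply: cintegral_real => t t01; exact: fker_real. Qed.

End ComplexKernels.

(** * The measure [mu] and its transforms at the points [A X] *)

Section MomentMeasure.
Variable R : realType.
Local Notation B := (@B R).
Local Notation leb := (@lebesgue_measure R).
Local Notation D01 := (`[0, 1]%classic : set R).

(** The recursion says that the sums [s] satisfy [s n.+1 - 1 / s n.+1 = s n], the equation solved by
    [phi]; the start [s 0 = 1 = S_ 1] explains the shift of index. *)
Lemma moments_S (m : nat -> R) : m 0%N = 1 -> (forall n, 0 < m n) ->
  (forall n, (1 <= n)%N -> (1 + \sum_(1 <= i < n.+1) m i) * m n = 1) ->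
  forall n, m n = (S_ R n.+1)^-1.
Proof.
move=> m0 mp mr.
pose s n := 1 + \sum_(1 <= i < n.+1) m i.
have s0 n : 0 < s n.
  by rewrite /s ltr_pwDl// sumr_ge0// => i _; exact: ltW.
have mE n : m n.+1 = (s n.+1)^-1.
  by apply: (mulfI (lt0r_neq0 (s0 n.+1))); rewrite mulfV ?lt0r_neq0// mr.
have sE n : s n = S_ R n.+1.
  elim: n => [|n IH]; first by rewrite /s big_geq// S_1 addr0.
  rewrite [RHS]/S_ itS; apply: phi_unique => //.
  by rewrite -mE -/(S_ R n.+1) -IH /s [in LHS]big_nat_recr//=; ring.
by case=> [|n]; rewrite ?m0 ?S_1 ?invr1// mE sE.
Qed.

Lemma rblk_cvg_nat l : (fun N : nat => \sum_(p < N) rblk B p (l%:R + 1)) @ \oo --> (S_ R l.+1)^-1.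
Proof. by rewrite natr1 -A_S; apply: rblk_B_cvg; exact: S_gt0. Qed.

(** Cut off outside []0, 1[], where the limit in [dens] is not controlled. *)
Definition density : R -> R := dens B \_ `]0, 1[.

Lemma density_ge0 t : 0 <= density t.
Proof.
rewrite /density patchE; case: ifPn => // /[!inE]/=; rewrite in_itv/= => t01.
apply: limr_ge; first by apply: cvgP; exact: dens_cvg (B_family R) t01.
by near=> N; apply: sumr_ge0 => p _; exact: tblk_ge0 (B_family R).
Unshelve. all: by end_near. Qed.

Lemma measurable_density : measurable_fun setT density.
Proof.
apply/measurable_restrict => //; rewrite setTI.
exact: measurable_dens (B_family R).
Qed.

Lemma integral_density_mkcond (g : R -> R) (V : set R) :
  (\int[leb]_(t in V) ((g t)%:E * (density t)%:E) =
   \int[leb]_(t in V `&` `]0%R, 1%R[) (g t * dens B t)%:E)%E.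
Proof.
rewrite [RHS]integral_mkcondr; apply: eq_integral => t _.
by rewrite /density !patchE; case: ifPn => // _; rewrite mule0.
Qed.

Lemma density_mass : (\int[leb]_t (density t)%:E = 1)%E.
Proof.
transitivity (\int[leb]_t ((1 : R)%:E * (density t)%:E))%E.
  by apply: eq_integral => t _; rewrite mul1e.
rewrite (integral_density_mkcond (fun=> 1)) setTI.
have h := @rblk_cvg_nat 0%N; rewrite S_1 invr1 in h.
rewrite -(integral_dens (B_family R) (lexx 0) h).
by apply: eq_integral => t _; rewrite powRr0.
Qed.

Definition density_pdf := Pdfun density_ge0 measurable_density density_mass.

Lemma integral_powR_density (nu : probability R R) (x v : R) :
  (forall V, measurable V -> nu V = \int[leb]_(t in V) (density t)%:E)%E ->
  0 <= x -> (fun N : nat => \sum_(p < N) rblk B p (x + 1)) @ \oo --> v ->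
  (\int[nu]_(t in D01) (t `^ x)%:E = v%:E)%E.
Proof.
move=> nuE x0 hv.
rewrite (@integral_density _ nu density D01 (fun t => (t `^ x)%:E))//.
- rewrite (integral_density_mkcond (fun t => t `^ x)) (_ : _ `&` _ = `]0, 1[%classic).
    exact: integral_dens (B_family R) x0 hv.
  apply/seteqP; split => t /=; first by case.
  by rewrite !in_itv/= => /andP[t0 t1]; rewrite t0 t1 !ltW.
- exact: measurable_density.
- by apply/measurable_EFinP; exact: measurable_powR.
- apply: (@mu_integrable01 _ _ _ 1); first exact: measurable_powR.
  by move=> t t01; have /andP[h1 h2] := powR01 t01 x0; rewrite ger0_norm.
Qed.

Lemma exprn_powR01 (nu : probability R R) n :
  (\int[nu]_(t in D01) (t ^+ n)%:E = \int[nu]_(t in D01) (t `^ n%:R)%:E)%E.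
Proof.
by apply: eq_integral => t /[!inE]/=; rewrite in_itv/= => /andP[t0 _]; rewrite powR_mulrn.
Qed.

Section Mu.
Variable mu : probability R R.
Hypothesis mu_supp : mu (~` D01) = 0%E.
Hypothesis mu_mom : forall n, (\int[mu]_(t in D01) (t ^+ n)%:E = ((S_ R n.+1)^-1)%:E)%E.

Lemma mu_density V : measurable V -> (mu V = \int[leb]_(t in V) (density t)%:E)%E.
Proof.
pose nu : probability R R := density_prob density_pdf.
have nuE W : measurable W -> (nu W = \int[leb]_(t in W) (density t)%:E)%E by [].
move=> mV; rewrite -nuE//; apply: hausdorff_moment_unique => //.
  rewrite nuE; last exact: measurableC.
  apply: integral0_eq => t /=; rewrite in_itv/= => /negP t01.
  rewrite /density patchE; case: ifPn => // /[!inE]/=; rewrite in_itv/= => /andP[t0 t1].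
  by move: t01; rewrite !ltW.
move=> n; rewrite mu_mom exprn_powR01; symmetry.
exact: integral_powR_density nuE (ler0n _ n) (@rblk_cvg_nat n).
Qed.

(** The exponent plus 1 is [A X + l + 1 = A (it l.+1 X)], a point where the pole series is known. At
    [t = 0] both powers vanish because [A X > 0]. *)
Lemma mu_powR X l : 0 < X ->
  (\int[mu]_(t in D01) (t ^+ l * t `^ (A X))%:E = ((it l.+1 X)^-1)%:E)%E.
Proof.
move=> X0; have AX0 := A_gt0 X0.
transitivity (\int[mu]_(t in D01) (t `^ (A X + l%:R))%:E)%E.
  apply: eq_integral => t /[!inE]/=; rewrite in_itv/= => /andP[t0 _]; congr (_%:E).
  have [->|tn] := eqVneq t 0.
    by rewrite (@powR0 _ (A X)) ?mulr0 ?powR0// gt_eqF// ltr_wpDr.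
  by rewrite powRD ?tn ?implybT// powR_mulrn// mulrC.
apply: (integral_powR_density mu_density); first by rewrite addr_ge0// ltW.
rewrite -addrA natr1 -A_it ?ltW//; apply: rblk_B_cvg; exact: it_gt0.
Qed.

Lemma F_int_A X : 0 < X -> F_int mu (A X)%:C = ((phi X)^-1)%:C.
Proof.
move=> X0; rewrite F_int_real ?A_gt0//; congr (_%:C).
transitivity (Rintegral mu D01 (fun t => t ^+ 0 * t `^ (A X))).
  by apply: eq_Rintegral => t _; rewrite expr0 mul1r.
by rewrite /Rintegral mu_powR.
Qed.

(** For these moments the series of [integral_kern] telescopes to [X - (it L X - S_ L)], and for
    [L >= 1] the difference in parentheses is at most [A X / S_ L]. *)
Lemma f_int_A X : 0 < X -> f_int mu (A X)%:C = X%:C.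
Proof.
move=> X0; rewrite f_int_real ?A_gt0//; congr (_%:C).
apply: (integral_kern (A_gt0 X0) mu_mom (fun l => mu_powR l X0)).
  have := @it_inv_cvg0 R 1 ler01; rewrite (_ : (fun n => _) = fun n => (S_ R n.+1)^-1)//.
  by apply/funext => n; rewrite -S_1 it_S addn1.
have E (L : nat) : \sum_(l < L) ((S_ R l.+1)^-1 - (it l.+1 X)^-1) = X - (it L X - S_ R L).
  elim: L => [|L IH]; first by rewrite big_ord0 S_0 /= subr0 subrr.
  rewrite big_ord_recr/= IH -S_rec.
  have : (it L.+1 X)^-1 = it L.+1 X - it L X by rewrite itS -{3}[it L X]phiV; lra.
  by move=> /= ->; lra.
rewrite (_ : (fun L => _) = fun L => X - (it L X - S_ R L)); last exact/funext.
rewrite -[X in _ --> X]subr0; apply: cvgB; first exact: cvg_cst.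
rewrite -(cvg_shiftS (fun L => it L X - S_ R L)).
have h1 : (fun n => (S_ R n.+1)^-1) @ \oo --> (0 : R).
  have := @it_inv_cvg0 R 1 ler01; rewrite (_ : (fun n => _) = fun n => (S_ R n.+1)^-1)//.
  by apply/funext => n; rewrite -S_1 it_S addn1.
apply: (@squeeze_cvgr _ _ _ _ (cst 0) (fun n => A X * (S_ R n.+1)^-1)).
- apply: nearW => n; have s0 := S_gt0 R n; rewrite subr_ge0 S_le_it ?(ltW X0)//=.
  rewrite ler_pdivlMr// mulrC.
  have := gap_le_A n.+1 (lexx 0) (ltW X0); rewrite A_0 subr0 /gap.
  exact.
- exact: cvg_cst.
- by rewrite -(mulr0 (A X)); apply: cvgM; [exact: cvg_cst|exact: h1].
Qed.

End Mu.
End MomentMeasure.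

(** * Zeros and poles *)

Section PuncturedNeighbourhoods.
Variable R : realType.
Local Notation C := R[i].
Local Notation Co := (R[i])^o.
Implicit Types (f g h : Co -> Co) (z w a c : Co) (S T : set Co).

Lemma discrete_near S z : discrete_set S -> \forall w \near z^', ~ S w.
Proof.
move=> dS; have [r r0 Hr] := dS z; apply/dnbhsC; exists (r / 2).
  by rewrite divr_gt0.
by move=> w wz wr; apply: Hr => //; lra.
Qed.

Lemma discrete_setU S T : discrete_set S -> discrete_set T ->
  discrete_set (fun z => S z \/ T z).
Proof.
move=> dS dT z; have [r r0 Hr] := dS z; have [s s0 Hs] := dT z.
exists (Num.min r s); first by rewrite lt_min r0.
by move=> w; rewrite lt_min => /andP[wr ws] wz [/(Hr w wr wz)|/(Hs w ws wz)].
Qed.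

Lemma discrete_set_shift S a : discrete_set S -> discrete_set (fun z => S (z + a)).
Proof.
move=> dS z; have [r r0 Hr] := dS (z + a); exists r => // w wr wz; apply: Hr.
  by rewrite opprD addrACA subrr addr0.
by rewrite (inj_eq (addIr a)).
Qed.

Lemma dnbhs_shift (Q : set Co) z a :
  (\forall w \near (z + a)^', Q w) -> \forall w \near z^', Q (w + a).
Proof.
move=> /dnbhsC[r r0 Hr]; apply/dnbhsC; exists r => // w wz wr; apply: Hr.
  by rewrite (inj_eq (addIr a)).
by rewrite opprD addrACA subrr addr0.
Qed.

Lemma dnbhs_neq z : \forall w \near z^', w != z.
Proof. by apply/dnbhsC; exists 1. Qed.

Lemma ccont_near g z (e : R) : ccont_at g z -> 0 < e ->
  \forall w \near z^', cm (g w - g z) <= e.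
Proof. by move=> cg e0; have [r r0 Hr] := cg e e0; apply/dnbhsC; exists r => // w _; exact: Hr. Qed.

Lemma ccont_unique g h z : ccont_at g z -> ccont_at h z ->
  (\forall w \near z^', g w = h w) -> g z = h z.
Proof.
move=> cg ch gh; apply/eqP; rewrite -subr_eq0 -cm_eq0; apply: contraT => n0.
have e0 : 0 < cm (g z - h z) / 4 by rewrite divr_gt0// lt_def n0 cm_ge0.
have [w [H1 [H2 H3]]] := filter_ex (filterI (ccont_near cg e0) (filterI (ccont_near ch e0) gh)).
have : cm (g z - h z) <= cm (g z - g w) + cm (h w - h z).
  by rewrite -[X in cm X](subrKA (g w)) {2}H3; exact: cmD.
rewrite (cm_distC (g z) (g w)) => H.
have p0 : 0 < cm (g z - h z) by rewrite lt_def n0 cm_ge0.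
lra.
Qed.

(** Both sides are multiplied by [w - z] and compared at [z] by continuity. *)
Lemma polar_part_eq0 g h z c : holo g z -> holo h z ->
  (\forall w \near z^', g w = h w + c / (w - z)) -> c = 0.
Proof.
move=> dg dh gh.
have cg := holo_ccont (holoM (holo_subC z z) dg).
have ch := holo_ccont (holoD (holoM (holo_subC z z) dh) (holo_cst c z)).
have := ccont_unique cg ch; rewrite subrr !mul0r add0r => <- //.
apply: filterS2 gh (dnbhs_neq z) => w -> wz; rewrite mulrDr; congr (_ + _).
by rewrite mulrCA divff ?mulr1// subr_eq0.
Qed.

Lemma is_poleP g z : is_pole g z <->
  forall M : R, \forall w \near z^', M <= cm (g w).
Proof.
split=> H M; have := H M; apply: filterS => w; by rewrite cmE lecR.
Qed.

Lemma regular_not_pole g h z : holo h z -> (\forall w \near z^', g w = h w) ->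
  ~ is_pole g z.
Proof.
move=> dh gh /is_poleP/(_ (cm (h z) + 2)) H.
have [w [H1 [H2 H3]]] := filter_ex (filterI (ccont_near (holo_ccont dh) ltr01) (filterI H gh)).
have := cmD (h w - h z) (h z); rewrite subrK; rewrite H3 in H2; lra.
Qed.

Lemma ccont_eq_near g h z : ccont_at g z -> ccont_at h z ->
  (\forall w \near z^', g w = h w) ->
  exists2 r : R, 0 < r & forall w, cm (w - z) <= r -> g w = h w.
Proof.
move=> cg ch gh; have e := ccont_unique cg ch gh.
have /dnbhsC[r r0 Hr] := gh; exists r => // w wr.
by have [->//|wz] := eqVneq w z; exact: Hr.
Qed.

Lemma pole_sum_polar (B : nat -> seq (R * R)) M z : pole_family B M ->
  \forall w \near z^', pole_sum B w =
    pole_sum (drop_pole B z) w + (residue B z)%:C / (w - z).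
Proof.
move=> BM; apply: filterS (discrete_near z (discrete_poles BM)) => w.
by move=> wB; exact: (pole_sum_drop z BM wB).
Qed.

Lemma holo_drop_pole (B : nat -> seq (R * R)) M z : pole_family B M ->
  holo (pole_sum (drop_pole B z)) z.
Proof.
move=> BM; apply: (pole_sum_holo (drop_pole_family z BM)); exact: drop_poleN.
Qed.

Lemma locally_finite_discrete S : locally_finite_set S -> discrete_set S.
Proof.
move=> H z; have [r r0 Hr] := H z; exists r => // w wr wz Sw.
by move: wz; rewrite (Hr w Sw) ?eqxx// cmE ltcR.
Qed.

End PuncturedNeighbourhoods.

(** * Transfer of the singularities of [P] to [F] and [f] *)

Section ZerosPoles.
Variable R : realType.
Local Notation C := R[i].
Local Notation Co := (R[i])^o.
Local Notation B := (@B R).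
Local Notation Q := (pole_of B).
Implicit Types (z w : Co).

Let BM := B_family R.

Lemma P_holo z : ~ Q z -> holo (@P R) z.
Proof. exact: pole_sum_holo BM. Qed.

Lemma Q_discrete : discrete_set (Q : set Co).
Proof. exact: discrete_poles BM. Qed.

Lemma Q_Re z : 0 < complex.Re z -> ~ Q z.
Proof. exact: not_pole_Re BM. Qed.

Section MeromorphicF.
Variables (F : Co -> Co) (PF : set Co).
Hypothesis dPF : discrete_set PF.
Hypothesis hF : forall z, ~ PF z -> holo F z.
Hypothesis FA : forall X : R, 0 < X -> F (A X)%:C = ((phi X)^-1)%:C.

Lemma F_eq_P z : ~ PF z -> ~ Q (z + 1) -> F z = P (z + 1).
Proof.
move=> zP zQ; apply/eqP; rewrite -subr_eq0; apply/eqP.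
pose S : set Co := fun w => PF w \/ Q (w + 1).
apply: (@identity_A R S (fun w => F w - P (w + 1))).
- apply: discrete_setU => //; apply: (@discrete_set_shift R Q); exact: Q_discrete.
- move=> w /not_orP[w1 w2]; apply: holoB; first exact: hF.
  exact: holo_shift (P_holo w2).
- move=> X X0 _; rewrite FA// -[1]/(1%:C) -rmorphD -A_phi ?ltW// P_A ?phi_gt0//.
  by rewrite subrr.
- by move=> [].
Qed.

(** If [F] were regular at [z], the polar part of [P] at [z + 1] would vanish, but its coefficient
    is a positive residue. *)
Lemma Q_PF z : Q (z + 1) -> PF z.
Proof.
move=> zQ; apply: contrapT => zP.
have K : \forall w \near z^', F w = pole_sum (drop_pole B (z + 1)) (w + 1) + (residue B (z + 1))%:C / (w - z).
  have n1 := dnbhs_shift (pole_sum_polar (z + 1) BM).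
  have n2 := dnbhs_shift (discrete_near (z + 1) Q_discrete).
  have n3 := discrete_near z dPF.
  apply: filterS3 n1 n2 n3 => w e wQ wP; rewrite F_eq_P// [LHS]e.
  by rewrite opprD addrACA subrr addr0.
have := polar_part_eq0 (hF zP) (holo_shift (holo_drop_pole (z + 1) BM)) K.
move=> /(@complexI R) e; have := residue_gt0 BM (@B_weight_gt0 R) zQ.
by rewrite e ltxx.
Qed.

End MeromorphicF.

Section Meromorphicf.
Variables (f : Co -> Co) (Pf : set Co).
Hypothesis dPf : discrete_set Pf.
Hypothesis hf : forall z, ~ Pf z -> holo f z.
Hypothesis pf : forall z, Pf z -> is_pole f z.
Hypothesis fA : forall X : R, 0 < X -> f (A X)%:C = X%:C.

Lemma fP z : ~ Pf z -> ~ Q z -> f z * P z = 1.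
Proof.
move=> zP zQ; apply/eqP; rewrite -subr_eq0; apply/eqP.
pose S : set Co := fun w => Pf w \/ Q w.
apply: (@identity_A R S (fun w => f w * P w - 1)).
- by apply: discrete_setU => //; exact: Q_discrete.
- move=> w /not_orP[w1 w2]; apply: holoB; last exact: holo_cst.
  by apply: holoM; [exact: hf|exact: P_holo].
- move=> X X0 _; rewrite fA// P_A// -rmorphM mulfV ?subrr//; exact: lt0r_neq0.
- by move=> [].
Qed.

(** At [z = A X] this reads [phi X = X + 1 / phi X]. *)
Lemma f_add1 z : ~ Pf z -> ~ Pf (z + 1) -> ~ Q (z + 1) -> f (z + 1) = f z + P (z + 1).
Proof.
move=> z1 z2 z3; apply/eqP; rewrite -subr_eq0; apply/eqP.
pose S : set Co := fun w => Pf w \/ (Pf (w + 1) \/ Q (w + 1)).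
apply: (@identity_A R S (fun w => f (w + 1) - (f w + P (w + 1)))).
- apply: discrete_setU => //; apply: discrete_setU.
    exact: (@discrete_set_shift R Pf).
  by apply: (@discrete_set_shift R Q); exact: Q_discrete.
- move=> w /not_orP[w1 /not_orP[w2 w3]]; apply: holoB.
    by apply: holo_shift; exact: hf.
  by apply: holoD; [exact: hf|apply: holo_shift; exact: P_holo].
- move=> X X0 _; rewrite -[1]/(1%:C) -rmorphD -A_phi ?ltW// P_A ?phi_gt0// !fA ?phi_gt0//.
  have e : X + (phi X)^-1 = phi X by rewrite -{1}[X]phiV subrK.
  by rewrite -rmorphD e subrr.
- by move=> [|[]].
Qed.

Lemma f_near z :
  \forall w \near z^', [/\ ~ Pf w, ~ Q w & f w * P w = 1].
Proof.
apply: filterS2 (discrete_near z dPf) (discrete_near z Q_discrete) => w h1 h2.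
by split => //; exact: fP.
Qed.

(** At a pole of [P] the product [(w - z) * P w] extends to a holomorphic [H] whose value at [z] is
    the residue. Hence [f w = (w - z) / H w] nearby, which excludes a pole of [f] and gives the
    derivative. *)
Lemma f_zero z : Q z -> [/\ ~ Pf z, f z = 0 & cder f z ((residue B z)^-1)%:C].
Proof.
move=> zQ; have r0 := residue_gt0 BM (@B_weight_gt0 R) zQ.
set r := residue B z in r0 *.
pose H (w : Co) : Co := (w - z) * pole_sum (drop_pole B z) w + r%:C.
have dH : holo H z.
  apply: holoD; last exact: holo_cst.
  by apply: holoM; [exact: holo_subC|exact: (holo_drop_pole z BM)].
have Hz : H z = r%:C by rewrite /H subrr mul0r add0r.
have Hz0 : H z != 0 by rewrite Hz -cm_gt0 cm_real gtr0_norm.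
have dV : holo (fun w => (H w)^-1) z by exact: holoV.
have fg : \forall w \near z^', f w = (w - z) * (H w)^-1.
  apply: filterS3 (f_near z) (pole_sum_polar z BM) (dnbhs_neq z) => w [_ _ e1] e2 wz.
  have wz0 : w - z != 0 by rewrite subr_eq0.
  have e3 : (w - z) * P w = H w.
    by rewrite /P e2 mulrDr /H; congr (_ + _); rewrite mulrCA mulfV// mulr1.
  have P0 : P w != 0 by apply: contraTneq isT => e; move: e1; rewrite e mulr0 => /eqP; rewrite eq_sym oner_eq0.
  rewrite -e3 invfM mulrA mulfV// mul1r; apply: (mulIf P0).
  by rewrite e1 mulVf.
have dg : holo (fun w => (w - z) * (H w)^-1) z by apply: holoM => //; exact: holo_subC.
have zP : ~ Pf z by move=> /pf; exact: regular_not_pole dg fg.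
have [s s0 Hs] := ccont_eq_near (holo_ccont (hf zP)) (holo_ccont dg) fg.
have fz : f z = 0 by rewrite Hs ?subrr ?cm0 ?(ltW s0)// mul0r.
split=> // e e0; have [q q0 Hq] := holo_ccont dV e0.
exists (Num.min s q); first by rewrite lt_min s0.
move=> w; rewrite le_min => /andP[ws wq].
rewrite fz subr0 Hs// (_ : _ - _ = ((H w)^-1 - (H z)^-1) * (w - z)); last first.
  by rewrite Hz [RHS]mulrBl; congr (_ - _); [exact: mulrC|rewrite fmorphV].
by rewrite cmM ler_wpM2r ?cm_ge0//; exact: Hq.
Qed.

Lemma f_zeroP z : (~ Pf z /\ f z = 0) <-> Q z.
Proof.
split=> [[z1 z2]|/f_zero[]//]; apply: contrapT => zQ.
by have := fP z1 zQ; rewrite z2 mul0r => /eqP; rewrite eq_sym oner_eq0.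
Qed.

Lemma f_right z : 0 < complex.Re z -> ~ Pf z.
Proof.
move=> z0; have zQ := Q_Re z0.
have Pz : P z != 0.
  have := pole_sum_Re_gt0 BM (B_0 R) (@rho0_gt0 R) z0; rewrite -/(P z) => h.
  by apply: contraTneq h => ->; rewrite ltxx.
have dV : holo (fun w => (P w)^-1) z by apply: holoV => //; exact: P_holo.
move=> /pf; apply: (regular_not_pole dV).
apply: filterS (f_near z) => w [_ _ e].
have P0 : P w != 0 by apply: contraTneq isT => e0; move: e; rewrite e0 mulr0 => /eqP; rewrite eq_sym oner_eq0.
by apply: (mulIf P0); rewrite e mulVf.
Qed.

(* Iterating [f z = f (z + 1) - P (z + 1)] leads to the right half-plane; the
   residues of the translates of [P] are nonnegative, so they do not cancel. *)
Lemma f_polar z : exists (H : Co -> Co) (r : R),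
  [/\ holo H z, 0 <= r, \forall w \near z^', f w = H w - r%:C / (w - z) &
      0 < r <-> exists2 l : nat, (1 <= l)%N & Q (z + l%:R)].
Proof.
have [N] : exists N : nat, 0 < complex.Re z + N%:R.
  have := archi_boundP (normr_ge0 (complex.Re z)); set N := Num.Def.archi_bound _ => h.
  by exists N; have := ler_norm (- complex.Re z); rewrite normrN; lra.
elim: N z => [|N IH] z zN.
  rewrite addr0 in zN; exists f, 0; split=> //.
  - by apply: hf; exact: f_right.
  - by apply: nearW => w; rewrite mul0r subr0.
  rewrite ltxx; split=> // -[l _] /Q_Re; case.
  by rewrite ReD -(rmorph_nat (real_complex R)) /= ltr_wpDr.
have [|H [r [dH r0 Hr rl]]] := IH (z + 1).
  by rewrite ReD /= addrAC -addrA natr1.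
exists (fun w => H (w + 1) - pole_sum (drop_pole B (z + 1)) (w + 1)).
exists (r + residue B (z + 1)).
have s0 := residue_ge0 (z + 1) BM.
split.
- apply: holoB; first exact: holo_shift dH.
  exact: holo_shift (holo_drop_pole (z + 1) BM).
- exact: addr_ge0.
- have n1 := dnbhs_shift Hr.
  have n2 := dnbhs_shift (pole_sum_polar (z + 1) BM).
  have n3 : \forall w \near z^', ~ Pf w /\ [/\ ~ Pf (w + 1), ~ Q (w + 1) & f (w + 1) * P (w + 1) = 1].
    by apply: filterI; [exact: discrete_near|exact: (dnbhs_shift (f_near (z + 1)))].
  apply: filterS3 n1 n2 n3 => w e1 e2 [wP [w1P w1Q _]].
  have := f_add1 wP w1P w1Q; rewrite /P e1 e2 opprD addrACA subrr addr0 => e.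
  have -> : f w = H (w + 1) - r%:C / (w - z) - (pole_sum (drop_pole B (z + 1)) (w + 1) + (residue B (z + 1))%:C / (w - z)).
    by rewrite e addrK.
  by rewrite rmorphD mulrDl !opprD addrACA.
split.
  have [zQ _|zQ] := pselect (Q (z + 1)); first by exists 1%N.
  rewrite (residue_eq0 BM zQ) addr0 => /rl[l l1 lQ]; exists l.+1 => //.
  by rewrite -natr1 [l%:R + 1]addrC addrA.
move=> [l l1 lQ]; have [l2|] := ltnP 1 l.
  apply: ltr_wpDr => //; apply/rl; exists l.-1; first by rewrite -ltnS prednK.
  by rewrite -addrA -[1 + _]addrC natr1 prednK// ltnW.
move=> l2; have e : l = 1%N by apply/eqP; rewrite eqn_leq l1 l2.
by apply: ltr_wpDl => //; apply: (residue_gt0 BM (@B_weight_gt0 R)); rewrite e in lQ.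
Qed.

Lemma f_poleP z : Pf z <-> exists2 l : nat, (1 <= l)%N & Q (z + l%:R).
Proof.
have [H [r [dH r0 Hr rl]]] := f_polar z; split=> [zP|/rl rp].
  apply/rl; rewrite lt_def r0 andbT; apply: contraTneq isT => e.
  case: (regular_not_pole dH _ (pf zP)); apply: filterS Hr => w ->.
  by rewrite e mul0r subr0.
apply: contrapT => zP; have : - r%:C = 0 :> C.
  apply: (polar_part_eq0 (hf zP) dH); apply: filterS Hr => w ->.
  by rewrite mulNr.
by move=> /eqP; rewrite oppr_eq0 => /eqP/(@complexI R) e; move: rp; rewrite e ltxx.
Qed.

Lemma f_simple_pole z : Pf z -> simple_pole f z.
Proof.
move=> /f_poleP zl; have [H [r [dH r0 Hr rl]]] := f_polar z; have rp := rl.2 zl.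
exists (- r%:C); first by rewrite oppr_eq0 -cm_gt0 cm_real gtr0_norm.
apply/(@cvgC _ _ z^') => e e0.
have dK : holo (fun w => (w - z) * H w) z by apply: holoM => //; exact: holo_subC.
apply: filterS3 Hr (ccont_near (holo_ccont dK) e0) (dnbhs_neq z) => w -> + wz.
rewrite subrr mul0r subr0; congr (cm _ <= _).
by rewrite mulrBr opprK mulrCA mulfV ?subr_eq0// mulr1 subrK.
Qed.

End Meromorphicf.
End ZerosPoles.

(** * Expansions *)

Section Expansions.
Variable R : realType.
Local Notation C := R[i].
Local Notation Co := (R[i])^o.
Local Notation B := (@B R).
Local Notation Q := (pole_of B).
Implicit Types (z w : Co).

Let BM := B_family R.

Lemma clim_near (a b : nat -> C) (x : C) : (forall n, (0 < n)%N -> a n = b n) ->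
  clim a x -> clim b x.
Proof.
move=> ab ax e e0; have [N HN] := ax e e0; exists N.+1 => n Nn.
by rewrite -ab ?(leq_trans _ Nn)//; apply: HN; exact: ltnW.
Qed.

Lemma clim_pred (a : nat -> C) (x : C) : clim a x -> clim (fun n => a n.-1) x.
Proof.
move=> ax e e0; have [N HN] := ax e e0; exists N.+1 => n Nn; apply: HN.
by rewrite -ltnS prednK// (leq_trans _ Nn).
Qed.

Lemma clim_sum1 (a : nat -> C) (s : C) : clim (fun N : nat => \sum_(p < N) a p) s ->
  clim (fun N => \sum_(1 <= p < N) a p) (s - a 0%N).
Proof.
move=> H; apply: clim_near (climB H (clim_cst (a 0%N))) => n n0.
by rewrite -(big_mkord xpredT a) big_ltn// addrC addKr.
Qed.

Lemma P_expansion z : ~ Q z ->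
  clim (fun N => \sum_(1 <= p < N) blk B p z) (P z - (rho0 R)%:C / z).
Proof.
move=> zQ; have := @clim_sum1 (fun p => blk B p z) _ (pole_sum_cvg BM zQ).
by rewrite {2}/blk B_0 big_seq1 subr0.
Qed.

Lemma not_Q_nat (l : nat) : (0 < l)%N -> ~ Q (l%:R : Co).
Proof. by move=> l0; apply: Q_Re; rewrite -(rmorph_nat (real_complex R)) /= ltr0n. Qed.

(** Block 0, which carries [rho0], is included here and split off only in the final theorem. *)
Definition vblk z (l p : nat) : C :=
  \sum_(b <- B p) b.2%:C / ((l%:R - b.1)%:C * (z + l%:R - b.1%:C)).

(** Each term, multiplied by [z], is a difference of two simple fractions. The product form [V * z]
    covers [z = 0] as well, where convergence is the whole content. *)
Lemma vblk_cvg z l : (0 < l)%N -> ~ Q (z + l%:R) ->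
  exists2 V : C, clim (fun N : nat => \sum_(p < N) vblk z l p) V &
    V * z = P l%:R - P (z + l%:R).
Proof.
move=> l0 zQ; have [d d0 Hd] := pole_sep BM zQ.
have l1 : 1 <= l%:R :> R by rewrite ler1n.
have bound p : cm (vblk z l p) <= d^-1 * wt B p.
  rewrite /vblk /wt mulr_sumr; apply: le_trans (cm_sum _ _) _.
  rewrite big_seq [leRHS]big_seq; apply: ler_sum => b bp.
  have b1 := fam_le0 BM bp; have [_ b2] := BM.1 _ _ bp.
  have h0 : 0 < d * (1 - b.1) by rewrite mulr_gt0//; lra.
  have hq : 1 <= l%:R - b.1 by lra.
  have n1 : 0 < l%:R - b.1 by lra.
  rewrite cmM cmV cmM !cm_real (ger0_norm b2) (gtr0_norm n1) mulrCA -invfM.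
  rewrite ler_wpM2l// lef_pV2 ?posrE//; last first.
    by rewrite mulr_gt0// (lt_le_trans h0)// (Hd p).
  by rewrite -[leLHS]mul1r; apply: ler_pM => //; [exact: ltW|exact: (Hd p)].
have K0 : 0 <= d^-1 by rewrite invr_ge0 ltW.
have [V HV _] := abs_series K0 bound BM.2.
exists V => //; apply: clim_unique (climMr z HV) _.
apply: eq_clim (climB (pole_sum_cvg BM (not_Q_nat l0)) (pole_sum_cvg BM zQ)) => N.
rewrite -sumrB mulr_suml; apply: eq_bigr => p _.
rewrite -sumrB mulr_suml big_seq [RHS]big_seq; apply: eq_bigr => b bp.
have b1 := fam_le0 BM bp.
have n1 : (l%:R - b.1%:C : C) != 0.
  rewrite -(rmorph_nat (real_complex R)) -rmorphB -cm_gt0 cm_real gtr0_norm; lra.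
have n2 : (z + l%:R - b.1%:C : C) != 0.
  by rewrite -cm_gt0; apply: lt_le_trans (Hd p b bp); rewrite mulr_gt0//; lra.
rewrite rmorphB rmorph_nat; field; by rewrite n1 n2.
Qed.

Lemma rblk_nat_cvg l : (fun N : nat => \sum_(p < N) rblk B p l.+1%:R) @ \oo --> (S_ R l.+1)^-1.
Proof. by rewrite -A_S; apply: rblk_B_cvg; exact: S_gt0. Qed.

(** The terms [b.2 / (l.+2 - b.1)^2] are dominated by [b.2 / ((l.+1 - b.1) * (l.+2 - b.1))], a
    difference of terms of the pole series at [l.+1] and [l.+2]. *)
Lemma vblk0_bound l V : clim (fun N : nat => \sum_(p < N) vblk 0 l.+2 p) V ->
  cm V <= (S_ R l.+1)^-1 - (S_ R l.+2)^-1.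
Proof.
move=> HV; have l1 : 1 <= l.+1%:R :> R by rewrite ler1n.
pose t p := rblk B p l.+1%:R - rblk B p l.+2%:R.
have tE p : t p = \sum_(b <- B p) b.2 / ((l.+1%:R - b.1) * (l.+2%:R - b.1)).
  rewrite /t /rblk -sumrB big_seq [RHS]big_seq; apply: eq_bigr => b bp.
  have b1 := fam_le0 BM bp; rewrite -[l.+2%:R]natr1; field.
  by apply/andP; split; apply: lt0r_neq0; lra.
have bound p : cm (vblk 0 l.+2 p) <= 1 * t p.
  rewrite mul1r tE; apply: le_trans (cm_sum _ _) _.
  rewrite big_seq [leRHS]big_seq; apply: ler_sum => b bp.
  have b1 := fam_le0 BM bp; have [_ b2] := BM.1 _ _ bp.
  rewrite add0r -[X in _ * (X - _)](rmorph_nat (real_complex R)) -rmorphB.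
  have n2 : 0 < l.+2%:R - b.1 by rewrite -natr1; lra.
  have n1 : 0 < l.+1%:R - b.1 by lra.
  rewrite cmM cmV cmM !cm_real (ger0_norm b2) (gtr0_norm n2) ler_wpM2l//.
  rewrite lef_pV2 ?posrE ?mulr_gt0// ler_wpM2r ?(ltW n2)// -[l.+2%:R]natr1; lra.
have t0 p : 0 <= t p by have := bound p; rewrite mul1r; apply: le_trans; exact: cm_ge0.
have Ht : (fun N : nat => \sum_(p < N) t p) @ \oo --> (S_ R l.+1)^-1 - (S_ R l.+2)^-1.
  rewrite (_ : (fun N => _) = (fun N : nat => \sum_(p < N) rblk B p l.+1%:R - \sum_(p < N) rblk B p l.+2%:R)).
    by apply: cvgB; exact: rblk_nat_cvg.
  by apply/funext => N; rewrite -sumrB.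
have tM (N : nat) : \sum_(p < N) t p <= (S_ R l.+1)^-1 - (S_ R l.+2)^-1.
  rewrite -(cvg_lim _ Ht)//; apply: nondecreasing_cvgn_le; last by apply: cvgP Ht.
  by apply/nondecreasing_seqP => n; rewrite big_ord_recr/= lerDl.
have [s Hs] := abs_series ler01 bound tM.
by rewrite (clim_unique Hs HV) mul1r.
Qed.

(** The outer series at [z = 0], where dividing the telescoped identity by [z] is impossible. The
    term [l = 1] is bounded by its own modulus, the others by a telescoping sum. *)
Lemma vblk0_series (V : nat -> C) :
  (forall l, (0 < l)%N -> clim (fun N : nat => \sum_(p < N) vblk 0 l p) (V l)) ->
  exists U : C, clim (fun N : nat => \sum_(l < N) V l.+1) U.
Proof.
move=> HV; pose t l := if l is k.+1 then (S_ R k.+1)^-1 - (S_ R k.+2)^-1 else cm (V 1%N).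
have bound l : cm (V l.+1) <= 1 * t l.
  by rewrite mul1r; case: l => [//|l] /=; apply: vblk0_bound; exact: HV.
have tE (N : nat) : \sum_(l < N.+1) t l = cm (V 1%N) + (1 - (S_ R N.+1)^-1).
  elim: N => [|N IH]; first by rewrite big_ord_recl big_ord0 S_1 invr1 subrr !addr0.
  by rewrite big_ord_recr/= IH; lra.
have tM (N : nat) : \sum_(l < N) t l <= cm (V 1%N) + 1.
  case: N => [|N]; first by rewrite big_ord0 addr_ge0// cm_ge0.
  rewrite tE lerD2l gerBl invr_ge0; exact: S_ge0.
by have [U HU _] := abs_series ler01 bound tM; exists U.
Qed.

Section Meromorphicf.
Variables (f : Co -> Co) (Pf : set Co).
Hypothesis dPf : discrete_set Pf.
Hypothesis hf : forall z, ~ Pf z -> holo f z.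
Hypothesis pf : forall z, Pf z -> is_pole f z.
Hypothesis fA : forall X : R, 0 < X -> f (A X)%:C = X%:C.

Let f_poleP' := f_poleP dPf hf pf fA.

Lemma f_nat l : f l%:R = (S_ R l)%:C.
Proof.
case: l => [|l].
  have [] // := @f_zero _ _ _ dPf hf pf fA (0 : Co).
  exists 0%N, (0, rho0 R) => //; by rewrite B_0 mem_head.
by rewrite -(rmorph_nat (real_complex R)) -A_S fA// S_gt0.
Qed.

Lemma not_Pf_shift z l : ~ Pf z -> ~ Pf (z + l%:R).
Proof.
move=> zP /f_poleP'[k k1 H]; apply: zP; apply/f_poleP'.
by exists (l + k)%N; rewrite ?addn_gt0 ?k1 ?orbT// natrD addrA.
Qed.

Lemma not_Q_shift z l : ~ Pf z -> (0 < l)%N -> ~ Q (z + l%:R).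
Proof. by move=> zP l0 zQ; apply: zP; apply/f_poleP'; exists l. Qed.

Lemma f_telescope z (N : nat) : ~ Pf z ->
  \sum_(l < N) P (z + l.+1%:R) = f (z + N%:R) - f z.
Proof.
move=> zP; elim: N => [|N IH]; first by rewrite big_ord0 addr0 subrr.
have e : z + N.+1%:R = z + N%:R + 1 by rewrite -natr1 addrA.
rewrite big_ord_recr/= IH e (f_add1 dPf hf fA)//; first by rewrite addrAC.
- exact: not_Pf_shift.
- by rewrite -e; exact: not_Pf_shift.
- by rewrite -e; exact: not_Q_shift.
Qed.

Lemma not_Pf0 : ~ Pf 0.
Proof.
have [] // := @f_zero _ _ _ dPf hf pf fA (0 : Co).
by exists 0%N, (0, rho0 R) => //; rewrite B_0 mem_head.
Qed.

(** With [s = S_ N] and [p = P (z + N)] the difference is [s * (1/s - p) / p]. The relative error of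
    [p] is of order [1 / N], hence of order [1 / s^2] by [S_sqr_le], and [1 / |p|] is at most
    [2 * s]; the product is of order [1 / s]. *)
Lemma f_shift_cvg z : ~ Pf z -> clim (fun N => f (z + N%:R) - f N%:R) 0.
Proof.
move=> zP e e0; have c0 := cm_ge0 z.
(* The 8 is the product of the constants in [4 * |z| / s^2] and [2 * s]. *)
have k0 : 0 < e / (8 * (cm z + 1)) by rewrite divr_gt0// mulr_gt0// ltr_wpDl.
have [N1 _ HN1] := (cvgrPdist_lt _ _).1 (@it_inv_cvg0 R 0 (lexx 0)) _ k0.
have a0 : 0 <= 3 * cm z by rewrite mulr_ge0.
have := archi_boundP a0; set N2 := Num.Def.archi_bound _ => hN2.
exists (maxn N1 N2).+1 => N; case: N => // N; rewrite ltnS geq_max => /andP[n1 n2].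
rewrite subr0 f_nat.
have := HN1 N.+1 (leq_trans n1 (leqnSn _)); rewrite /= -/(S_ R N.+1) sub0r normrN.
set s := S_ R N.+1; have s0 : 0 < s by exact: S_gt0.
rewrite gtr0_norm ?invr_gt0// => hs.
have hN : 3 * cm z < N.+1%:R.
  by apply: lt_le_trans hN2 _; rewrite ler_nat (leq_trans n2).
have zN : cm z < N.+1%:R by lra.
have zQ : ~ Q (z + N.+1%:R) by exact: not_Q_shift.
have fP1 := fP dPf hf fA (@not_Pf_shift z N.+1 zP) zQ.
have PN : P (N.+1%:R : C) = (s^-1)%:C.
  by rewrite -(rmorph_nat (real_complex R)) -A_S P_A// S_gt0.
have := pole_sum_shift BM zN (@rblk_nat_cvg N).
rewrite rmorph_nat -/(P _) -/(P _) PN -/s.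
set p := P (z + N.+1%:R) in fP1 *; set d := cm _ => hd.
have q0 : 0 < N.+1%:R - cm z by lra.
have s2 : s ^+ 2 <= 2 * N.+1%:R by exact: S_sqr_le.
have si0 : 0 < s^-1 by rewrite invr_gt0.
have h1 : cm z / (N.+1%:R - cm z) <= 2^-1.
  by rewrite ler_pdivrMr// mulrC ler_pdivlMr//; lra.
have hp : s^-1 / 2 <= cm p.
  have := cmD ((s^-1)%:C - p) p; rewrite subrK cm_real gtr0_norm// -/d.
  have : cm z / (N.+1%:R - cm z) / s <= 2^-1 / s by rewrite ler_wpM2r// ltW.
  lra.
have p0 : 0 < cm p by apply: lt_le_trans hp; rewrite divr_gt0.
have pn : p != 0 by rewrite -cm_gt0.
have sn : (s%:C : C) != 0 by rewrite -cm_gt0 cm_real gtr0_norm.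
have -> : f (z + N.+1%:R) = p^-1 by apply: (mulIf pn); rewrite fP1 mulVf.
have -> : p^-1 - s%:C = s%:C * ((s^-1)%:C - p) / p.
  by rewrite fmorphV; field; rewrite pn sn.
rewrite !cmM cmV cm_real (gtr0_norm s0) -/d ler_pdivrMr//.
have h2 : s * d <= cm z / (N.+1%:R - cm z).
  have := ler_wpM2l (ltW s0) hd; rewrite mulrCA divff ?mulr1//; exact: lt0r_neq0.
apply: le_trans h2 _.
have h3 : cm z / (N.+1%:R - cm z) <= 4 * cm z / s ^+ 2.
  rewrite ler_pdivrMr// mulrAC ler_pdivlMr ?exprn_gt0//.
  have : cm z * s ^+ 2 <= cm z * (2 * N.+1%:R) by rewrite ler_wpM2l.
  have : 0 <= cm z * (2 * (N.+1%:R - 2 * cm z)) by rewrite !mulr_ge0//; lra.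
  lra.
apply: le_trans h3 _.
have h4 : 4 * cm z / s ^+ 2 <= (8 * (cm z + 1) * s^-1) * (s^-1 / 2).
  rewrite expr2 invfM.
  have : 0 < s^-1 * s^-1 by rewrite mulr_gt0.
  rewrite (_ : _ * (s^-1 / 2) = 4 * cm z * (s^-1 * s^-1) + 4 * (s^-1 * s^-1)); [lra|by field; exact: lt0r_neq0].
apply: le_trans h4 _; apply: ler_pM => //.
- by apply: mulr_ge0; [apply: mulr_ge0 => //; exact: addr_ge0|exact: ltW].
- by rewrite divr_ge0// ltW.
by rewrite mulrC -ler_pdivlMr ?(ltW hs)// mulr_gt0// ltr_wpDl.
Qed.

(** Multiplied by [z], the sum over [1 <= l <= N] telescopes to [f N - f (z + N) + f z], because
    [f 0 = 0]. *)
Lemma f_expansion z : ~ Pf z -> exists V : nat -> C,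
  (forall l, (0 < l)%N -> clim (fun N : nat => \sum_(p < N) vblk z l p) (V l)) /\
  exists2 U : C, clim (fun N => \sum_(1 <= l < N) V l) U & f z = z * U.
Proof.
move=> zP.
have [V HV] : exists V : nat -> C, forall l, (0 < l)%N ->
    clim (fun N : nat => \sum_(p < N) vblk z l p) (V l) /\ V l * z = P l%:R - P (z + l%:R).
  pose T l (v : C) := (0 < l)%N ->
    clim (fun N : nat => \sum_(p < N) vblk z l p) v /\ v * z = P l%:R - P (z + l%:R).
  suff /choice[V HV] : forall l, exists v, T l v by exists V.
  move=> l; rewrite /T.
  have [->|l0] := posnP l; first by exists 0.
  by have [v h1 h2] := vblk_cvg l0 (not_Q_shift zP l0); exists v.
exists V; split=> [l l0|]; first by have [] := HV l l0.
have sumE (N : nat) : \sum_(1 <= l < N) V l = \sum_(l < N.-1) V l.+1.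
  by rewrite big_add1 big_mkord.
have [z0|zn] := eqVneq z 0.
  have [|U HU] := @vblk0_series V.
    by move=> l l0; have [h _] := HV l l0; rewrite z0 in h.
  exists U; last by rewrite z0 mul0r (f_nat 0) S_0.
  by apply: eq_clim (clim_pred HU) => N; rewrite sumE.
exists (f z / z); last by rewrite mulrCA mulfV ?mulr1.
have H := climMr z^-1 (climB (clim_cst (f z)) (f_shift_cvg zP)).
rewrite subr0 in H; apply: eq_clim (clim_pred H) => N /=.
rewrite sumE; apply: (mulIf zn); rewrite divfK//.
rewrite mulr_suml (eq_bigr (fun l : 'I_N.-1 => P l.+1%:R - P (z + l.+1%:R))); last first.
  by move=> l _; have [] := HV l.+1 isT.
rewrite sumrB (@f_telescope z N.-1 zP).
have -> : \sum_(l < N.-1) P (l.+1%:R : C) = f N.-1%:R.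
  have := @f_telescope 0 N.-1 not_Pf0; rewrite (f_nat 0) S_0 subr0 add0r => <-.
  by apply: eq_bigr => l _; rewrite add0r.
by rewrite !opprB; exact: addrCA.
Qed.

End Meromorphicf.
End Expansions.

(** * Numbering of the poles and final assembly *)

Section Indexing.
Variable R : realType.
Local Notation C := R[i].
Local Notation Co := (R[i])^o.
Local Notation B := (@B R).

Definition pole_at p k : R * R := nth (0, 0) (B p) k.-1.

Lemma mem_pole_at p k : (1 <= p)%N -> (1 <= k <= 2 ^ p.-1)%N -> pole_at p k \in B p.
Proof.
case: p => // p _ /andP[k1 k2]; apply: mem_nth; rewrite size_B.
by case: k k1 k2.
Qed.

Lemma sum_pole_at (V : nmodType) (G : R * R -> V) p : (1 <= p)%N ->
  \sum_(1 <= k < (2 ^ p.-1).+1) G (pole_at p k) = \sum_(b <- B p) G b.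
Proof.
by case: p => // p _; rewrite (big_nth (0, 0)) size_B big_add1.
Qed.

Lemma pole_at_lt p k : (1 <= p)%N -> (1 <= k < 2 ^ p.-1)%N ->
  (pole_at p k).1 < (pole_at p k.+1).1.
Proof.
case: p => // p _; case: k => // k /=.
have /(sortedP (0, 0)) H := sorted_B R p.+1.
by move=> kp; apply: H; rewrite size_B.
Qed.

Lemma pole_ofP (z : Co) : pole_of B z <->
  z = 0 \/ exists p k, [/\ (1 <= p)%N, (1 <= k <= 2 ^ p.-1)%N & z = (pole_at p k).1%:C].
Proof.
split=> [[[|p] [b bp ->]]|[->|[p [k [p1 kp ->]]]]].
- by left; move: bp; rewrite B_0 inE => /eqP ->.
- right; exists p.+1, (index b (B p.+1)).+1; split=> //=.
    by rewrite -(size_B R) index_mem.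
  by rewrite /pole_at nth_index.
- by exists 0%N, (0, rho0 R); rewrite // B_0 mem_head.
- by exists p, (pole_at p k) => //; exact: mem_pole_at.
Qed.

Lemma csum_from1P (a b : nat -> C) (s : C) :
  (forall n, (1 <= n)%N -> a n = b n) ->
  clim (fun N => \sum_(1 <= n < N) b n) s -> csum_from1 a s.
Proof.
move=> ab H; apply/climP; apply: eq_clim H => N.
by apply: eq_big_nat => n /andP[n1 _]; rewrite ab.
Qed.

Lemma rsum_from1_dens (t : R) : 0 < t < 1 ->
  rsum_from1 (fun p => \sum_(1 <= k < (2 ^ p.-1).+1)
     (pole_at p k).2 * t `^ (- (pole_at p k).1)) (dens B t - rho0 R).
Proof.
move=> t01; have H := dens_cvg (B_family R) t01.
have t0 : tblk B 0 t = rho0 R by rewrite /tblk B_0 big_seq1 oppr0 powRr0 mulr1.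
have K : (fun N : nat => \sum_(p < N) tblk B p t - rho0 R) @ \oo --> dens B t - rho0 R.
  by apply: cvgB; [exact: H|exact: cvg_cst].
apply: cvg_trans K; apply: near_eq_cvg; exists 1%N => // N /= N1.
rewrite -t0 -(big_mkord xpredT (fun p => tblk B p t)) big_ltn// addrC addKr.
apply: eq_big_nat => p /andP[p1 _].
by rewrite (sum_pole_at (fun b => b.2 * t `^ (- b.1))).
Qed.

End Indexing.

Unset Implicit Arguments.

Theorem theorem1p4 (R : realType)
  (m : nat -> R)
  (hm0 : m 0%N = 1)
  (hmpos : forall n : nat, 0 < m n)
  (hmrec : forall n : nat, (1 <= n)%N ->
             (1 + \sum_(1 <= i < n.+1) m i) * m n = 1)
  (mu : probability R R)
  (hsupp : mu (~` `[0, 1]) = 0%E)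
  (hmom : forall n : nat,
     (\int[mu]_(t in `[0%R, 1%R]) ((t ^+ n)%:E) = (m n)%:E)%E)
  (f : (R[i])^o -> (R[i])^o) (Pf : set (R[i])^o)
  (hf : meromorphic f Pf)
  (hfint : forall z : (R[i])^o, 0 < complex.Re z -> f z = f_int mu z)
  (F : (R[i])^o -> (R[i])^o) (PF : set (R[i])^o)
  (hF : meromorphic F PF)
  (hFint : forall z : (R[i])^o, 0 < complex.Re z -> F z = F_int mu z) :
  exists (xi : nat -> nat -> R) (rho0 : R) (rho : nat -> nat -> R),
    (* location and ordering of the zeros xi_{p,k}, 1 <= k <= 2^(p-1) *)
    (forall p k : nat, (1 <= p)%N -> (1 <= k <= 2 ^ p.-1)%N ->
        - (p%:R) - 1 < xi p k < - (p%:R)) /\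
    (forall p k : nat, (1 <= p)%N -> (1 <= k < 2 ^ p.-1)%N ->
        xi p k < xi p k.+1) /\
    (* the zeros of f are exactly 0 and the xi_{p,k} *)
    (forall z : (R[i])^o, (~ Pf z /\ f z = 0) <->
        (z = 0 \/ exists p k : nat,
           [/\ (1 <= p)%N, (1 <= k <= 2 ^ p.-1)%N & z = (xi p k)%:C])) /\
    (* the poles of f are exactly -l and xi_{p,k} - l, l >= 1 *)
    (forall z : (R[i])^o, Pf z <->
        (exists l : nat, (1 <= l)%N /\
          (z = - (l%:R) \/ exists p k : nat,
             [/\ (1 <= p)%N, (1 <= k <= 2 ^ p.-1)%N &
                 z = (xi p k - l%:R)%:C]))) /\
    (* all poles are simple *)
    (forall z, Pf z -> simple_pole f z) /\
    (* rho_0 = 1/f'(0) > 0 and rho_{p,k} = 1/f'(xi_{p,k}) > 0;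
       in particular all zeros are simple *)
    (0 < rho0 /\ is_derive (0 : (R[i])^o) 1 f ((rho0^-1)%:C)) /\
    (forall p k : nat, (1 <= p)%N -> (1 <= k <= 2 ^ p.-1)%N ->
        0 < rho p k /\
        is_derive ((xi p k)%:C : (R[i])^o) 1 f (((rho p k)^-1)%:C)) /\
    (* partial fraction expansion of F *)
    (forall z : (R[i])^o, ~ PF z ->
       csum_from1
         (fun p => \sum_(1 <= k < (2 ^ p.-1).+1)
                     (rho p k)%:C / (z + 1 - (xi p k)%:C))
         (F z - rho0%:C / (z + 1))) /\
    (* expansion of f *)
    (forall z : (R[i])^o, ~ Pf z ->
       exists T : nat -> (R[i])^o,
         (forall l : nat, (1 <= l)%N ->
            csum_from1
              (fun p => \sum_(1 <= k < (2 ^ p.-1).+1)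
                 (rho p k)%:C /
                   ((l%:R - xi p k)%:C * (z + l%:R - (xi p k)%:C)))
              (T l)) /\
         exists2 U : (R[i])^o,
           csum_from1 (fun l => rho0%:C / (l%:R * (z + l%:R)) + T l) U &
           f z = z * U) /\
    (* density of mu on ]0,1[ *)
    (exists D : R -> R,
       [/\ (forall t : R, 0 < t < 1 ->
              rsum_from1
                (fun p => \sum_(1 <= k < (2 ^ p.-1).+1)
                            rho p k * t `^ (- xi p k))
                (D t - rho0)),
           (forall x y : R, 0 < x -> x <= y -> y < 1 -> D x <= D y),
           (forall (x y lam : R), 0 < x < 1 -> 0 < y < 1 -> 0 <= lam <= 1 ->
              D (lam * x + (1 - lam) * y) <= lam * D x + (1 - lam) * D y) &
           (forall A : set R, measurable A ->
              mu A = (\int[lebesgue_measure]_(x in A `&` `]0%R, 1%R[) (D x)%:E)%E)]).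
Proof.
have mS := moments_S hm0 hmpos hmrec.
have mom n : (\int[mu]_(t in `[0%R, 1%R]) ((t ^+ n)%:E) = ((S_ R n.+1)^-1)%:E)%E.
  by rewrite hmom mS.
have [/locally_finite_discrete dPf hf' pf] := hf.
have [/locally_finite_discrete dPF hF' _] := hF.
have hhf z : ~ Pf z -> holo f z by move=> /hf' /holoP.
have hhF z : ~ PF z -> holo F z by move=> /hF' /holoP.
have fA X : 0 < X -> f (A X)%:C = X%:C.
  by move=> X0; rewrite hfint ?f_int_A//= A_gt0.
have FA X : 0 < X -> F (A X)%:C = ((phi X)^-1)%:C.
  by move=> X0; rewrite hFint ?F_int_A//= A_gt0.
exists (fun p k => (pole_at R p k).1), (rho0 R), (fun p k => (pole_at R p k).2).
have bP p k : (1 <= p)%N -> (1 <= k <= 2 ^ p.-1)%N -> pole_at R p k \in B R p.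
  exact: mem_pole_at.
split; first by move=> [|p] k // _ kp; apply: B_loc; exact: bP.
split; first by move=> p k; exact: pole_at_lt.
split; first by move=> z; rewrite (f_zeroP dPf hhf pf fA) pole_ofP.
split.
  move=> z; rewrite (f_poleP dPf hhf pf fA); split.
    move=> [l l1 /pole_ofP[e|[p [k [p1 kp e]]]]]; exists l; split=> //.
      by left; apply/eqP; rewrite -addr_eq0 e.
    right; exists p, k; split=> //; rewrite rmorphB rmorph_nat.
    exact: (canRL (addrK _) e).
  move=> [l [l1 [e|[p [k [p1 kp e]]]]]]; exists l => //; apply/pole_ofP.
    by left; rewrite e addNr.
  by right; exists p, k; split=> //; rewrite e rmorphB rmorph_nat subrK.
split; first by move=> z; exact: (f_simple_pole dPf hhf pf fA).
(* The poles in [B] are distinct, so each weight is a full residue of [P], and [f_zero] inverts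
   it. *)
have der p b : b \in B R p -> is_derive (b.1%:C : (R[i])^o) 1 f ((b.2)^-1)%:C.
  move=> bp; rewrite -(residue_B bp); apply: cder_derive.
  have bQ : pole_of (B R) (b.1%:C : (R[i])^o) by exists p, b.
  by have [_ _] := f_zero dPf hhf pf fA bQ.
split.
  split; first exact: rho0_gt0.
  by have := der 0%N (0, rho0 R); rewrite B_0; apply; rewrite mem_head.
split.
  move=> p k p1 kp; split; first exact: (B_weight_gt0 (bP p k p1 kp)).
  exact: der (bP p k p1 kp).
split.
  move=> z zF; have zQ : ~ pole_of (B R) (z + 1) by move=> /(Q_PF dPF hhF FA).
  rewrite (F_eq_P dPF hhF FA zF zQ).
  apply: csum_from1P (P_expansion zQ) => p p1.
  by rewrite (sum_pole_at (fun b : R * R => b.2%:C / (z + 1 - b.1%:C))).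
split.
  move=> z zP; have [V [HV [U HU fU]]] := f_expansion dPf hhf pf fA zP.
  have v0 l : vblk z l 0 = (rho0 R)%:C / (l%:R * (z + l%:R)).
    by rewrite /vblk B_0 big_seq1 /= !subr0 rmorph_nat.
  (* The statement displays block 0 separately as the [rho0] term. *)
  exists (fun l => V l - vblk z l 0); split.
    move=> l l1; apply: csum_from1P (clim_sum1 (HV l l1)) => p p1.
    rewrite (sum_pole_at (fun b : R * R => b.2%:C / ((l%:R - b.1)%:C * (z + l%:R - b.1%:C))))//.
  exists U => //; apply: csum_from1P HU => l l1.
  by rewrite v0 addrC subrK.
exists (dens (B R)); split.
- by move=> t; exact: rsum_from1_dens.
- by move=> x y; exact: (le_dens (B_family R)).
(* Block 0 has exponent 0; by [B_loc] the exponents in block [p.+1] exceed [p.+1]. *)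
- move=> x y l; apply: (convex_dens (B_family R)) => -[|p] b.
    by rewrite B_0 inE => /eqP ->; left.
  move=> /B_loc/andP[_ h]; right; apply: le_trans (ltW h) _.
  by rewrite lerN2 ler1n.
move=> V mV; rewrite (mu_density hsupp mom mV).
transitivity (\int[lebesgue_measure]_(x in V) ((1 : R)%:E * (density x)%:E))%E.
  by apply: eq_integral => t _; rewrite mul1e.
rewrite (integral_density_mkcond (fun=> 1)).
by apply: eq_integral => t _; rewrite mul1r.
Qed.
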